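(* Let $(M,H=E\oplus F)$ be a five-dimensional Legendrean contact manifold and let $\sigma$ be a nowhere vanishing section of $\Lambda^0[1,1]=L^*$ (equivalently, $\sigma^{-1}$ is a choice of contact form). Then there is a unique partial connection $\nabla_H:\Lambda^1_H\to\Lambda^1_H\otimes\Lambda^1_H$, compatible with the Legendrean contact structure, such that (i) the induced partial connection on $\Lambda^4_H=L^2=\Lambda^0[-2,-2]$ annihilates $\sigma^{-2}$; and (ii) $\nabla_H$ has minimal partial torsion, in the sense that the induced operator $\nabla_\perp:\Lambda^1_H\to\Lambda^2_{H\perp}$ agrees with the Rumin operator $d_\perp$ modulo the homomorphisms $F^*\to\Lambda^2E^*$ and $E^*\to\Lambda^2F^*$ that are the obstructions to integrability of $E$ and $F$.
   Context: Everything is smooth and real. $M$ is a 5-manifold with contact distribution $H\subset TM$ (rank 4), $L\subset\Lambda^1$ is the annihilator of $H$, $\Lambda^k_H=\Lambda^kH^*$. The Levi form is the injective bundle map $L\to\Lambda^2_H$, $\alpha\mapsto d\alpha|_H$, with nondegenerate values; its square identifies $\Lambda^4_H=L^2$. Write $\Lambda^2_H=\Lambda^2_{H\perp}\oplus L$, where $\Lambda^2_{H\perp}$ consists of 2-forms on $H$ trace-free with respect to the Levi form. A Legendrean contact structure is a splitting $H=E\oplus F$ into rank 2 subbundles, each null with respect to the Levi form. Then $\Lambda^1_H=E^*\oplus F^*$ and $\Lambda^2_{H\perp}=\Lambda^2E^*\oplus(E^*\otimes F^* )_\circ\oplus\Lambda^2F^*$, where $\circ$ denotes the part trace-free with respect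 to the Levi form. Write $\Lambda^0[-1,-1]=L$, $\Lambda^0[1,1]=L^*$, $\Lambda^0[-2,-2]=L^2$. The Rumin operator $d_\perp:\Lambda^1_H\to\Lambda^2_{H\perp}$ is: lift $\omega\in\Lambda^1_H$ to a 1-form $\tilde\omega$ on $M$ and project $d\tilde\omega|_H$ to $\Lambda^2_{H\perp}$. Its components $F^*\to\Lambda^2E^*$ and $E^*\to\Lambda^2F^*$ are bundle homomorphisms, vanishing precisely when $E$, respectively $F$, is integrable. A partial connection on a vector bundle $V$ is a linear differential operator $\nabla_H:V\to\Lambda^1_H\otimes V$ with $\nabla_H(fs)=f\nabla_Hs+(df|_H)\otimes s$. A partial connection on $\Lambda^1_H$ induces $\nabla_\perp:\Lambda^1_H\to\Lambda^2_{H\perp}$, the composition of $\nabla_H$ with $\Lambda^1_H\otimes\Lambda^1_H\to\Lambda^2_H\to\Lambda^2_{H\perp}$. It is compatible with the Legendrean contact structure if it preserves the subbundles $E^*$ and $F^*$ of $\Lambda^1_H$ and if the induced partial connection on $\Lambda^2_H$ preserves the line subbundle $L\subset\Lambda^2_H$ given by the Levi form. ''Agrees modulo'' in (ii) means that the homomorphism $\nabla_\perp-d_\perp$ takes values in $\mathrm{Hom}(F^*,\Lambda^2E^* )\oplus\mathrm{Hom}(E^*,\Lambda^2F^* )\subset\mathrm{Hom}(\Lambda^1_H,\Lambda^2_{H\perp})$. *)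

(* Defs.v *)
From HB Require Import structures.
From mathcomp Require Import all_boot all_order all_algebra.
From mathcomp Require Import all_classical all_reals all_analysis.
Set Implicit Arguments. Unset Strict Implicit. Unset Printing Implicit Defensive.
Import Order.TTheory GRing.Theory Num.Theory.
Import numFieldNormedType.Exports.
Local Open Scope classical_set_scope.
Local Open Scope ring_scope.

(* C^k and C^oo on an open set, by iterated Frechet differentiability. *)
Fixpoint Ck_on (R : realType) (V W : normedModType R) (k : nat) (U : set V)
    (f : V -> W) : Prop :=
  match k with
  | 0 => forall x, U x -> {for x, continuous f}
  | k'.+1 => (forall x, U x -> differentiable f x) /\
             (forall v, Ck_on k' U (fun x => 'D_v f x))
  end.

Definition smooth_on (R : realType) (V W : normedModType R) (U : set V)
  (f : V -> W) : Prop := forall k, Ck_on k U f.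

(* The chart [chart_phi i] has domain [chart_dom i] and inverse [chart_psi i];
   the values of these total functions elsewhere carry no information.
   [chart_at x] is a chosen chart around [x], used below to trivialise T_x M. *)
Record smooth_manifold (R : realType) (n : nat) := SmoothManifold {
  carrier :> topologicalType;
  carrier_hausdorff : hausdorff_space carrier;
  carrier_second_countable : @second_countable carrier;
  chart : Type;
  chart_dom : chart -> set carrier;
  chart_phi : chart -> carrier -> 'rV[R]_n;
  chart_psi : chart -> 'rV[R]_n -> carrier;
  chart_at : carrier -> chart;
  chart_at_dom : forall x, chart_dom (chart_at x) x;
  chart_dom_open : forall i, open (chart_dom i);
  chart_img_open : forall i, open (chart_phi i @` chart_dom i);
  chart_phiK : forall i x, chart_dom i x -> chart_psi i (chart_phi i x) = x;
  chart_phi_continuous :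
    forall i x, chart_dom i x -> {for x, continuous (chart_phi i)};
  chart_psi_continuous :
    forall i z, (chart_phi i @` chart_dom i) z -> {for z, continuous (chart_psi i)};
  chart_transition_smooth : forall i j,
    smooth_on (chart_phi i @` (chart_dom i `&` chart_dom j))
              (chart_phi j \o chart_psi i)
}.

Section Calculus.
Variables (R : realType) (n : nat) (M : smooth_manifold R n).
Implicit Types (U : set M) (x : M) (i : chart M).

Definition smooth_fun (W : normedModType R) U (f : M -> W) : Prop :=
  forall i, smooth_on (chart_phi i @` (U `&` chart_dom i)) (f \o chart_psi i).

(* T_x M is represented by R^n through the chart [chart_at x]; a different
   chart around [x] acts through the differential of the transition map. *)
Definition tangent x : vectType R := 'rV[R]_n.
Definition cotangent x : vectType R := 'Hom(tangent x, R^o).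

(* (df)_x(v) *)
Definition dirder x (v : tangent x) (W : normedModType R) (f : M -> W) : W :=
  'D_v (f \o chart_psi (chart_at x)) (chart_phi (chart_at x) x).

Definition smooth_field U (X : forall x, tangent x) : Prop :=
  forall i, smooth_fun (U `&` chart_dom i) (fun x => dirder (X x) (chart_phi i)).

(* The vector at [chart_psi i z] with components [a] in the chart [i]. *)
Definition chart_vector i (z a : 'rV[R]_n) : tangent (chart_psi i z) :=
  'D_a (chart_phi (chart_at (chart_psi i z)) \o chart_psi i) z.

(* The [a]-component of the pullback of a 1-form by [chart_psi i]. *)
Definition form_in_chart (al : forall x, cotangent x) i (a z : 'rV[R]_n) : R^o :=
  al (chart_psi i z) (chart_vector i z a).

Definition smooth_form U (al : forall x, cotangent x) : Prop :=
  forall i a, smooth_on (chart_phi i @` (U `&` chart_dom i)) (form_in_chart al i a).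

(* (d al)_x(u, v) = D_u (al(v)) - D_v (al(u)) with u, v extended as constant
   coefficient fields in the chart [chart_at x]. *)
Definition ext_deriv (al : forall x, cotangent x) x (u v : tangent x) : R :=
  let i := chart_at x in let z := chart_phi i x in
  'D_u (form_in_chart al i v) z - 'D_v (form_in_chart al i u) z.

Definition vdistribution := forall x, {vspace tangent x}.

Definition smooth_subbundle (r : nat) (E : vdistribution) : Prop :=
  forall x, exists U, exists X : 'I_r -> forall y, tangent y,
    [/\ open U, U x, forall j, smooth_field U (X j)
      & forall y, U y -> basis_of (E y) [tuple X j y | j < r]].

End Calculus.

Section Contact.
Variables (R : realType) (n : nat) (M : smooth_manifold R n) (H : vdistribution M).
Implicit Types (U : set M) (x : M).

Definition Hfib x : vectType R := subvs_of (H x).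
Definition Hdual x : vectType R := 'Hom(Hfib x, R^o).

(* Fibres of Lambda^k_H are cut out of this space by [altform]. *)
Definition Hform (k : nat) x : lmodType R := (k.-tuple (Hfib x) -> R^o).

Definition tset (k : nat) (T : Type) (v : k.-tuple T) (i : 'I_k) (u : T) :=
  [tuple if j == i then u else tnth v j | j < k].

Definition altform (k : nat) x (f : Hform k x) : Prop :=
  (forall v i, linear (fun u : Hfib x => f (tset v i u))) /\
  (forall v i j, i != j -> tnth v i = tnth v j -> f v = 0).

(* Smooth sections of H, H^* and Lambda^k H^* over the open set U; a section
   over U is a section over M whose values outside U are irrelevant. *)
Definition Hsection U (X : forall x, Hfib x) : Prop :=
  smooth_field U (fun x => vsval (X x) : tangent x).

Definition Hdual_section U (w : forall x, Hdual x) : Prop :=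
  forall V X, open V -> V `<=` U -> Hsection V X ->
    smooth_fun V (fun x => w x (X x) : R^o).

Definition Hform_section (k : nat) U (s : forall x, Hform k x) : Prop :=
  (forall x, U x -> altform (s x)) /\
  (forall V (X : 'I_k -> forall x, Hfib x), open V -> V `<=` U ->
     (forall j, Hsection V (X j)) ->
     smooth_fun V (fun x => s x [tuple X j x | j < k] : R^o)).

(* A vector bundle over M, given by (ambient) fibres and its sheaf of smooth
   sections. *)
Record vbundle := VBundle {
  fib : M -> lmodType R;
  smooth_section : set M -> (forall x, fib x) -> Prop
}.
Arguments smooth_section : clear implicits.

Definition Lambda1_H : vbundle :=
  @VBundle (fun x => Hdual x : lmodType R) Hdual_section.
Definition Lambda_H (k : nat) : vbundle := @VBundle (Hform k) (@Hform_section k).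

(* Partial connections are operators on the sheaf of smooth sections; a section
   of Lambda^1_H (x) V is a section of Hom(H, V). *)
Definition partial_connection (V : vbundle)
    (D : (forall x, fib V x) -> forall x, Hfib x -> fib V x) : Prop :=
  forall U, open U -> forall s, smooth_section V U s ->
  [/\ (forall x, U x -> linear (D s x)) /\
      (forall X, Hsection U X -> smooth_section V U (fun x => D s x (X x))),
      (forall t, smooth_section V U t -> (forall x, U x -> s x = t x) ->
        forall x, U x -> D s x =1 D t x),
      (forall (a : R) t, smooth_section V U t -> forall x, U x -> forall v,
        D (fun y => a *: s y + t y) x v = a *: D s x v + D t x v)
    & (forall f : M -> R^o, smooth_fun U f -> forall x, U x -> forall v,
        D (fun y => (f y : R) *: s y) x v
        = (f x : R) *: D s x v + (dirder (vsval v : tangent x) f : R) *: s x)].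

Definition preserves (V : vbundle) (S : forall x, set (fib V x))
    (D : (forall x, fib V x) -> forall x, Hfib x -> fib V x) : Prop :=
  forall U, open U -> forall s, smooth_section V U s ->
    (forall x, U x -> S x (s x)) -> forall x, U x -> forall v, S x (D s x v).

Definition wedge (k : nat) x (w : 'I_k -> Hdual x) : Hform k x :=
  fun v => \det (\matrix_(i, j) (w i (tnth v j) : R)).

(* [D] is the partial connection on Lambda^k_H induced by [nabla]. *)
Definition induced (k : nat) (nabla : (forall x, Hdual x) -> forall x, Hfib x -> Hdual x)
    (D : (forall x, Hform k x) -> forall x, Hfib x -> Hform k x) : Prop :=
  partial_connection (V := Lambda_H k) D /\
  forall U, open U -> forall w : 'I_k -> forall x, Hdual x,
    (forall i, Hdual_section U (w i)) ->
    forall x, U x -> forall v,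
      D (fun y => wedge (fun i => w i y)) x v
      = \sum_(i < k) wedge (fun j => if j == i then nabla (w j) x v else w j x).

(* L, the annihilator of H *)
Definition restrictH x (a : cotangent x) : Hdual x := (a \o linfun vsval)%VF.
Definition Lfib x : {vspace cotangent x} := lker (linfun (@restrictH x)).

Lemma memL x (a : cotangent x) :
  reflect (forall v, v \in H x -> a v = 0) (a \in Lfib x).
Proof.
have lin : linear (@restrictH x).
  move=> c f g; apply/lfunP => v.
  by rewrite /restrictH !(comp_lfunE, add_lfunE, scale_lfunE).
pose hl := GRing.isLinear.Build _ _ _ _ _ lin.
pose r : {linear _ -> _} := HB.pack (@restrictH x) hl.
rewrite memv_ker (lfunE r) /=; apply: (iffP eqP) => [a0 v vH|a0].
  have /lfunP/(_ (vsproj (H x) v)) := a0.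
  by rewrite /= /restrictH comp_lfunE lfunE /= vsprojK // zero_lfunE.
apply/lfunP => v; rewrite /= /restrictH comp_lfunE lfunE /= zero_lfunE.
exact/a0/subvsP.
Qed.

Definition L_section U (al : forall x, cotangent x) : Prop :=
  smooth_form U al /\ forall x, U x -> al x \in Lfib x.

(* (d al)|_H *)
Definition levi (al : forall x, cotangent x) x : Hform 2 x :=
  fun v => ext_deriv al (vsval (tnth v ord0)) (vsval (tnth v ord_max)).
Arguments levi al x v : clear implicits.

(* The image of L_x in Lambda^2 H_x^* under the Levi form. *)
Definition levi_line x (J : Hform 2 x) : Prop :=
  exists U, exists al, [/\ open U, U x, L_section U al & J = levi al x].
Arguments levi_line : clear implicits.

Definition contact_distribution : Prop :=
  smooth_subbundle n.-1 H /\
  forall U al, open U -> L_section U al -> forall x, U x -> al x != 0 ->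
    forall u : Hfib x, (forall v, levi al x [tuple u; v] = 0) -> u = 0.

(* The trace J^{ab} B_{ab} with respect to an invertible J is, up to sign,
   tr(J^{-1} B) in any basis. *)
Definition gram x (B : Hform 2 x) : 'M[R]_(\dim {:Hfib x}) :=
  \matrix_(i, j) B [tuple tnth (vbasis {:Hfib x}) i; tnth (vbasis {:Hfib x}) j].

Definition tracefree x (B : Hform 2 x) : Prop :=
  forall J, levi_line x J -> \tr (invmx (gram J) *m gram B) = 0.

(* Projection of Lambda^2_H = Lambda^2_{H perp} (+) L onto the first summand. *)
Definition perp x (B : Hform 2 x) : Hform 2 x :=
  xget 0 [set C : Hform 2 x | [/\ altform C, tracefree C & levi_line x (B - C)]].

(* [nabla_perp], with (a (x) b)(u, v) |-> a(u) b(v) - a(v) b(u). *)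
Definition nabla_perp (nabla : (forall x, Hdual x) -> forall x, Hfib x -> Hdual x)
    (w : forall x, Hdual x) x : Hform 2 x :=
  perp (fun v => nabla w x (tnth v ord0) (tnth v ord_max)
                 - nabla w x (tnth v ord_max) (tnth v ord0)).

(* The Rumin operator applied to w is [rumin_lift wt] for any lift wt of w. *)
Definition lifts U (w : forall x, Hdual x) (wt : forall x, cotangent x) : Prop :=
  smooth_form U wt /\ forall x, U x -> restrictH (wt x) = w x.
Definition rumin_lift (wt : forall x, cotangent x) x : Hform 2 x := perp (levi wt x).

(* L^* and the inverse section of L *)
Definition Ldual_section (sg : forall x, 'Hom(subvs_of (Lfib x), R^o)) : Prop :=
  forall U (al : forall x, subvs_of (Lfib x)), open U ->
    smooth_form U (fun x => vsval (al x)) -> smooth_fun U (fun x => sg x (al x) : R^o).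

Definition Linv (sg : forall x, 'Hom(subvs_of (Lfib x), R^o)) x : cotangent x :=
  vsval (xget 0 [set a : subvs_of (Lfib x) | sg x a = 1]).

(* B /\ B for a 2-form B: the element of Lambda^4_H = L^2 that corresponds to
   al^2 when B = (d al)|_H. *)
Definition wedge_square x (B : Hform 2 x) : Hform 4 x := fun v =>
  let b (i j : nat) := B [tuple tnth v (inord i); tnth v (inord j)] in
  2 * (b 0%N 1%N * b 2%N 3%N - b 0%N 2%N * b 1%N 3%N + b 0%N 3%N * b 1%N 2%N).

End Contact.

Arguments levi {R n M} H al x v.
Arguments levi_line {R n M H} x J.
Arguments nabla_perp {R n M H} nabla w x v.
Arguments rumin_lift {R n M} H wt x v.
Arguments Linv {R n M H} sg x.

Section Legendrean.
Variables (R : realType) (n : nat) (M : smooth_manifold R n) (H E F : vdistribution M).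

Definition levi_null (D : vdistribution M) : Prop :=
  forall x (J : Hform H 2 x), levi_line x J ->
    forall u v : Hfib H x, vsval u \in D x -> vsval v \in D x -> J [tuple u; v] = 0.

Definition legendrean_splitting : Prop :=
  [/\ smooth_subbundle 2 E /\ smooth_subbundle 2 F,
      forall x, (E x + F x)%VS = H x /\ (E x :&: F x)%VS = 0%VS,
      levi_null E & levi_null F].

(* The annihilator in H^* of a subbundle D of H; for H = E (+) F, the subbundle
   E^* of H^* is [ann F] and F^* is [ann E]. *)
Definition ann (D : vdistribution M) x (w : Hdual H x) : Prop :=
  forall u : Hfib H x, vsval u \in D x -> w u = 0.

(* Lambda^2 E^* = [ann2 F] and Lambda^2 F^* = [ann2 E] in Lambda^2 H^*. *)
Definition ann2 (D : vdistribution M) x (B : Hform H 2 x) : Prop :=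
  altform B /\ forall u v : Hfib H x, vsval v \in D x -> B [tuple u; v] = 0.

Definition Estar := @ann F.
Definition Fstar := @ann E.
Definition Lambda2_Estar := @ann2 F.
Definition Lambda2_Fstar := @ann2 E.

Definition compatible
    (nabla : (forall x, Hdual H x) -> forall x, Hfib H x -> Hdual H x) : Prop :=
  [/\ preserves (V := Lambda1_H H) Estar nabla,
      preserves (V := Lambda1_H H) Fstar nabla
    & exists D2, induced (k := 2) nabla D2 /\
        preserves (V := Lambda_H H 2) (@levi_line _ _ _ H) D2].

Definition annihilates_sigma_sq (sg : forall x, 'Hom(subvs_of (Lfib H x), R^o))
    (nabla : (forall x, Hdual H x) -> forall x, Hfib H x -> Hdual H x) : Prop :=
  exists D4, induced (k := 4) nabla D4 /\
    forall x v, D4 (fun y => wedge_square (levi H (Linv sg) y)) x v = 0.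

(* [nabla_perp - d_perp] maps F^* to Lambda^2 E^* and E^* to Lambda^2 F^*. *)
Definition minimal_torsion
    (nabla : (forall x, Hdual H x) -> forall x, Hfib H x -> Hdual H x) : Prop :=
  forall U w wt, open U -> Hdual_section U w -> lifts U w wt ->
    ((forall x, U x -> Fstar (w x)) ->
      forall x, U x -> Lambda2_Estar (nabla_perp nabla w x - rumin_lift H wt x)) /\
    ((forall x, U x -> Estar (w x)) ->
      forall x, U x -> Lambda2_Fstar (nabla_perp nabla w x - rumin_lift H wt x)).

End Legendrean.

(* Main.v *)
From HB Require Import structures.
Require Import Defs.
From mathcomp Require Import all_boot all_order all_algebra.
From mathcomp Require Import all_classical all_reals all_analysis.
From mathcomp Require Import perm ring lra.
Set Implicit Arguments. Unset Strict Implicit. Unset Printing Implicit Defensive.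
Import Order.TTheory GRing.Theory Num.Theory.
Import numFieldNormedType.Exports.
Local Open Scope classical_set_scope.
Local Open Scope ring_scope.

(** Let J be the Levi form of the contact form theta = sigma^-1. A compatible
    partial connection with property (i) is the same as one that preserves E^*
    and F^* and has nabla J = 0: preserving the line of J means nabla J = a J
    for some a, and then nabla (J /\ J) = 2 a (J /\ J), which (i) makes zero.
    So the statement is an analogue of the existence and uniqueness of the
    Levi-Civita connection, and it is proved in the same way.

    In a frame X_0, X_1 of E and X_2, X_3 of F with J (X_j, X_(j+2)) = 1 the
    conditions become linear equations for the sixty-four coefficients
    (nabla_(X_j) w_i) (X_k), with the exterior derivatives of the dual coframe
    on the right-hand side. Splitting kills the coefficients with w_i and X_k
    of different type, the torsion condition gives those with X_j of the type
    opposite to w_i up to one unknown trace for each i, parallelism of J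
    carries this over to the other directions, and the rest of the torsion
    condition fixes the traces. This is [christoffel_unique], and
    [christoffel_system] checks that the values so found do satisfy all the
    equations.

    A solution of the system in a frame gives covariant derivatives of forms of
    every degree at once ([form_conn]), whose behaviour on wedge products is
    [form_conn_wedge]; they provide the induced connections that
    compatibility and (i) ask for. The properties of the frame connection are
    then restated without a frame in [levi_civita_on]; since these determine
    the coefficients in any other adapted frame, the connections of two frames
    agree on the overlap and glue ([glued_conn]).

    For uniqueness, an arbitrary connection with the required properties has
    to satisfy the system. The splitting and torsion equations are direct
    ([minimal_torsionP] compares forms modulo J, as the projection to the
    trace-free part does nothing else). For the metric equations,
    J = w_0 /\ w_2 + w_1 /\ w_3 and J /\ J = - 2 w_0 /\ w_1 /\ w_2 /\ w_3 express
    the two induced connections through the coefficients. That nabla J is a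
    multiple of J gives the metric equations up to a term with this multiple,
    and property (i) makes the trace of the connection matrix, and with it the
    multiple, vanish ([metric_of_induced]). *)

(** * Iterated differentiability *)

Section CkTheory.
Variables (R : realType).
Implicit Types (V W : normedModType R).

Lemma Ck_onS V W k (U : set V) (f : V -> W) : Ck_on k.+1 U f -> Ck_on k U f.
Proof.
elim: k f => [|k IH] f /=.
  by move=> [df _] x Ux; apply/differentiable_continuous/df.
by move=> [df Df]; split=> // v; apply: IH; apply: Df.
Qed.

Lemma Ck_on_sub V W k (U U' : set V) (f : V -> W) :
  U' `<=` U -> Ck_on k U f -> Ck_on k U' f.
Proof.
move=> sU; elim: k f => [|k IH] f /=; first by move=> cf x /sU; apply: cf.
by move=> [df Df]; split=> [x /sU /df //|v]; apply: IH; apply: Df.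
Qed.

Lemma Ck_on_pointwise V W k (U : set V) (f : V -> W) :
  (forall x, U x -> exists2 U', U' x & Ck_on k U' f) -> Ck_on k U f.
Proof.
elim: k f => [|k IH] f /= h; first by move=> x /h [U' U'x]; apply.
split=> [x /h [U' U'x [+ _]]|v]; first by apply.
by apply: IH => x /h [U' U'x [_ +]] => /(_ v); exists U'.
Qed.

(** The difference [g - f] vanishes near [x], so it is differentiable there
    with differential zero. *)
Lemma near_eq_differentiable V W (f g : V -> W) (x : V) :
  (\forall y \near x, f y = g y) -> differentiable f x -> differentiable g x.
Proof.
move=> fg df.
suff dgf : differentiable (g - f) x.
  have -> : g = f + (g - f) by apply/funext => y; rewrite !fctE subrKC.
  exact: differentiableD.
have gf0 : (g - f) x = 0 by rewrite !fctE (nbhs_singleton fg) subrr.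
have e : (g - f) \o shift x = cst ((g - f) x) + \0 +o_ 0 id.
  apply/eqaddoP => _/posnumP[e]; near=> h.
  rewrite gf0 !fctE /= addr0 subr0 (_ : f (h + x) = g (h + x)).
    by rewrite subrr normr0 mulr_ge0.
  near: h.
  have := fg; rewrite (near_shift 0) /= subr0; apply: filterS => y /=.
  by [].
apply/diff_locallyP.
rewrite (@diff_unique _ _ _ (g - f) \0 x _ e); last exact: cst_continuous.
split=> //; exact: cst_continuous.
Unshelve. all: by end_near. Qed.

Lemma open_nearP V (U : set V) (P : V -> Prop) x :
  open U -> U x -> (forall y, U y -> P y) -> \forall y \near x, P y.
Proof. by move=> oU Ux h; apply: filterS (open_nbhs_nbhs (conj oU Ux)). Qed.

Lemma Ck_on_eq V W k (U : set V) (f g : V -> W) : open U ->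
  (forall x, U x -> f x = g x) -> Ck_on k U f -> Ck_on k U g.
Proof.
move=> oU; elim: k f g => [|k IH] f g fg /=.
  move=> cf x Ux; change (g @ x --> g x); rewrite -(fg _ Ux).
  apply: cvg_trans (cf _ Ux); apply: near_eq_cvg.
  by apply: open_nearP oU Ux _ => y /fg.
move=> [df Df]; split=> [x Ux|v].
  by apply: near_eq_differentiable (df x Ux); apply: open_nearP oU Ux fg.
apply: (IH (fun x => 'D_v f x)) (Df v) => x Ux.
by apply: near_eq_derive; apply: open_nearP oU Ux fg.
Qed.

Lemma Ck_on_cst V W k (U : set V) (c : W) : Ck_on k U (fun _ : V => c).
Proof.
elim: k c => [|k IH] c /=; first by move=> x _; apply: cst_continuous.
split=> [x _|v]; first exact: differentiable_cst.
rewrite (_ : (fun x => 'D_v _ x) = fun _ => 0); first exact: IH.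
by apply/funext => x; apply: derive_cst.
Qed.

Section OpenSet.
Variables (V : normedModType R) (U : set V).
Hypothesis oU : open U.

Lemma Ck_onD W k (f g : V -> W) :
  Ck_on k U f -> Ck_on k U g -> Ck_on k U (fun x => f x + g x).
Proof.
elim: k f g => [|k IH] f g /=.
  by move=> cf cg x Ux; apply: continuousD; [apply: cf|apply: cg].
move=> [df Df] [dg Dg]; split=> [x Ux|v].
  by apply: differentiableD; [apply: df|apply: dg].
apply: Ck_on_eq oU _ (IH _ _ (Df v) (Dg v)) => x Ux.
by rewrite [RHS]deriveD//; apply: diff_derivable; [apply: df|apply: dg].
Qed.

Lemma Ck_onM k (f g : V -> R^o) :
  Ck_on k U f -> Ck_on k U g -> Ck_on k U (fun x => (f x : R) * g x : R^o).
Proof.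
elim: k f g => [|k IH] f g.
  by move=> cf cg x Ux; apply: (@continuousM R V); [apply: cf|apply: cg].
move=> Cf Cg; have [df Df] := Cf; have [dg Dg] := Cg; split=> [x Ux|v].
  by apply: (@differentiableM R V); [apply: df|apply: dg].
have h := Ck_onD (IH _ _ (Ck_onS Cf) (Dg v)) (IH _ _ (Ck_onS Cg) (Df v)).
apply: Ck_on_eq oU _ h => x Ux.
by rewrite [RHS](@deriveM R V)//; apply: diff_derivable; [apply: df|apply: dg].
Qed.

Lemma Ck_onV k (f : V -> R^o) : (forall x, U x -> f x != 0) ->
  Ck_on k U f -> Ck_on k U (fun x => (f x : R)^-1 : R^o).
Proof.
move=> f0; elim: k => [|k IH].
  move=> cf x Ux; apply: (@continuousV R V); [exact: f0|exact: cf].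
move=> Cf; have [df Df] := Cf; split=> [x Ux|v].
  by apply: (@differentiableV R V); [apply: df|apply: f0].
have hV := IH (Ck_onS Cf).
have h := Ck_onM (Ck_onM (Ck_on_cst k U (-1 : R^o)) (Ck_onM hV hV)) (Df v).
apply: Ck_on_eq oU _ h => x Ux.
rewrite [RHS](@deriveV R V) ?f0//; last by apply: diff_derivable; apply: df.
by rewrite scaleNr mulN1r expr2 invfM mulNr.
Qed.

Lemma Ck_on_sum W k (I : Type) (r : seq I) (P : pred I) (f : I -> V -> W) :
  (forall i, P i -> Ck_on k U (f i)) ->
  Ck_on k U (fun x => \sum_(i <- r | P i) f i x).
Proof.
move=> h; elim: r => [|i r IH].
  under [X in Ck_on _ _ X]funext do rewrite big_nil; exact: Ck_on_cst.
under [X in Ck_on _ _ X]funext do rewrite big_cons.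
by case: (boolP (P i)) => // Pi; apply: Ck_onD => //; apply: h.
Qed.

Lemma Ck_on_prod k (I : Type) (r : seq I) (P : pred I) (f : I -> V -> R^o) :
  (forall i, P i -> Ck_on k U (f i)) ->
  Ck_on k U (fun x => \prod_(i <- r | P i) (f i x : R) : R^o).
Proof.
move=> h; elim: r => [|i r IH].
  under [X in Ck_on _ _ X]funext do rewrite big_nil; exact: Ck_on_cst.
under [X in Ck_on _ _ X]funext do rewrite big_cons.
by case: (boolP (P i)) => // Pi; apply: Ck_onM => //; apply: h.
Qed.

End OpenSet.

Lemma coord_continuous' m (j : 'I_m) : continuous (fun A : 'rV[R]_m => A ord0 j : R^o).
Proof. exact: coord_continuous. Qed.

Lemma derive_coord V m (f : V -> 'rV[R]_m) x v j : differentiable f x ->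
  'D_v (fun y => f y ord0 j : R^o) x = ('D_v f x) ord0 j.
Proof.
by move=> df; rewrite derive_mx ?mxE//; apply: diff_derivable.
Qed.

Lemma Ck_on_coord V m k (U : set V) (f : V -> 'rV[R]_m) j : open U ->
  Ck_on k U f -> Ck_on k U (fun x => f x ord0 j : R^o).
Proof.
move=> oU; elim: k f => [|k IH] f.
  by move=> cf x Ux; apply: (@continuous_comp _ _ _ f (fun A : 'rV[R]_m => A ord0 j : R^o)) (cf x Ux) _; apply: coord_continuous'.
move=> [df Df]; split=> [x Ux|v].
  apply: (@differentiable_comp _ _ _ _ f (fun A : 'rV[R]_m => A ord0 j : R^o)) (df x Ux) _.
  exact: differentiable_coord.
by apply: Ck_on_eq oU _ (IH _ (Df v)) => x Ux; rewrite derive_coord//; apply: df.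
Qed.

Lemma Ck_on_scalel V W k (U : set V) (f : V -> R^o) (w : W) : open U ->
  Ck_on k U f -> Ck_on k U (fun x => (f x : R) *: w).
Proof.
move=> oU; elim: k f => [|k IH] f.
  by move=> cf x Ux; apply: (@continuous_comp _ _ _ f (fun c : R^o => (c : R) *: w)) (cf x Ux) _; apply: scalel_continuous.
move=> [df Df]; split=> [x Ux|v]; first by apply: differentiableZl; apply: df.
apply: Ck_on_eq oU _ (IH _ (Df v)) => x Ux.
rewrite deriveE; last by apply: df.
by rewrite deriveE ?diffZl//; [apply: df|apply: differentiableZl; apply: df].
Qed.

Lemma Ck_on_rV V m k (U : set V) (f : V -> 'rV[R]_m) : open U ->
  (forall j, Ck_on k U (fun x => f x ord0 j : R^o)) -> Ck_on k U f.
Proof.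
move=> oU h; rewrite (_ : f = fun x => \sum_j (f x ord0 j) *: delta_mx ord0 j).
  by apply: Ck_on_sum => // j _; apply: Ck_on_scalel.
by apply/funext => x; rewrite {1}[f x]row_sum_delta.
Qed.

Lemma derive_mul V (f g : V -> R^o) x v :
  differentiable f x -> differentiable g x ->
  'D_v (fun z => (f z : R) * g z : R^o) x
  = (f x : R) * ('D_v g x : R) + (g x : R) * ('D_v f x : R) :> R.
Proof. by move=> df dg; apply: (@deriveM R V f g); apply: diff_derivable. Qed.

Lemma derive_comp V m W (f : 'rV[R]_m -> W) (g : V -> 'rV[R]_m) x v :
  differentiable g x -> differentiable f (g x) ->
  'D_v (f \o g) x = \sum_j ('D_v g x) ord0 j *: 'D_(delta_mx ord0 j) f (g x).
Proof.
move=> dg df; rewrite deriveE; last exact: differentiable_comp.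
rewrite diff_comp//= -(deriveE v dg) [X in 'd f (g x) X = _]row_sum_delta linear_sum.
by apply: eq_bigr => j _; rewrite linearZ/= -deriveE.
Qed.

Lemma derive_comp1 V V' W (f : V' -> W) (g : V -> V') x v :
  differentiable g x -> differentiable f (g x) ->
  'D_v (f \o g) x = 'D_('D_v g x) f (g x).
Proof.
move=> dg df; rewrite !deriveE//; last exact: differentiable_comp.
by rewrite diff_comp.
Qed.

Lemma Ck_on_comp V m k (U : set V) (U' : set 'rV[R]_m) (f : 'rV[R]_m -> R^o)
    (g : V -> 'rV[R]_m) : open U -> (forall x, U x -> U' (g x)) ->
  Ck_on k U' f -> Ck_on k U g -> Ck_on k U (f \o g).
Proof.
move=> oU gU; elim: k f => [|k IH] f.
  by move=> cf cg x Ux; apply: (@continuous_comp _ _ _ g f) (cg x Ux) _; apply/cf/gU.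
move=> Cf Cg; have [df Df] := Cf; have [dg Dg] := Cg; split=> [x Ux|v].
  by apply: differentiable_comp; [apply: dg|apply/df/gU].
have h : Ck_on k U (fun x => \sum_j (('D_v g x) ord0 j : R) *
     ('D_(delta_mx ord0 j) f \o g) x : R^o).
  apply: Ck_on_sum => // j _; apply: Ck_onM => //.
    exact: Ck_on_coord (Dg v).
  exact: IH (Df _) (Ck_onS Cg).
apply: Ck_on_eq oU _ h => x Ux.
by rewrite derive_comp//; [apply: dg|apply/df/gU].
Qed.

End CkTheory.

(** * Symmetry of second derivatives *)

Section Schwarz.
Variables (R : realType) (V : normedModType R).
Implicit Types (f : V -> R^o) (x y u v : V).

Lemma differentiable_shift a x : differentiable (fun z : V => z + a) x.
Proof. by apply: differentiableD; [exact: ex_diff|exact: differentiable_cst]. Qed.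

Lemma derive_shiftr f a u x : differentiable f (x + a) ->
  differentiable (fun z => f (z + a)) x /\
  'D_u (fun z => f (z + a)) x = 'D_u f (x + a).
Proof.
move=> df; have ds := differentiable_shift a x; split.
  exact: (@differentiable_comp _ _ _ _ (fun z => z + a) f).
rewrite (@derive_comp1 _ _ _ _ f (fun z : V => z + a))//; congr ('D_ _ f _).
rewrite [LHS]deriveD; [|exact: derivable_id|exact: derivable_cst].
by rewrite derive_id derive_cst addr0.
Qed.

Lemma mvt_line f y u (h : R) : 0 < h ->
  (forall s : R, 0 <= s <= h -> differentiable f (y + s *: u)) ->
  exists2 c : R, 0 < c < h & f (y + h *: u) - f y = h * ('D_u f (y + c *: u) : R).
Proof.
move=> h0 df.
pose g (s : R) : V := y + s *: u.
have dg s : differentiable g s.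
  apply: (@differentiableD _ _ _ (cst y) (fun s : R => s *: u)); first exact: differentiable_cst.
  by apply: differentiableZl; exact: ex_diff.
have Dg s : 'D_(1 : R) g s = u.
  rewrite [LHS]deriveD; [|exact: derivable_cst|].
    rewrite derive_cst add0r deriveE; last by apply: differentiableZl; exact: ex_diff.
    by rewrite diffZl ?diff_val ?scale1r//; exact: ex_diff.
  by apply: diff_derivable; apply: differentiableZl; exact: ex_diff.
have dF s : s \in `[0, h]%R -> differentiable (f \o g) s.
  by rewrite in_itv/= => sI; apply: differentiable_comp => //; apply: df.
have [||c cI e] := @MVT R (f \o g) (fun s => 'D_u f (g s)) 0 h h0 _ _.
- move=> s sI.
  have sI' : s \in `[0, h]%R by apply: subset_itv_oo_cc.
  apply: DeriveDef; first by apply: diff_derivable; apply: dF.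
  rewrite derive_comp1 ?Dg//; apply: df; by move: sI'; rewrite in_itv.
- apply: derivable_within_continuous => s sI; apply: diff_derivable; exact: dF.
exists c; first by move: cI; rewrite in_itv.
by move: e; rewrite /= /g scale0r addr0 subr0 mulrC.
Qed.

(** The mean value theorem, applied along [u] to the increment of [f] in the
    direction [v] and then along [v] to ['D_u f]. *)
Lemma second_difference f (U : set V) x u v (h : R) : 0 < h -> Ck_on 2 U f ->
  (forall s t : R, 0 <= s <= h -> 0 <= t <= h -> U (x + s *: u + t *: v)) ->
  exists s t : R, [/\ 0 < s < h, 0 < t < h &
    f (x + h *: u + h *: v) - f (x + h *: u) - (f (x + h *: v) - f x)
    = h * (h * 'D_v ('D_u f) (x + s *: u + t *: v))].
Proof.
move=> h0 [df D1] hU; have [dDu _] := D1 u.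
have h00 : 0 <= (0:R) <= h by rewrite lexx ltW.
have hhh : 0 <= h <= h by rewrite lexx ltW.
pose F z : R^o := f (z + h *: v) - f z.
have dF s : 0 <= s <= h -> differentiable (fun z => f (z + h *: v)) (x + s *: u) /\
    differentiable f (x + s *: u).
  move=> sI; split; last first.
    by apply: df; have := hU s 0 sI h00; rewrite scale0r addr0.
  by apply: (derive_shiftr 0 _).1; apply: df; apply: hU.
have [s sI] := @mvt_line F x u h h0 (fun s sI => differentiableB (dF s sI).1 (dF s sI).2).
have sI' : 0 <= s <= h by have /andP[/ltW -> /ltW ->] := sI.
rewrite {3}/F deriveB; try by apply: diff_derivable; apply dF.
rewrite (derive_shiftr u _).2; last by apply: df; apply: hU.
have [t tI] := @mvt_line ('D_u f) (x + s *: u) v h h0 (fun t tI => dDu _ (hU s t sI' tI)).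
move=> -> e; exists s, t; split=> //; rewrite -e /F; ring.
Qed.

Lemma close_to_common (a b c e : R) :
  `|a - c| < e / 2 -> `|b - c| < e / 2 -> `|a - b| <= e.
Proof.
move=> p1 p2; have -> : a - b = (a - c) + (c - b) by rewrite addrA subrK.
by rewrite (le_trans (ler_normD _ _))// [leRHS]splitr lerD// ltW// distrC.
Qed.

(** The second difference of [f] is symmetric in [u] and [v], and for small
    steps it is the square of the step times a value of either mixed derivative
    near [x]; continuity of both derivatives does the rest. *)
Lemma derive_schwarz f (U : set V) x u v : open U -> U x -> Ck_on 2 U f ->
  'D_v ('D_u f) x = 'D_u ('D_v f) x.
Proof.
move=> oU Ux Cf.
have [_ Df] := Cf.
have cA : {for x, continuous ('D_v ('D_u f))} by have [_ /(_ v)] := Df u; apply.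
have cB : {for x, continuous ('D_u ('D_v f))} by have [_ /(_ u)] := Df v; apply.
apply/eqP; rewrite -subr_eq0 -normr_le0; apply/ler_addgt0Pr => e e0; rewrite add0r.
have e20 : 0 < e / 2 by rewrite divr_gt0.
pose P := [set y | [/\ U y, `|'D_v ('D_u f) x - 'D_v ('D_u f) y| < e / 2 &
  `|'D_u ('D_v f) x - 'D_u ('D_v f) y| < e / 2]].
have : nbhs x P.
  have nU : \forall y \near x, U y by exact: open_nearP oU Ux _.
  have nA : \forall y \near x, `|'D_v ('D_u f) x - 'D_v ('D_u f) y| < e / 2.
    by move/cvgrPdist_lt : cA; apply.
  have nB : \forall y \near x, `|'D_u ('D_v f) x - 'D_u ('D_v f) y| < e / 2.
    by move/cvgrPdist_lt : cB; apply.
  by apply: filterS3 nU nA nB.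
move=> /nbhs_ballP[r /= r0 rP].
pose h := r / (2 * (`|u| + `|v| + 1)).
have d0 : 0 < `|u| + `|v| + 1 by rewrite ltr_wpDl// addr_ge0.
have h0 : 0 < h by rewrite divr_gt0// mulr_gt0.
have hP s t : 0 <= s <= h -> 0 <= t <= h -> P (x + s *: u + t *: v).
  move=> /andP[s0 sh] /andP[t0 th]; apply: rP; rewrite -ball_normE /= -addrA opprD addrA subrr sub0r normrN.
  apply: le_lt_trans (ler_normD _ _) _; rewrite !normrZ !ger0_norm//.
  apply: (@le_lt_trans _ _ (h * (`|u| + `|v| + 1))).
    by rewrite !mulrDr -addrA lerD ?ler_wpM2r// (le_trans (y:= h * `|v|)) ?ler_wpM2r// lerDl mulr1 ltW.
  by rewrite /h invfM mulrA mulfVK ?gt_eqF// ltr_pdivrMr// ltr_pMr// ltr1n.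
have [s [t [/andP[s0 sh] /andP[t0 th] e1]]] := @second_difference f U x u v h h0 Cf
   (fun s t sI tI => let: And3 a _ _ := hP s t sI tI in a).
have hP' s' t' : 0 <= s' <= h -> 0 <= t' <= h -> P (x + s' *: v + t' *: u).
  by move=> ? ?; rewrite addrAC; apply: hP.
have [s' [t' [/andP[s0' sh'] /andP[t0' th'] e2]]] := @second_difference f U x v u h h0 Cf
   (fun s t sI tI => let: And3 a _ _ := hP' s t sI tI in a).
have e3 : 'D_v ('D_u f) (x + s *: u + t *: v) = 'D_u ('D_v f) (x + s' *: v + t' *: u) :> R.
  have hn : h != 0 by rewrite gt_eqF.
  have : h * (h * ('D_v ('D_u f) (x + s *: u + t *: v) : R))
       = h * (h * ('D_u ('D_v f) (x + s' *: v + t' *: u) : R)).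
    apply: (etrans (esym e1)); apply: (etrans _ e2); rewrite (addrAC x (h *: v)).
    set a := f _; set b := f _; set c := f _; set d := f _.
    by rewrite !opprD !opprK !addrA (addrAC a).
  by move=> /(mulfI hn) /(mulfI hn).
have [|| _ p1 _] := hP s t; [by rewrite !ltW..|].
have [|| _ _ p2] := hP' s' t'; [by rewrite !ltW..|].
by rewrite -e3 in p2; exact: close_to_common p1 p2.
Qed.

End Schwarz.

(** * Smooth functions and charts *)

Section SmoothFun.
Variables (R : realType) (n : nat) (M : smooth_manifold R n).
Implicit Types (U : set M) (x y : M) (i j : chart M).

Lemma chart_at_in x : chart_dom (chart_at x) x.
Proof. exact: chart_at_dom. Qed.

Lemma open_chart_image U i : open U -> open (chart_phi i @` (U `&` chart_dom i)).
Proof.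
move=> oU; rewrite openE => _ [x [Ux dx] <-]; rewrite /interior /=.
have img : (chart_phi i @` chart_dom i) (chart_phi i x) by exists x.
have c := chart_psi_continuous img.
have nU : nbhs (chart_psi i (chart_phi i x)) U.
  by rewrite chart_phiK//; apply: open_nbhs_nbhs.
have nI : nbhs (chart_phi i x) (chart_phi i @` chart_dom i).
  by apply: open_nbhs_nbhs; split=> //; exact: chart_img_open.
apply: filterS2 nI (c _ nU) => _ [y dy <-] /=; rewrite /preimage /= chart_phiK// => Uy.
by exists y.
Qed.

Lemma smooth_fun_sub (W : normedModType R) U U' (f : M -> W) :
  U' `<=` U -> smooth_fun U f -> smooth_fun U' f.
Proof.
move=> sU sf i k; apply: Ck_on_sub (sf i k).
by apply: image_subset => x [/sU ? ?].
Qed.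

Lemma smooth_fun_pointwise (W : normedModType R) U (f : M -> W) :
  (forall x, U x -> exists2 U', U' x & smooth_fun U' f) -> smooth_fun U f.
Proof.
move=> h i k; apply: Ck_on_pointwise => _ [x [/h[U' U'x sf] dx] <-].
by exists (chart_phi i @` (U' `&` chart_dom i)); [exists x|exact: sf].
Qed.

Lemma smooth_fun_eq (W : normedModType R) U (f g : M -> W) : open U ->
  (forall x, U x -> f x = g x) -> smooth_fun U f -> smooth_fun U g.
Proof.
move=> oU fg sf i k; apply: Ck_on_eq (sf i k); first exact: open_chart_image.
by move=> _ [x [Ux dx] <-] /=; rewrite chart_phiK//; apply: fg.
Qed.

Section Algebra.
Variable U : set M.
Hypothesis oU : open U.

Lemma smooth_fun_cst (W : normedModType R) (c : W) : smooth_fun U (fun=> c).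
Proof. by move=> i k; apply: Ck_on_cst. Qed.

Lemma smooth_funD (W : normedModType R) (f g : M -> W) :
  smooth_fun U f -> smooth_fun U g -> smooth_fun U (fun x => f x + g x).
Proof.
by move=> sf sg i k; apply: Ck_onD (sf i k) (sg i k); apply: open_chart_image.
Qed.

Lemma smooth_funM (f g : M -> R^o) :
  smooth_fun U f -> smooth_fun U g -> smooth_fun U (fun x => (f x : R) * g x : R^o).
Proof.
by move=> sf sg i k; apply: Ck_onM (sf i k) (sg i k); apply: open_chart_image.
Qed.

Lemma smooth_funN (f : M -> R^o) :
  smooth_fun U f -> smooth_fun U (fun x => - (f x : R) : R^o).
Proof.
move=> sf; apply: smooth_fun_eq oU _ (smooth_funM (smooth_fun_cst (-1 : R^o)) sf).
by move=> x _; rewrite mulN1r.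
Qed.

Lemma smooth_funB (f g : M -> R^o) :
  smooth_fun U f -> smooth_fun U g -> smooth_fun U (fun x => (f x : R) - g x : R^o).
Proof. by move=> sf sg; apply: smooth_funD => //; apply: smooth_funN. Qed.

Lemma smooth_funV (f : M -> R^o) : (forall x, U x -> f x != 0) ->
  smooth_fun U f -> smooth_fun U (fun x => (f x : R)^-1 : R^o).
Proof.
move=> f0 sf i k; apply: Ck_onV (sf i k); first exact: open_chart_image.
by move=> _ [x [Ux dx] <-] /=; rewrite chart_phiK//; apply: f0.
Qed.

Lemma smooth_fun_sum (W : normedModType R) (I : Type) (r : seq I) (P : pred I)
    (f : I -> M -> W) : (forall l, P l -> smooth_fun U (f l)) ->
  smooth_fun U (fun x => \sum_(l <- r | P l) f l x).
Proof.
move=> sf i k; apply: Ck_on_sum => [|j Pj]; first exact: open_chart_image.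
exact: sf.
Qed.

Lemma smooth_fun_prod (I : Type) (r : seq I) (P : pred I)
    (f : I -> M -> R^o) : (forall l, P l -> smooth_fun U (f l)) ->
  smooth_fun U (fun x => \prod_(l <- r | P l) (f l x : R) : R^o).
Proof.
move=> sf i k; apply: Ck_on_prod => [|j Pj]; first exact: open_chart_image.
exact: sf.
Qed.

Lemma smooth_fun_coord m (f : M -> 'rV[R]_m) (l : 'I_m) :
  smooth_fun U f -> smooth_fun U (fun x => f x ord0 l : R^o).
Proof.
by move=> sf i k; apply: Ck_on_coord (sf i k); apply: open_chart_image.
Qed.

Lemma smooth_fun_rV m (f : M -> 'rV[R]_m) :
  (forall l : 'I_m, smooth_fun U (fun x => f x ord0 l : R^o)) -> smooth_fun U f.
Proof.
move=> sf i k; apply: Ck_on_rV => [|j]; first exact: open_chart_image.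
exact: sf.
Qed.

End Algebra.

Lemma chart_transition U i j : open U -> U `<=` chart_dom i ->
  smooth_on (chart_phi j @` (U `&` chart_dom j)) (chart_phi i \o chart_psi j).
Proof.
move=> oU sU k; apply: Ck_on_sub (@chart_transition_smooth _ _ M j i k).
by apply: image_subset => x [/sU ? ?].
Qed.

(** Any other chart differs from [i] by a smooth transition map. *)
Lemma smooth_fun_in_chart U i (f : M -> R^o) : open U -> U `<=` chart_dom i ->
  smooth_on (chart_phi i @` U) (f \o chart_psi i) -> smooth_fun U f.
Proof.
move=> oU sU sf j k.
have oI := @open_chart_image U j oU.
have gU z : (chart_phi j @` (U `&` chart_dom j)) z ->
    (chart_phi i @` U) ((chart_phi i \o chart_psi j) z).
  by move=> [x [Ux dx] <-] /=; rewrite !chart_phiK//; exists x.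
apply: Ck_on_eq (Ck_on_comp oI gU (sf k) (@chart_transition U i j oU sU k)) => //.
by move=> _ [x [Ux dx] <-] /=; rewrite !chart_phiK//; apply: sU.
Qed.

Lemma chart_phi_smooth i : smooth_fun (chart_dom i) (chart_phi i).
Proof. by move=> j; apply: chart_transition => //; apply: chart_dom_open. Qed.

Lemma smooth_fun_differentiable (W : normedModType R) U (f : M -> W) x i :
  smooth_fun U f -> U x -> chart_dom i x ->
  differentiable (f \o chart_psi i) (chart_phi i x).
Proof. by move=> sf Ux dx; have [df _] := sf i 1%N; apply: df; exists x. Qed.

Lemma near_chart U i x (P : 'rV[R]_n -> Prop) : open U -> U x -> chart_dom i x ->
  (forall y, U y -> chart_dom i y -> P (chart_phi i y)) ->
  \forall z \near chart_phi i x, P z.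
Proof.
move=> oU Ux dx h; apply: (open_nearP (@open_chart_image U i oU)); first by exists x.
by move=> _ [y [Uy dy] <-]; apply: h.
Qed.

(** The components of [v] in the chart [i]. Since [tangent x] is modelled on the
    chart [chart_at x], this is the differential of a transition map; [cvec] is
    its inverse. *)
Definition vcomp i x (v : tangent x) : 'rV[R]_n := dirder v (chart_phi i).
Definition cvec i x (a : 'rV[R]_n) : tangent x :=
  'D_a (chart_phi (chart_at x) \o chart_psi i) (chart_phi i x).

(** Chain rule for the transition map from [chart_at x] to [i]. *)
Lemma dirder_chart (W : normedModType R) U (f : M -> W) x i (v : tangent x) :
  open U -> smooth_fun U f -> U x -> chart_dom i x ->
  dirder v f = 'D_(vcomp i v) (f \o chart_psi i) (chart_phi i x).
Proof.
move=> oU sf Ux dx; rewrite /vcomp /dirder; set c := chart_at x.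
have dc : chart_dom c x := chart_at_in x.
have e : chart_phi i x = (chart_phi i \o chart_psi c) (chart_phi c x).
  by rewrite /= chart_phiK.
rewrite e -derive_comp1 -?e; last exact: smooth_fun_differentiable Ux dx.
  apply: near_eq_derive; apply: (near_chart (U := U `&` chart_dom i)).
  - by apply: openI => //; exact: chart_dom_open.
  - by split.
  - by [].
  - by move=> y [Uy diy] dcy /=; rewrite !chart_phiK.
exact: smooth_fun_differentiable (@chart_phi_smooth i) dx dc.
Qed.

Lemma vcomp_linear i x : chart_dom i x -> linear (@vcomp i x).
Proof.
move=> dx a u v; rewrite /vcomp /dirder.
have d := smooth_fun_differentiable (@chart_phi_smooth i) dx (chart_at_in x).
by rewrite !deriveE// linearP.
Qed.

Lemma cvec_linear i x : chart_dom i x -> linear (@cvec i x).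
Proof.
move=> dx a u v; rewrite /cvec.
have d := smooth_fun_differentiable (@chart_phi_smooth (chart_at x)) (chart_at_in x) dx.
by rewrite !deriveE// linearP.
Qed.

Lemma derive_id_near i x (v : 'rV[R]_n) (f : 'rV[R]_n -> 'rV[R]_n) :
  chart_dom i x -> (\forall z \near chart_phi i x, f z = z) ->
  'D_v f (chart_phi i x) = v.
Proof. by move=> dx h; rewrite (near_eq_derive v h) derive_id. Qed.

Lemma vcompK i x (v : tangent x) : chart_dom i x -> cvec i x (vcomp i v) = v.
Proof.
move=> dx; rewrite /cvec -(@dirder_chart _ (chart_dom (chart_at x)))//.
- rewrite /dirder; apply: derive_id_near (chart_at_in x) _.
  apply: (near_chart openT) => //; first exact: chart_at_in.
  by move=> y _ dy /=; rewrite chart_phiK.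
- exact: chart_dom_open.
- exact: chart_phi_smooth.
- exact: chart_at_in.
Qed.

Lemma cvecK i x (a : 'rV[R]_n) : chart_dom i x -> vcomp i (cvec i x a) = a.
Proof.
move=> dx; rewrite /vcomp /dirder /cvec; set c := chart_at x.
have dc : chart_dom c x := chart_at_in x.
have e : chart_phi c x = (chart_phi c \o chart_psi i) (chart_phi i x).
  by rewrite /= chart_phiK.
rewrite e -derive_comp1 -?e.
- apply: derive_id_near => //.
  apply: (near_chart (chart_dom_open c)) => //.
  by move=> y dcy diy /=; rewrite !chart_phiK.
- exact: smooth_fun_differentiable (@chart_phi_smooth c) dc dx.
- exact: smooth_fun_differentiable (@chart_phi_smooth i) dx dc.
Qed.

End SmoothFun.

(** * Directional derivatives, vector fields and 1-forms *)

Section LinearPredicate.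
Variables (K : nzRingType) (V W : lmodType K) (f : V -> W).
Hypothesis lf : linear f.

(** Maps such as [fun u => J [tuple u; v]] are linear only by hypothesis and
    carry no bundled structure, hence these rules for the bare predicate. *)
Lemma lin0 : f 0 = 0.
Proof.
have := lf 1 0 0.
by rewrite !scale1r addr0 => /esym/eqP; rewrite -subr_eq0 addrK => /eqP.
Qed.

Lemma linD u v : f (u + v) = f u + f v.
Proof. by have := lf 1 u v; rewrite !scale1r. Qed.

Lemma linZ a u : f (a *: u) = a *: f u.
Proof. by have := lf a u 0; rewrite lin0 !addr0. Qed.

Lemma lin_sum (I : Type) (r : seq I) (P : pred I) (g : I -> V) :
  f (\sum_(i <- r | P i) g i) = \sum_(i <- r | P i) f (g i).
Proof. exact: (big_morph f linD lin0). Qed.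

Lemma lin_comb (I : Type) (r : seq I) (P : pred I) (c : I -> K) (g : I -> V) :
  f (\sum_(i <- r | P i) c i *: g i) = \sum_(i <- r | P i) c i *: f (g i).
Proof. by rewrite lin_sum; apply: eq_bigr => i _; apply: linZ. Qed.

End LinearPredicate.

Section Dirder.
Variables (R : realType) (n : nat) (M : smooth_manifold R n).
Implicit Types (U : set M) (x y : M) (i j : chart M).

Lemma vcomp_sum i x (I : Type) (r : seq I) (P : pred I) (f : I -> tangent x) :
  chart_dom i x -> vcomp i (\sum_(l <- r | P l) f l) = \sum_(l <- r | P l) vcomp i (f l).
Proof. by move=> dx; apply: lin_sum; apply: vcomp_linear. Qed.

Section AtPoint.
Variables (x : M) (U : set M).
Hypotheses (oU : open U) (Ux : U x).
Variables (v : tangent x).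

Lemma dirder_eq (W : normedModType R) (f g : M -> W) :
  (forall y, U y -> f y = g y) -> dirder v f = dirder v g.
Proof.
move=> fg; apply: near_eq_derive; apply: (near_chart oU Ux (chart_at_in x)).
by move=> y Uy dy /=; rewrite chart_phiK//; apply: fg.
Qed.

Lemma dirder_cst (W : normedModType R) (c : W) : dirder v (fun=> c) = 0.
Proof. exact: derive_cst. Qed.

Let smooth_dif (W : normedModType R) (f : M -> W) (sf : smooth_fun U f) :=
  smooth_fun_differentiable sf Ux (chart_at_in x).

Let smooth_der (W : normedModType R) (f : M -> W) (sf : smooth_fun U f) w :
  derivable (f \o chart_psi (chart_at x)) (chart_phi (chart_at x) x) w.
Proof. exact: diff_derivable (smooth_dif sf). Qed.

Lemma dirderD (W : normedModType R) (f g : M -> W) :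
  smooth_fun U f -> smooth_fun U g ->
  dirder v (fun y => f y + g y) = dirder v f + dirder v g.
Proof.
move=> sf sg; have e := deriveD (smooth_der sf (w:=v)) (smooth_der sg (w:=v)).
exact: e.
Qed.

Lemma dirderM (f g : M -> R^o) : smooth_fun U f -> smooth_fun U g ->
  dirder v (fun y => (f y : R) * g y : R^o)
  = (f x : R) * (dirder v g : R) + (g x : R) * (dirder v f : R).
Proof.
move=> sf sg; rewrite [LHS](deriveM (smooth_der sf (w:=v)) (smooth_der sg (w:=v))).
by rewrite /= chart_phiK//; apply: chart_at_in.
Qed.

Lemma dirder_linear (W : normedModType R) (f : M -> W) : smooth_fun U f ->
  linear (fun w : tangent x => dirder w f).
Proof.
move=> sf a u w; have d := smooth_dif sf.
by rewrite /dirder !deriveE// linearP.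
Qed.

Lemma dirder_sum (W : normedModType R) (I : Type) (r : seq I) (P : pred I)
    (f : I -> M -> W) : (forall l, P l -> smooth_fun U (f l)) ->
  dirder v (fun y => \sum_(l <- r | P l) f l y) = \sum_(l <- r | P l) dirder v (f l).
Proof.
move=> sf; elim: r => [|l r IH].
  by under eq_fun do rewrite big_nil; rewrite big_nil dirder_cst.
under eq_fun do rewrite big_cons; rewrite big_cons.
case: ifP => [Pl|_]; last exact: IH.
by rewrite dirderD ?IH//; [exact: sf|apply: smooth_fun_sum].
Qed.

End AtPoint.

Lemma smooth_field_sub U U' (X : forall x, tangent x) :
  U' `<=` U -> smooth_field U X -> smooth_field U' X.
Proof.
move=> sU sX i; apply: smooth_fun_sub (sX i) => x [U'x dx].
by split=> //; apply: sU.
Qed.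

Lemma smooth_field_eq U (X Y : forall x, tangent x) : open U ->
  (forall x, U x -> X x = Y x) -> smooth_field U X -> smooth_field U Y.
Proof.
move=> oU XY sX i; apply: smooth_fun_eq (sX i) => [|x [Ux _]].
  by apply: openI => //; apply: chart_dom_open.
by rewrite XY.
Qed.

Lemma smooth_field_comb U (I : finType) (f : I -> M -> R^o)
    (X : I -> forall x, tangent x) : open U ->
  (forall l, smooth_fun U (f l)) -> (forall l, smooth_field U (X l)) ->
  smooth_field U (fun x => \sum_l (f l x : R) *: X l x).
Proof.
move=> oU sf sX i.
have oUi : open (U `&` chart_dom i) by apply: openI => //; apply: chart_dom_open.
apply: smooth_fun_rV => // k.
have h : smooth_fun (U `&` chart_dom i)
  (fun x => \sum_l (f l x : R) * (vcomp i (X l x)) ord0 k : R^o).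
  apply: smooth_fun_sum => // l _; apply: smooth_funM => //.
    by apply: smooth_fun_sub (sf l) => x [].
  exact: smooth_fun_coord (sX l i).
apply: smooth_fun_eq oUi _ h => x [Ux dx].
rewrite -/(vcomp i _) vcomp_sum// summxE; apply: eq_bigr => l _.
by rewrite (linZ (vcomp_linear dx)) mxE.
Qed.

Lemma cvec_smooth i a : smooth_field (chart_dom i) (fun x => cvec i x a).
Proof.
move=> j.
have oD : open (chart_dom i `&` chart_dom j) by apply: openI; apply: chart_dom_open.
apply: smooth_fun_rV => // k; apply: (@smooth_fun_in_chart _ _ _ _ i) => //.
have oI : open (chart_phi i @` (chart_dom i `&` chart_dom j)).
  by rewrite setIC; apply: open_chart_image; exact: chart_dom_open.
move=> m.
have [_ /(_ a) C] := @chart_transition_smooth _ _ M i j m.+1.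
apply: Ck_on_eq oI _ (Ck_on_coord k oI C).
move=> _ [x [dx djx] <-] /=; rewrite chart_phiK//.
congr (_ ord0 k); rewrite -[in LHS](cvecK a dx).
by rewrite (dirder_chart _ (chart_dom_open j) (@chart_phi_smooth _ _ _ j) djx dx).
Qed.

Lemma form_in_chartE (al : forall x, cotangent x) i a x : chart_dom i x ->
  form_in_chart al i a (chart_phi i x) = al x (cvec i x a).
Proof.
move=> dx; rewrite /form_in_chart /chart_vector /cvec.
(* the fibre depends on the point, so the point is generalised to be replaced *)
have : chart_psi i (chart_phi i x) = x by rewrite chart_phiK.
by move: (chart_psi _ _) => y ->.
Qed.

Lemma form_expand x (al : cotangent x) i (v : tangent x) : chart_dom i x ->
  al v = \sum_k (vcomp i v) ord0 k * (al (cvec i x (delta_mx ord0 k)) : R) :> R.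
Proof.
move=> dx; rewrite -{1}(vcompK v dx) [X in cvec i x X]row_sum_delta.
rewrite (lin_comb (cvec_linear dx)) linear_sum.
by apply: eq_bigr => k _; rewrite linearZ.
Qed.

Lemma pairing_smooth U (al : forall x, cotangent x) (X : forall x, tangent x) :
  open U -> smooth_form U al -> smooth_field U X ->
  smooth_fun U (fun x => al x (X x)).
Proof.
move=> oU sal sX i m.
have oUi : open (U `&` chart_dom i) by apply: openI => //; apply: chart_dom_open.
have oI := @open_chart_image _ _ _ U i oU.
have h : Ck_on m (chart_phi i @` (U `&` chart_dom i)) (fun z => \sum_k
  ((fun x => vcomp i (X x) ord0 k : R^o) \o chart_psi i) z * (form_in_chart al i (delta_mx ord0 k) z : R) : R^o).
  apply: Ck_on_sum => // k _; apply: Ck_onM => //; last exact: sal.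
  have := smooth_fun_coord oUi k (sX i); move=> /(_ i m); apply: Ck_on_sub.
  by apply: image_subset => x [].
apply: Ck_on_eq oI _ h => _ [x [Ux dx] <-] /=; rewrite !chart_phiK//.
by rewrite [RHS](form_expand _ _ dx); apply: eq_bigr => k _; rewrite form_in_chartE.
Qed.

Lemma smooth_form_sub U U' (al : forall x, cotangent x) :
  U' `<=` U -> smooth_form U al -> smooth_form U' al.
Proof.
move=> sU sal i a k; apply: Ck_on_sub (sal i a k).
by apply: image_subset => x [/sU ? ?].
Qed.

Lemma smooth_formP U (al : forall x, cotangent x) : open U ->
  (forall i a, smooth_fun (U `&` chart_dom i) (fun x => al x (cvec i x a))) ->
  smooth_form U al.
Proof.
move=> oU h i a m; have oI := @open_chart_image _ _ _ U i oU.
have := h i a i m; rewrite -setIA setIid; apply: Ck_on_eq => //.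
by move=> _ [x [Ux dx] <-] /=; rewrite form_in_chartE// chart_phiK.
Qed.

Lemma smooth_form_eq U (al be : forall x, cotangent x) : open U ->
  (forall x, U x -> al x = be x) -> smooth_form U al -> smooth_form U be.
Proof.
move=> oU e sal i a m; apply: Ck_on_eq (sal i a m); first exact: open_chart_image.
by move=> _ [x [Ux dx] <-]; rewrite !form_in_chartE// e.
Qed.

Lemma smooth_form_pointwise U (al : forall x, cotangent x) :
  (forall x, U x -> exists2 U', U' x & smooth_form U' al) -> smooth_form U al.
Proof.
move=> h i a m; apply: Ck_on_pointwise => _ [x [/h[U' U'x sal] dx] <-].
by exists (chart_phi i @` (U' `&` chart_dom i)); [exists x|exact: sal].
Qed.

Lemma form_in_chart_comb (I : finType) (f : I -> M -> R^o)
    (al : I -> forall x, cotangent x) i a z :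
  form_in_chart (fun x => \sum_l (f l x : R) *: al l x) i a z
  = \sum_l (f l (chart_psi i z) : R) * (form_in_chart (al l) i a z : R).
Proof.
rewrite /form_in_chart sum_lfunE; apply: eq_bigr => l _.
by rewrite scale_lfunE.
Qed.

Lemma smooth_form_comb U (I : finType) (f : I -> M -> R^o)
    (al : I -> forall x, cotangent x) : open U ->
  (forall l, smooth_fun U (f l)) -> (forall l, smooth_form U (al l)) ->
  smooth_form U (fun x => \sum_l (f l x : R) *: al l x).
Proof.
move=> oU sf sal i a m; have oI := @open_chart_image _ _ _ U i oU.
under [X in Ck_on _ _ X]funext do rewrite form_in_chart_comb.
apply: Ck_on_sum => // l _; apply: Ck_onM => //; last exact: sal.
exact: sf.
Qed.

End Dirder.

(** * The exterior derivative of a 1-form *)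

Section ExtDeriv.
Variables (R : realType) (n : nat) (M : smooth_manifold R n).
Implicit Types (U : set M) (x y : M) (i j : chart M) (al be : forall x : M, cotangent x).

Lemma vcomp_at x (v : tangent x) : vcomp (chart_at x) v = v.
Proof.
apply: derive_id_near; first exact: chart_at_in.
apply: (near_chart openT) => //; first exact: chart_at_in.
by move=> y _ dy /=; rewrite chart_phiK.
Qed.

Lemma derive_sum_fun (V : normedModType R) (I : Type) (r : seq I) (f : I -> V -> R^o) z w :
  (forall l, differentiable (f l) z) ->
  'D_w (fun z => \sum_(l <- r) (f l z : R) : R^o) z
  = \sum_(l <- r) ('D_w (f l) z : R) :> R.
Proof.
move=> df.
have [_] : differentiable (fun z => \sum_(l <- r) (f l z : R) : R^o) z /\
  'D_w (fun z => \sum_(l <- r) (f l z : R) : R^o) z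
  = \sum_(l <- r) ('D_w (f l) z : R) :> R; last by [].
elim: r => [|l r [d IH]].
  under eq_fun do rewrite big_nil; rewrite big_nil; split; last exact: derive_cst.
  exact: differentiable_cst.
under eq_fun do rewrite big_cons; rewrite big_cons; split; first exact: differentiableD.
rewrite [LHS]deriveD; [|exact: diff_derivable|exact: diff_derivable].
by rewrite -IH.
Qed.

Lemma cvec_at x (v : tangent x) : cvec (chart_at x) x v = v.
Proof. by have := vcompK v (chart_at_in x); rewrite vcomp_at. Qed.

Lemma leibniz_algebra (a b c d f p q : R) :
  (a * b + f * p) - (c * d + f * q) = a * b - c * d + f * (p - q).
Proof. ring. Qed.

Lemma subr_cancel (a b s t p q p' q' : R) : a = p + s -> b = q + t -> s = t ->
  p' = p -> q' = q -> a - b = p' - q'.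
Proof. by move=> -> -> -> -> ->; ring. Qed.

Lemma skew_double_sum m (u v : 'I_m -> R) (Q : 'I_m -> 'I_m -> R) :
  \sum_a \sum_b u a * v b * Q a b - \sum_a \sum_b v a * u b * Q a b
  = \sum_a \sum_b u a * v b * (Q a b - Q b a).
Proof.
rewrite [X in _ - X]exchange_big -sumrB; apply: eq_bigr => a _.
rewrite -sumrB; apply: eq_bigr => b _; rewrite mulrBr.
by rewrite (mulrC (v b)).
Qed.

Lemma form_in_chart_expand al i a x : chart_dom i x ->
  form_in_chart al i a (chart_phi i x)
  = \sum_k a ord0 k * (form_in_chart al i (delta_mx ord0 k) (chart_phi i x) : R) :> R.
Proof.
move=> dx; rewrite (form_in_chartE _ _ dx) (form_expand _ _ dx) (cvecK _ dx).
by apply: eq_bigr => k _; rewrite (form_in_chartE _ _ dx).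
Qed.

Section AtPoint.
Variables (U : set M) (al : forall x : M, cotangent x) (x : M).
Hypotheses (oU : open U) (sal : smooth_form U al) (Ux : U x).

Lemma form_in_chart_dif i a : chart_dom i x ->
  differentiable (form_in_chart al i a) (chart_phi i x).
Proof. by move=> dx; have [d _] := sal i a 1%N; apply: d; exists x. Qed.

Lemma derive_form_in_chart i a w : chart_dom i x ->
  'D_w (form_in_chart al i a) (chart_phi i x)
  = \sum_k a ord0 k * ('D_w (form_in_chart al i (delta_mx ord0 k)) (chart_phi i x) : R) :> R.
Proof.
move=> dx; have d k := form_in_chart_dif (delta_mx ord0 k) dx.
have -> : 'D_w (form_in_chart al i a) (chart_phi i x) = 'D_w (fun z => \sum_k
    a ord0 k * (form_in_chart al i (delta_mx ord0 k) z : R) : R^o) (chart_phi i x).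
  apply: near_eq_derive; apply: (near_chart oU Ux dx) => y Uy dy.
  exact: form_in_chart_expand.
rewrite derive_sum_fun => [|k]; last exact: (differentiableZ _ (d k)).
by apply: eq_bigr => k _; apply: (deriveZ _ (diff_derivable (d k))).
Qed.

(** The components of [al] in [chart_at x] are its components in [i] times first
    derivatives of the transition map. Differentiating produces second
    derivatives of that map, which are symmetric and cancel. Hence [ext_deriv],
    although defined through [chart_at], can be computed in one chart near a
    point, which is what makes it smooth. *)
Lemma ext_deriv_chart i (u v : tangent x) : chart_dom i x ->
  ext_deriv al u v = 'D_(vcomp i u) (form_in_chart al i (vcomp i v)) (chart_phi i x)
    - 'D_(vcomp i v) (form_in_chart al i (vcomp i u)) (chart_phi i x) :> R.
Proof.
move=> dx; rewrite /ext_deriv; set c := chart_at x.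
have dc : chart_dom c x := chart_at_in x.
pose T : 'rV[R]_n -> 'rV[R]_n := chart_phi i \o chart_psi c.
pose A k := form_in_chart al i (delta_mx ord0 k).
pose B k z : R^o := T z ord0 k.
have zE : T (chart_phi c x) = chart_phi i x by rewrite /T /= chart_phiK.
pose W := chart_phi c @` (U `&` chart_dom i `&` chart_dom c).
have oW : open W.
  by apply: open_chart_image; apply: openI => //; exact: chart_dom_open.
have Wx : W (chart_phi c x) by exists x.
have ST k : Ck_on k W T.
  apply: Ck_on_sub (@chart_transition_smooth _ _ M c i k).
  by apply: image_subset => y [[_ ?] ?].
have SB k m : Ck_on m W (B k) by apply: Ck_on_coord.
have dT : differentiable T (chart_phi c x) by have [d _] := ST 1%N; apply: d.
have DT (w : tangent x) : 'D_w T (chart_phi c x) = vcomp i w by [].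
have DB k (w : tangent x) : 'D_w (B k) (chart_phi c x) = (vcomp i w) ord0 k.
  by rewrite /B derive_coord// DT.
have dA k : differentiable (A k) (T (chart_phi c x)).
  by rewrite zE; apply: form_in_chart_dif.
have dAT k : differentiable (A k \o T) (chart_phi c x) := differentiable_comp dT (dA k).
have dDB k w : differentiable ('D_w (B k)) (chart_phi c x).
  by have [_ /(_ w) [d _]] := SB k 2%N; apply: d.
have key (w a : tangent x) : 'D_w (form_in_chart al c a) (chart_phi c x) =
   \sum_k (vcomp i a) ord0 k * ('D_(vcomp i w) (A k) (chart_phi i x) : R)
   + \sum_k (A k (chart_phi i x) : R) * ('D_w ('D_a (B k)) (chart_phi c x) : R) :> R.
  have -> : 'D_w (form_in_chart al c a) (chart_phi c x) =
      'D_w (fun z => \sum_k ('D_a (B k) z : R) * ((A k \o T) z : R) : R^o) (chart_phi c x).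
    apply: near_eq_derive; apply: (open_nearP oW Wx) => _ [y [[Uy dy] dcy] <-].
    rewrite (form_in_chartE _ _ dcy) (form_expand _ _ dy).
    apply: eq_bigr => k _.
    have Ty : T (chart_phi c y) = chart_phi i y by rewrite /T /= (chart_phiK dcy).
    have dTy : differentiable T (chart_phi c y) by have [d _] := ST 1%N; apply: d; exists y.
    rewrite -(form_in_chartE _ _ dy) -Ty; congr (_ * _).
    rewrite [LHS](_ : _ = ('D_a T (chart_phi c y)) ord0 k); last first.
      rewrite /vcomp (dirder_chart _ (chart_dom_open i) (@chart_phi_smooth _ _ _ i) dy dcy).
      by rewrite (cvecK _ dcy).
    exact/esym/derive_coord.
  rewrite derive_sum_fun; last first.
    by move=> k; apply: differentiableM; [exact: dDB|exact: dAT].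
  rewrite -big_split; apply: eq_bigr => k _.
  apply: (etrans (derive_mul w (dDB k a) (dAT k))).
  have e1 : (A k \o T) (chart_phi c x) = A k (chart_phi i x) by rewrite -zE.
  have e2 : 'D_w (A k \o T) (chart_phi c x) = 'D_(vcomp i w) (A k) (chart_phi i x).
    by apply: (etrans (derive_comp1 w dT (dA k))); rewrite DT zE.
  by rewrite e1 e2 (DB k a).
have sw : \sum_k (A k (chart_phi i x) : R) * ('D_u ('D_v (B k)) (chart_phi c x) : R)
  = \sum_k (A k (chart_phi i x) : R) * ('D_v ('D_u (B k)) (chart_phi c x) : R) :> R.
  apply: eq_bigr => k _; apply: (congr1 ( *%R _)).
  exact: (@derive_schwarz _ _ (B k) W _ v u oW Wx (SB k 2%N)).
have e w a := @derive_form_in_chart i a w dx.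
exact: (subr_cancel (key u v) (key v u) sw (e _ _) (e _ _)).
Qed.

Lemma ext_deriv_expand i (u v : tangent x) : chart_dom i x ->
  ext_deriv al u v = \sum_a \sum_b (vcomp i u) ord0 a * (vcomp i v) ord0 b *
   (('D_(delta_mx ord0 a) (form_in_chart al i (delta_mx ord0 b)) (chart_phi i x) : R)
    - ('D_(delta_mx ord0 b) (form_in_chart al i (delta_mx ord0 a)) (chart_phi i x) : R)) :> R.
Proof.
move=> dx.
have e w a : 'D_w (form_in_chart al i a) (chart_phi i x) = \sum_k \sum_l w ord0 k * a ord0 l *
    ('D_(delta_mx ord0 k) (form_in_chart al i (delta_mx ord0 l)) (chart_phi i x) : R) :> R.
  apply: (etrans (derive_form_in_chart _ _ dx)).
  apply: (etrans _ (exchange_big _ _ _ _ _ _)); apply: eq_bigr => l _.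
  have d := form_in_chart_dif (delta_mx ord0 l) dx.
  rewrite deriveE// [X in 'd _ _ X]row_sum_delta linear_sum mulr_sumr.
  apply: eq_bigr => k _; rewrite linearZ -deriveE//.
  by rewrite mulrCA mulrA.
apply: (etrans (ext_deriv_chart u v dx)).
apply: (etrans (congr2 (fun p q : R => p - q) (e (vcomp i u) (vcomp i v)) (e (vcomp i v) (vcomp i u)))).
exact: (@skew_double_sum _ _ _ (fun k l =>
  'D_(delta_mx ord0 k) (form_in_chart al i (delta_mx ord0 l)) (chart_phi i x) : R)).
Qed.

Lemma ext_derivC (u v : tangent x) : ext_deriv al u v = - ext_deriv al v u.
Proof. by rewrite /ext_deriv opprB. Qed.

Lemma ext_deriv_linearl (v : tangent x) : linear (fun u : tangent x => ext_deriv al u v : R^o).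
Proof.
move=> c u w; rewrite !(ext_deriv_expand _ _ (chart_at_in x)) !vcomp_at.
rewrite scaler_sumr -big_split; apply: eq_bigr => a _ /=.
rewrite scaler_sumr -big_split; apply: eq_bigr => b _ /=.
by rewrite !mxE !mulrDl -!mulrA.
Qed.

Lemma ext_deriv_linearr (u : tangent x) : linear (fun v : tangent x => ext_deriv al u v : R^o).
Proof.
move=> c v w; rewrite !(ext_derivC u) ext_deriv_linearl opprD; congr (_ + _).
by rewrite -scalerN.
Qed.

End AtPoint.

Lemma ext_deriv_smooth U al X Y : open U -> smooth_form U al ->
  smooth_field U X -> smooth_field U Y ->
  smooth_fun U (fun x => ext_deriv al (X x) (Y x) : R^o).
Proof.
move=> oU sal sX sY i m.
have oUi : open (U `&` chart_dom i) by apply: openI => //; apply: chart_dom_open.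
have oI := @open_chart_image _ _ _ U i oU.
pose f z : R^o := \sum_a \sum_b
   ((((fun x => vcomp i (X x) ord0 a : R^o) \o chart_psi i) z : R) *
   (((fun x => vcomp i (Y x) ord0 b : R^o) \o chart_psi i) z : R)) *
   (('D_(delta_mx ord0 a) (form_in_chart al i (delta_mx ord0 b)) z : R)
    - ('D_(delta_mx ord0 b) (form_in_chart al i (delta_mx ord0 a)) z : R)).
have h : Ck_on m (chart_phi i @` (U `&` chart_dom i)) f.
  have c Z a : smooth_field U Z -> Ck_on m (chart_phi i @` (U `&` chart_dom i))
      ((fun x => vcomp i (Z x) ord0 a : R^o) \o chart_psi i).
    move=> sZ; have := smooth_fun_coord oUi a (sZ i); move=> /(_ i m); apply: Ck_on_sub.
    by apply: image_subset => x [].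
  have d a b : Ck_on m (chart_phi i @` (U `&` chart_dom i))
      ('D_(delta_mx ord0 a) (form_in_chart al i (delta_mx ord0 b))).
    by have [_] := sal i (delta_mx ord0 b) m.+1; apply.
  apply: Ck_on_sum => // a _; apply: Ck_on_sum => // b _.
  apply: Ck_onM => //; first by apply: Ck_onM => //; exact: c.
  apply: Ck_onD => //.
  apply: Ck_on_eq oI _ (Ck_onM oI (Ck_on_cst m _ (-1 : R^o)) (d b a)) => z _.
  by rewrite mulN1r.
apply: Ck_on_eq oI _ h => _ [x [Ux dx] <-] /=; rewrite /f /= chart_phiK//.
by rewrite (ext_deriv_expand oU sal Ux _ _ dx).
Qed.

Lemma ext_deriv_eq U al be x (u v : tangent x) : open U -> U x ->
  (forall y, U y -> al y = be y) -> ext_deriv al u v = ext_deriv be u v.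
Proof.
move=> oU Ux e; have dx := chart_at_in x.
have h a w : 'D_w (form_in_chart al (chart_at x) a) (chart_phi (chart_at x) x)
   = 'D_w (form_in_chart be (chart_at x) a) (chart_phi (chart_at x) x).
  apply: near_eq_derive; apply: (near_chart oU Ux dx) => y Uy dy.
  by rewrite !form_in_chartE// e.
exact: (congr2 (fun p q : R => p - q) (h v u) (h u v)).
Qed.

(** The Leibniz rule d (f al) = df /\ al + f d al, for a sum of such products. *)
Lemma ext_deriv_comb U (I : finType) (f : I -> M -> R^o) (al : I -> forall x, cotangent x)
    x (u v : tangent x) : open U -> U x ->
  (forall l, smooth_fun U (f l)) -> (forall l, smooth_form U (al l)) ->
  ext_deriv (fun y => \sum_l (f l y : R) *: al l y) u v
  = \sum_l ((dirder u (f l) : R) * (al l x v : R) - (dirder v (f l) : R) * (al l x u : R)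
     + (f l x : R) * ext_deriv (al l) u v) :> R.
Proof.
move=> oU Ux sf sal; have dx := chart_at_in x.
have df l : differentiable (f l \o chart_psi (chart_at x)) (chart_phi (chart_at x) x).
  exact: smooth_fun_differentiable (sf l) Ux dx.
have dal l a := form_in_chart_dif (sal l) Ux a dx.
have key (w a : tangent x) : 'D_w (form_in_chart (fun y => \sum_l (f l y : R) *: al l y) (chart_at x) a)
    (chart_phi (chart_at x) x) = \sum_l ((dirder w (f l) : R) * (al l x a : R) +
    (f l x : R) * ('D_w (form_in_chart (al l) (chart_at x) a) (chart_phi (chart_at x) x) : R)) :> R.
  have dfa l : differentiable (fun z => ((f l \o chart_psi (chart_at x)) z : R) *
      (form_in_chart (al l) (chart_at x) a z : R) : R^o) (chart_phi (chart_at x) x).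
    by apply: differentiableM; [exact: df|exact: dal].
  have -> : form_in_chart (fun y => \sum_l (f l y : R) *: al l y) (chart_at x) a
     = (fun z => \sum_l ((f l \o chart_psi (chart_at x)) z : R) *
      (form_in_chart (al l) (chart_at x) a z : R) : R^o).
    by apply/funext => z; apply: form_in_chart_comb.
  apply: (etrans (derive_sum_fun _ _ dfa)); apply: eq_bigr => l _.
  apply: (etrans (derive_mul w (df l) (dal l a))).
  have e1 : (f l \o chart_psi (chart_at x)) (chart_phi (chart_at x) x) = f l x.
    by rewrite /= (chart_phiK dx).
  have e2 : form_in_chart (al l) (chart_at x) a (chart_phi (chart_at x) x) = al l x a.
    by rewrite (form_in_chartE _ _ dx) cvec_at.
  by rewrite e1 e2 addrC mulrC.
apply: (etrans (congr2 (fun p q : R => p - q) (key u v) (key v u))).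
apply: (etrans (esym (sumrB _ _ _ _))); apply: eq_bigr => l _.
exact: leibniz_algebra.
Qed.

End ExtDeriv.

(** * Frames and dual coframes *)

Section Coframe.
Variables (R : realType) (n : nat) (M : smooth_manifold R n).
Implicit Types (U : set M) (x y : M) (i j : chart M).

Lemma smooth_fun_det U m (A : M -> 'M[R]_m) : open U ->
  (forall a b, smooth_fun U (fun x => A x a b : R^o)) ->
  smooth_fun U (fun x => \det (A x) : R^o).
Proof.
move=> oU sA; apply: smooth_fun_sum => // s _; apply: smooth_funM => //.
  exact: smooth_fun_cst.
by apply: smooth_fun_prod.
Qed.

Lemma smooth_fun_invmx U m (A : M -> 'M[R]_m) a b : open U ->
  (forall a b, smooth_fun U (fun x => A x a b : R^o)) ->
  (forall x, U x -> A x \in unitmx) ->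
  smooth_fun U (fun x => invmx (A x) a b : R^o).
Proof.
move=> oU sA uA.
have h : smooth_fun U (fun x => ((\det (A x))^-1 : R) *
    ((-1) ^+ (b + a) * \det (row' b (col' a (A x))) : R) : R^o).
  apply: smooth_funM => //.
    apply: smooth_funV => //; last exact: smooth_fun_det.
    by move=> x Ux; have := uA x Ux; rewrite unitmxE unitfE.
  apply: smooth_funM => //; first exact: smooth_fun_cst.
  apply: smooth_fun_det => // c d.
  by under eq_fun do rewrite !mxE; apply: sA.
apply: smooth_fun_eq oU _ h => x Ux.
by rewrite /invmx uA// !mxE.
Qed.

Lemma smooth_fun_neq0 U x (f : M -> R^o) : open U -> U x -> smooth_fun U f ->
  f x != 0 -> exists V, [/\ open V, V x, V `<=` U & forall y, V y -> f y != 0].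
Proof.
move=> oU Ux sf fx; set c := chart_at x; have dc := chart_at_in x.
have cf : {for chart_phi c x, continuous (f \o chart_psi c)}.
  by apply: (sf c 0%N); exists x.
have cp := chart_phi_continuous dc.
have ne : \forall y \near x, f (chart_psi c (chart_phi c y)) != 0.
  have H : nbhs ((f \o chart_psi c) (chart_phi c x)) [set r : R^o | r != 0].
    apply: open_nbhs_nbhs; split; first exact: open_neq.
    by rewrite /= chart_phiK.
  exact: (cp _ (cf _ H)).
exists (U `&` chart_dom c `&` [set y | f (chart_psi c (chart_phi c y)) != 0]^°).
split.
- by apply: openI; [apply: openI => //; exact: chart_dom_open|exact: open_interior].
- by [].
- by move=> y [[]].
- by move=> y [[Uy dy] /nbhs_singleton /=]; rewrite chart_phiK.
Qed.

Section Dual.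
Variables (U : set M) (X : 'I_n -> forall x, tangent x).
Hypotheses (oU : open U) (sX : forall k, smooth_field U (X k)).

Definition frame_mx x : 'M[R]_n := \matrix_k (X k x : 'rV[R]_n).
Definition coframe k x : cotangent x :=
  linfun (fun v : tangent x => ((v : 'rV[R]_n) *m invmx (frame_mx x)) ord0 k : R^o).

Lemma coframeE k x (v : tangent x) :
  coframe k x v = ((v : 'rV[R]_n) *m invmx (frame_mx x)) ord0 k.
Proof.
have l : linear (fun v : tangent x => ((v : 'rV[R]_n) *m invmx (frame_mx x)) ord0 k : R^o).
  by move=> a u w; rewrite mulmxDl -scalemxAl !mxE.
pose hl := GRing.isLinear.Build _ _ _ _ _ l.
pose r : {linear _ -> _} := HB.pack (fun v : tangent x =>
   ((v : 'rV[R]_n) *m invmx (frame_mx x)) ord0 k : R^o) hl.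
exact: (lfunE r v).
Qed.

Lemma mul_frame_mx x (a : 'rV[R]_n) : a *m frame_mx x = \sum_k a ord0 k *: X k x.
Proof. by rewrite mulmx_sum_row; apply: eq_bigr => k _; rewrite rowK. Qed.

Lemma coframe_expand x (v : tangent x) : frame_mx x \in unitmx ->
  v = \sum_k (coframe k x v : R) *: X k x.
Proof.
move=> u; rewrite -[LHS](mulmxKV u) mul_frame_mx.
by apply: eq_bigr => k _; rewrite coframeE.
Qed.

Lemma coframe_dual x k l : frame_mx x \in unitmx -> coframe k x (X l x) = (l == k)%:R.
Proof.
move=> u; rewrite coframeE -[X l x](@rowK _ _ _ (fun k => X k x) l) -row_mul.
by rewrite -/(frame_mx x) mulmxV// !mxE.
Qed.

(** In a chart the coframe is the inverse of the matrix of components of the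
    frame. *)
Lemma coframe_smooth k : (forall x, U x -> frame_mx x \in unitmx) ->
  smooth_form U (coframe k).
Proof.
move=> u; apply: smooth_formP => // i a.
have oUi : open (U `&` chart_dom i) by apply: openI => //; apply: chart_dom_open.
pose A x : 'M[R]_n := \matrix_l vcomp i (X l x).
have key x b : U x -> chart_dom i x ->
    b = (\row_l (coframe l x (cvec i x b) : R)) *m A x.
  move=> Ux dx; rewrite -[LHS](cvecK b dx) [X in vcomp i X](coframe_expand _ (u x Ux)).
  rewrite (lin_comb (vcomp_linear dx)) mulmx_sum_row.
  by apply: eq_bigr => l _; rewrite rowK mxE.
have uA x : U x -> chart_dom i x -> A x \in unitmx.
  move=> Ux dx; rewrite -row_full_unit -sub1mx; apply/row_subP => b.
  by rewrite (key x (row b 1%:M) Ux dx) submxMl.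
have h : smooth_fun (U `&` chart_dom i) (fun x => \sum_l a ord0 l * (invmx (A x) l k : R) : R^o).
  apply: smooth_fun_sum => // l _; apply: smooth_funM => //; first exact: smooth_fun_cst.
  apply: smooth_fun_invmx => // [b c|x [Ux dx]]; last exact: uA.
  under eq_fun do rewrite mxE.
  exact: (smooth_fun_coord oUi _ (sX b i)).
apply: smooth_fun_eq oUi _ h => x [Ux dx].
have -> : \sum_l a ord0 l * (invmx (A x) l k : R) = (a *m invmx (A x)) ord0 k.
  by rewrite mxE.
by rewrite {1}(key x a Ux dx) mulmxK ?uA// mxE.
Qed.

(** Independence of the fields is the nonvanishing of a determinant that is
    smooth when computed with the components in one chart. *)
Lemma frame_mx_open x : U x -> frame_mx x \in unitmx ->
  exists V, [/\ open V, V x, V `<=` U & forall y, V y -> frame_mx y \in unitmx].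
Proof.
move=> Ux u; set i := chart_at x; have dx : chart_dom i x := chart_at_in x.
have oUi : open (U `&` chart_dom i) by apply: openI => //; apply: chart_dom_open.
pose A y : 'M[R]_n := \matrix_l vcomp i (X l y).
have sA : smooth_fun (U `&` chart_dom i) (fun y => \det (A y) : R^o).
  apply: smooth_fun_det => // b c; under eq_fun do rewrite mxE.
  exact: (smooth_fun_coord oUi _ (sX b i)).
have Ax : \det (A x) != 0.
  have -> : A x = frame_mx x by apply/row_matrixP => k; rewrite !rowK vcomp_at.
  by rewrite -unitfE -unitmxE.
have [V [oV Vx sV hV]] := @smooth_fun_neq0 _ x _ oUi (conj Ux dx) sA Ax.
exists V; split=> // [y /sV []//|y Vy]; have [Uy dy] := sV y Vy.
rewrite -row_free_unit; apply: inj_row_free => a; rewrite mul_frame_mx => e.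
have uA : A y \in unitmx by rewrite unitmxE unitfE hV.
rewrite -[a](mulmxK uA) (_ : a *m A y = 0) ?mul0mx//.
rewrite mulmx_sum_row; under eq_bigr do rewrite rowK.
by rewrite -(lin_comb (vcomp_linear dy)) e (lin0 (vcomp_linear dy)).
Qed.

End Dual.
End Coframe.

Section BasisTuple.
Variables (R : fieldType) (V : vectType R) (k : nat) (W : {vspace V}) (X : 'I_k -> V).
Hypothesis bX : basis_of W [tuple X j | j < k].

Lemma basis_tuple_mem j : X j \in W.
Proof. by have := basis_mem bX (mem_tnth j _); rewrite tnth_mktuple. Qed.

Lemma basis_tuple_expand v : v \in W -> exists c : 'I_k -> R, v = \sum_j c j *: X j.
Proof.
move=> vW; exists (fun j => coord [tuple X j | j < k] j v).
rewrite {1}(coord_basis bX vW); apply: eq_bigr => j _.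
by rewrite -tnth_nth tnth_mktuple.
Qed.

Lemma basis_tuple_free (c : 'I_k -> R) : \sum_j c j *: X j = 0 -> forall j, c j = 0.
Proof.
move=> e; have /freeP := basis_free bX; apply.
by rewrite -[RHS]e; apply: eq_bigr => j _; rewrite -tnth_nth tnth_mktuple.
Qed.

End BasisTuple.

Section BasisPair.
Variables (R : fieldType) (V : vectType R) (W : {vspace V}) (X : 'I_2 -> V).
Hypothesis bX : basis_of W [tuple X j | j < 2].

Lemma sum_I2 (U : nmodType) (f : 'I_2 -> U) : \sum_j f j = f (inord 0) + f (inord 1).
Proof.
rewrite !big_ord_recl big_ord0 addr0; congr (f _ + f _); apply/val_inj;
by rewrite /= inordK.
Qed.

Lemma basis_pair_expand v : v \in W ->
  exists a b : R, v = a *: X (inord 0) + b *: X (inord 1).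
Proof.
by move=> /(basis_tuple_expand bX)[c ->]; exists (c (inord 0)), (c (inord 1)); rewrite sum_I2.
Qed.

Lemma basis_pair_free (a b : R) : a *: X (inord 0) + b *: X (inord 1) = 0 -> a = 0 /\ b = 0.
Proof.
move=> e; have h := basis_tuple_free bX (c := fun j : 'I_2 => if val j == 0%N then a else b).
rewrite sum_I2 /= !inordK//= in h.
by have := h e (inord 0); have := h e (inord 1); rewrite !inordK.
Qed.

End BasisPair.

Section Frames.
Variables (R : realType) (M : smooth_manifold R 5) (H E F : vdistribution M).
Hypothesis EF_H : forall x, (E x + F x)%VS = H x.
Hypothesis EF_0 : forall x, (E x :&: F x)%VS = 0%VS.
Implicit Types (U : set M) (x y : M).

Lemma EH x (v : tangent x) : v \in E x -> v \in H x.
Proof. by move=> vE; rewrite -EF_H -[v]addr0 memv_add ?mem0v. Qed.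

Lemma FH x (v : tangent x) : v \in F x -> v \in H x.
Proof. by move=> vF; rewrite -EF_H -[v]add0r memv_add ?mem0v. Qed.

Lemma EF_disjoint x (v : tangent x) : v \in E x -> v \in F x -> v = 0.
Proof. by move=> vE vF; apply/eqP; rewrite -memv0 -EF_0 memv_cap vE. Qed.

(** Puts the transversal field [Z] after the four fields of [H], as coframes are
    indexed by ['I_n]. *)
Definition fields5 (X : nat -> forall y : M, tangent y) (Z : forall y : M, tangent y)
  (k : 'I_5) (y : M) : tangent y := if (k < 4)%N then X k y else Z y.

Lemma big5 (V : nmodType) (f : 'I_5 -> V) (g : nat -> V) z :
  (forall k : 'I_5, f k = if (k < 4)%N then g k else z) ->
  \sum_k f k = \sum_(k < 4) g k + z.
Proof.
move=> h; rewrite big_ord_recr /= h ltnn; congr (_ + _).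
by apply: eq_bigr => k _; rewrite h /= ltn_ord.
Qed.

(** [X 0], [X 1] span [E]; [X 2], [X 3] span [F]; [Z] is transversal to [H], and
    [w], [tau] is the dual coframe. The indices are natural numbers so that
    expressions like [X k.+2] need no casts. *)
Record is_frame U (X : nat -> forall y, tangent y) (Z : forall y, tangent y)
    (w : nat -> forall y, cotangent y) (tau : forall y, cotangent y) : Prop := IsFrame {
  frame_open : open U;
  frame_smoothX : forall k, (k < 4)%N -> smooth_field U (X k);
  frame_smoothZ : smooth_field U Z;
  frame_smoothw : forall k, (k < 4)%N -> smooth_form U (w k);
  frame_smootht : smooth_form U tau;
  frame_expand : forall y, U y -> forall v : tangent y,
     v = \sum_(k < 4) (w k y v : R) *: X k y + (tau y v : R) *: Z y;
  frame_wX : forall y, U y -> forall i k, (i < 4)%N -> (k < 4)%N ->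
     w i y (X k y) = (k == i)%:R;
  frame_wZ : forall y, U y -> forall i, (i < 4)%N -> w i y (Z y) = 0;
  frame_tX : forall y, U y -> forall k, (k < 4)%N -> tau y (X k y) = 0;
  frame_tZ : forall y, U y -> tau y (Z y) = 1;
  frame_H : forall y, U y -> forall v : tangent y, (v \in H y) = (tau y v == 0 :> R);
  frame_E : forall y, U y -> forall v : tangent y, v \in E y <->
     [/\ tau y v = 0, w 2%N y v = 0 & w 3%N y v = 0];
  frame_F : forall y, U y -> forall v : tangent y, v \in F y <->
     [/\ tau y v = 0, w 0%N y v = 0 & w 1%N y v = 0] }.

(** A linear relation has no [Z] term, because the other terms lie in [H]; its
    terms in [E] are then minus its terms in [F], and so both vanish. *)
Lemma frame_unit x (X : nat -> forall y, tangent y) Z :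
  X 0%N x \in E x -> X 1%N x \in E x -> X 2%N x \in F x -> X 3%N x \in F x -> Z x \notin H x ->
  (forall a b : R, a *: X 0%N x + b *: X 1%N x = 0 -> a = 0 /\ b = 0) ->
  (forall a b : R, a *: X 2%N x + b *: X 3%N x = 0 -> a = 0 /\ b = 0) ->
  frame_mx (fields5 X Z) x \in unitmx.
Proof.
move=> e0 e1 f0 f1 zH iE iF; rewrite -row_free_unit; apply: inj_row_free => a.
rewrite mul_frame_mx (big5 (g := fun k => a ord0 (inord k) *: X k x) (z := a ord0 ord_max *: Z x)); last first.
  move=> k; rewrite /fields5; case: ifP => k4; first by rewrite inord_val.
  by congr (a _ _ *: _); apply/val_inj => /=; have := ltn_ord k; rewrite ltnS leq_eqVlt k4 orbF => /eqP.
set s := \sum_(_ < _) _ => e.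
have sH : s \in H x.
  rewrite /s !big_ord_recl big_ord0 /= /bump /=.
  by rewrite !rpredD ?rpredZ ?rpred0 ?(EH e0) ?(EH e1) ?(FH f0) ?(FH f1).
have z0 : a ord0 ord_max = 0.
  apply/eqP; apply: contraNT zH => nz.
  have -> : Z x = - (a ord0 ord_max)^-1 *: s.
    by move/eqP: e; rewrite addr_eq0 => /eqP ->; rewrite scaleNr scalerN opprK scalerA mulVf ?scale1r.
  by rewrite rpredZ.
rewrite z0 scale0r addr0 in e.
have sE : a ord0 (inord 0) *: X 0%N x + a ord0 (inord 1) *: X 1%N x
     = - (a ord0 (inord 2) *: X 2%N x + a ord0 (inord 3) *: X 3%N x).
  apply/eqP; rewrite -addr_eq0; apply/eqP; rewrite -[RHS]e /s !big_ord_recl big_ord0 /= /bump /=.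
  by rewrite addr0 !addrA.
have uE : a ord0 (inord 0) *: X 0%N x + a ord0 (inord 1) *: X 1%N x \in E x.
  by rewrite rpredD ?rpredZ.
have uF : a ord0 (inord 0) *: X 0%N x + a ord0 (inord 1) *: X 1%N x \in F x.
  by rewrite sE rpredN rpredD ?rpredZ.
have u0 := EF_disjoint uE uF; have [a0 a1] := iE _ _ u0.
have [a2 a3] : a ord0 (inord 2) = 0 /\ a ord0 (inord 3) = 0.
  by apply: iF; apply/eqP; rewrite -oppr_eq0 -sE u0.
apply/rowP => k; rewrite mxE.
have := ltn_ord k; rewrite ltnS leq_eqVlt => /orP[/eqP k4|k4].
  by rewrite -z0; congr (a _ _); apply/val_inj.
rewrite -(inord_val k); case: (val k) k4 => [|[|[|[|//]]]] _; assumption.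
Qed.

(** The descriptions of [E], [F] and [H] by vanishing components hold because
    [E] and [F] are complementary in [H]. *)
Lemma full_frame U (X : nat -> forall y, tangent y) Z : open U ->
  (forall k, (k < 4)%N -> smooth_field U (X k)) -> smooth_field U Z ->
  (forall y, U y -> [/\ X 0%N y \in E y, X 1%N y \in E y, X 2%N y \in F y & X 3%N y \in F y]) ->
  (forall y, U y -> Z y \notin H y) ->
  (forall y, U y -> forall a b : R, a *: X 0%N y + b *: X 1%N y = 0 -> a = 0 /\ b = 0) ->
  (forall y, U y -> forall a b : R, a *: X 2%N y + b *: X 3%N y = 0 -> a = 0 /\ b = 0) ->
  exists w tau, is_frame U X Z w tau.
Proof.
move=> oU sX sZ XEF ZH iE iF.
have u y : U y -> frame_mx (fields5 X Z) y \in unitmx.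
  by move=> Uy; have [? ? ? ?] := XEF y Uy; apply: (@frame_unit y X Z) => //; [exact: ZH|exact: iE|exact: iF].
have s5 k : smooth_field U (fields5 X Z k).
  by rewrite /fields5; case k4: (k < 4)%N; [exact: sX|exact: sZ].
pose w k := coframe (fields5 X Z) (inord k).
pose tau := coframe (fields5 X Z) ord_max.
have expand y : U y -> forall v : tangent y,
     v = \sum_(k < 4) (w k y v : R) *: X k y + (tau y v : R) *: Z y.
  move=> Uy v; rewrite {1}(coframe_expand v (u y Uy)).
  apply: (big5 (g := fun k => (w k y v : R) *: X k y)) => k; rewrite /fields5 /w.
  case: ifP => k4; first by rewrite inord_val.
  by congr (coframe _ _ _ _ *: _); apply/val_inj => /=; have := ltn_ord k; rewrite ltnS leq_eqVlt k4 orbF => /eqP.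
have dual y k (l : 'I_5) : U y -> coframe (fields5 X Z) k y (fields5 X Z l y) = (l == k)%:R.
  by move=> Uy; apply: coframe_dual; apply: u.
have X5 k y : (k < 4)%N -> X k y = fields5 X Z (inord k) y.
  by move=> k4; rewrite /fields5 inordK ?k4// (leq_trans k4).
have Z5 y : Z y = fields5 X Z ord_max y by rewrite /fields5.
have inj4 i k : (i < 4)%N -> (k < 4)%N -> (inord k == inord i :> 'I_5) = (k == i).
  by move=> i4 k4; rewrite -val_eqE /= !inordK// ltnW.
have inmax k : (k < 4)%N -> (inord k == ord_max :> 'I_5) = false.
  by move=> k4; have k5 : (k < 5)%N := ltnW k4; rewrite -val_eqE /= (inordK k5); exact: ltn_eqF.
have XH y k : U y -> (k < 4)%N -> X k y \in H y.
  move=> Uy; have [? ? ? ?] := XEF y Uy.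
  by case: k => [|[|[|[|//]]]] _; [exact: EH|exact: EH|exact: FH|exact: FH].
have tX y : U y -> forall k, (k < 4)%N -> tau y (X k y) = 0.
  by move=> Uy k k4; rewrite X5// dual// inmax.
have wX y : U y -> forall i k, (i < 4)%N -> (k < 4)%N -> w i y (X k y) = (k == i)%:R.
  by move=> Uy i k i4 k4; rewrite X5// dual// inj4.
have sumH y (v : tangent y) : U y -> \sum_(k < 4) (w k y v : R) *: X k y \in H y.
  by move=> Uy; apply: rpred_sum => k _; rewrite rpredZ// XH.
have memH y : U y -> forall v : tangent y, (v \in H y) = (tau y v == 0 :> R).
  move=> Uy v; apply/idP/eqP => [vH|t0]; last first.
    by rewrite (expand y Uy v) t0 scale0r addr0 sumH.
  apply/eqP; apply: contraNT (ZH y Uy) => nz.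
  have -> : Z y = (tau y v : R)^-1 *: (v - \sum_(k < 4) (w k y v : R) *: X k y).
    have -> : v - \sum_(k < 4) (w k y v : R) *: X k y = (tau y v : R) *: Z y.
      by apply/eqP; rewrite subr_eq addrC -(expand y Uy v).
    by rewrite scalerA mulVf ?scale1r.
  by rewrite rpredZ// rpredB// sumH.
have ex4 y (v : tangent y) : U y -> tau y v = 0 -> v = (w 0%N y v : R) *: X 0%N y
    + (w 1%N y v : R) *: X 1%N y + ((w 2%N y v : R) *: X 2%N y + (w 3%N y v : R) *: X 3%N y).
  move=> Uy t0; rewrite {1}(expand y Uy v) t0 scale0r addr0 !big_ord_recl big_ord0 /= /bump /=.
  by rewrite addr0 !addrA.
exists w, tau; split=> //.
- by move=> k _; apply: coframe_smooth.
- exact: coframe_smooth.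
- move=> y Uy i i4; rewrite Z5 dual// eq_sym; apply/eqP; rewrite pnatr_eq0 eqb0.
  by rewrite inmax.
- by move=> y Uy; rewrite Z5 dual// eqxx.
- move=> y Uy v; have [x0 x1 x2 x3] := XEF y Uy; split=> [vE|[t0 w2 w3]]; last first.
    by rewrite (ex4 y v Uy t0) w2 w3 !scale0r !addr0 rpredD ?rpredZ.
  have t0 : tau y v = 0 by apply/eqP; rewrite -memH// EH.
  have e := ex4 y v Uy t0; split=> //.
    set a := (X in X + _) in e; set b := (X in _ + X) in e.
    have b0 : b = 0.
      apply: EF_disjoint; last by rewrite rpredD ?rpredZ.
      have -> : b = v - a by rewrite e addrAC subrr add0r.
      by rewrite rpredB// rpredD ?rpredZ.
    by have [] := iF y Uy _ _ b0.
  set a := (X in X + _) in e; set b := (X in _ + X) in e.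
  have b0 : b = 0.
    apply: EF_disjoint; last by rewrite rpredD ?rpredZ.
    have -> : b = v - a by rewrite e addrAC subrr add0r.
    by rewrite rpredB// rpredD ?rpredZ.
  by have [] := iF y Uy _ _ b0.
- move=> y Uy v; have [x0 x1 x2 x3] := XEF y Uy; split=> [vF|[t0 w0 w1]]; last first.
    by rewrite (ex4 y v Uy t0) w0 w1 !scale0r !add0r rpredD ?rpredZ.
  have t0 : tau y v = 0 by apply/eqP; rewrite -memH// FH.
  have e := ex4 y v Uy t0.
  set a := (X in X + _) in e; set b := (X in _ + X) in e.
  have a0 : a = 0.
    apply: EF_disjoint; first by rewrite rpredD ?rpredZ.
    have -> : a = v - b by rewrite e addrK.
    by rewrite rpredB// rpredD ?rpredZ.
  by have [] := iE y Uy _ _ a0.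
Qed.

Hypothesis sE : smooth_subbundle 2 E.
Hypothesis sF : smooth_subbundle 2 F.
Hypothesis sH : smooth_subbundle 4 H.

(** The transversal field has constant components in a chart; independence of
    the five fields at [x] persists nearby. *)
Lemma frame_exists x : exists U X Z w tau, U x /\ is_frame U X Z w tau.
Proof.
have [U1 [X1 [oU1 U1x sX1 b1]]] := sE x; have [U2 [X2 [oU2 U2x sX2 b2]]] := sF x.
have [v0 v0H] : exists v0 : tangent x, v0 \notin H x.
  have [U3 [X3 [_ U3x _ b3]]] := sH x.
  have dH : \dim (H x) = 4%N := size_basis (b3 x U3x).
  have : ~~ (fullv <= H x)%VS.
    apply/negP => /dimvS; rewrite dH dimvf.
    by rewrite /dim /= mul1n.
  by case/subvPn => v _ vH; exists v.
set i := chart_at x; have dx : chart_dom i x := chart_at_in x.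
pose Z y : tangent y := cvec i y (vcomp i v0).
have Zx : Z x = v0 by rewrite /Z vcompK.
pose X k y : tangent y := if (k < 2)%N then X1 (inord k) y else X2 (inord (k - 2)) y.
pose U0 := U1 `&` U2 `&` chart_dom i.
have oU0 : open U0 by apply: openI; [exact: openI|exact: chart_dom_open].
have sX k : smooth_field U0 (X k).
  by rewrite /X; case: (k < 2)%N; [apply: smooth_field_sub (sX1 _)|apply: smooth_field_sub (sX2 _)] => y [[]].
have sZ : smooth_field U0 Z by apply: smooth_field_sub (@cvec_smooth _ _ _ _ _) => y [].
have XEF y : U0 y -> [/\ X 0%N y \in E y, X 1%N y \in E y, X 2%N y \in F y & X 3%N y \in F y].
  move=> [[U1y U2y] _]; rewrite /X /=.
  by split; [exact: basis_tuple_mem (b1 y U1y) _|exact: basis_tuple_mem (b1 y U1y) _|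
    exact: basis_tuple_mem (b2 y U2y) _|exact: basis_tuple_mem (b2 y U2y) _].
have iE y : U0 y -> forall a b : R, a *: X 0%N y + b *: X 1%N y = 0 -> a = 0 /\ b = 0.
  by move=> [[U1y _] _] a b; apply: basis_pair_free (b1 y U1y) _ _.
have iF y : U0 y -> forall a b : R, a *: X 2%N y + b *: X 3%N y = 0 -> a = 0 /\ b = 0.
  by move=> [[_ U2y] _] a b; apply: basis_pair_free (b2 y U2y) _ _.
have U0x : U0 x by [].
have ux : frame_mx (fields5 X Z) x \in unitmx.
  have [? ? ? ?] := XEF x U0x; apply: (@frame_unit x X Z) => //; [by rewrite Zx|exact: iE|exact: iF].
have s5 k : smooth_field U0 (fields5 X Z k) by rewrite /fields5; case: (k < 4)%N; [exact: sX|exact: sZ].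
have [U [oU Ux sU hU]] := frame_mx_open oU0 s5 U0x ux.
have ZH y : U y -> Z y \notin H y.
  move=> Uy; have [[U1y U2y] _] := sU y Uy; apply/negP.
  rewrite -EF_H => /memv_addP[e eE [f fF ef]].
  have [c0 [c1 ce]] := basis_pair_expand (b1 y U1y) eE.
  have [d0 [d1 df]] := basis_pair_expand (b2 y U2y) fF.
  pose a : 'rV[R]_5 := \row_(k < 5) [:: c0; c1; d0; d1; -1]`_k.
  have : a *m frame_mx (fields5 X Z) y = 0.
    rewrite mul_frame_mx !big_ord_recl big_ord0 /fields5 /= /bump /= !mxE /=.
    rewrite /X /= addr0 scaleN1r ef ce df; set p := _ *: _; set q := _ *: _; set r := _ *: _; set s := _ *: _.
    by rewrite !addrA subrr.
  move=> /(congr1 (mulmx^~ (invmx (frame_mx (fields5 X Z) y)))); rewrite mulmxK ?hU// mul0mx.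
  move=> /rowP/(_ ord_max); rewrite !mxE /= => /eqP; rewrite oppr_eq0 oner_eq0 //.
have [||||||w [tau fr]] := @full_frame U X Z oU.
- by move=> k _; apply: smooth_field_sub (sX k).
- exact: smooth_field_sub sZ.
- by move=> y /sU; exact: XEF.
- exact: ZH.
- by move=> y /sU; exact: iE.
- by move=> y /sU; exact: iF.
by exists U, X, Z, w, tau.
Qed.

End Frames.

(** * The contact form and adapted frames *)

Section Scale.
Variables (R : realType) (n : nat) (M : smooth_manifold R n).

Lemma ext_derivZ U (f : M -> R^o) (al : forall x, cotangent x) x (u v : tangent x) :
  open U -> U x -> smooth_fun U f -> smooth_form U al ->
  ext_deriv (fun y => (f y : R) *: al y) u v
  = (dirder u f : R) * (al x v : R) - (dirder v f : R) * (al x u : R)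
     + (f x : R) * ext_deriv al u v :> R.
Proof.
move=> oU Ux sf sal.
have := @ext_deriv_comb _ _ _ U 'I_1 (fun=> f) (fun=> al) x u v oU Ux (fun=> sf) (fun=> sal).
rewrite big_ord1 => <-; apply: (ext_deriv_eq u v oU Ux) => y _.
by rewrite big_ord1.
Qed.

Lemma smooth_formZ U (f : M -> R^o) (al : forall x, cotangent x) : open U ->
  smooth_fun U f -> smooth_form U al -> smooth_form U (fun y => (f y : R) *: al y).
Proof.
move=> oU sf sal.
have := @smooth_form_comb _ _ _ U 'I_1 (fun=> f) (fun=> al) oU (fun=> sf) (fun=> sal).
by apply: smooth_form_eq => // y _; rewrite big_ord1.
Qed.

End Scale.

Section ContactForm.
Variables (R : realType) (M : smooth_manifold R 5) (H E F : vdistribution M).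
Hypothesis contactH : contact_distribution H.
Hypothesis splitH : legendrean_splitting H E F.
Variable sg : forall x : M, 'Hom(subvs_of (Lfib H x), R^o).
Hypothesis smooth_sg : Ldual_section sg.
Hypothesis sg_neq0 : forall x : M, sg x != 0.
Implicit Types (U : set M) (x y : M).

Let EF_H x : (E x + F x)%VS = H x. Proof. by have [_ /(_ x)[]] := splitH. Qed.
Let EF_0 x : (E x :&: F x)%VS = 0%VS. Proof. by have [_ /(_ x)[]] := splitH. Qed.

(** The contact form sigma^-1. *)
Definition theta x : cotangent x := Linv sg x.

Lemma theta_L x : theta x \in Lfib H x.
Proof. exact: subvsP. Qed.

Lemma theta_H x v : v \in H x -> theta x v = 0.
Proof. by have /memL := theta_L x; apply. Qed.

Section InFrame.
Variables (U : set M) (X : nat -> forall y : M, tangent y) (Z : forall y : M, tangent y).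
Variables (w : nat -> forall y : M, cotangent y) (tau : forall y : M, cotangent y).
Hypothesis fr : is_frame H E F U X Z w tau.

Lemma tau_L y : U y -> tau y \in Lfib H y.
Proof. by move=> Uy; apply/memL => v; rewrite (frame_H fr Uy) => /eqP. Qed.

Lemma L_tau y (a : cotangent y) : U y -> a \in Lfib H y -> a = (a (Z y) : R) *: tau y.
Proof.
move=> Uy /memL aL; apply/lfunP => v; rewrite scale_lfunE.
rewrite [in LHS](frame_expand fr Uy v) linearD linearZ linear_sum /= big1.
  by rewrite add0r /GRing.scale /= mulrC.
move=> k _; rewrite linearZ /= aL ?scaler0// (frame_H fr Uy).
by rewrite (frame_tX fr Uy).
Qed.

Definition sgtau y : R := sg y (vsproj (Lfib H y) (tau y)).

Lemma sgtau_neq0 y : U y -> sgtau y != 0.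
Proof.
move=> Uy; apply: contraNneq (sg_neq0 y) => s0; apply/eqP/lfunP => a.
rewrite zero_lfunE -[a]vsvalK.
by rewrite (L_tau Uy (subvsP a)) linearZ /= linearZ /= -/(sgtau y) s0 scaler0.
Qed.

Lemma thetaE y : U y -> theta y = (sgtau y)^-1 *: tau y.
Proof.
move=> Uy; rewrite /theta /Linv; set P := (X in xget 0 X).
have P1 : P ((sgtau y)^-1 *: vsproj (Lfib H y) (tau y)).
  by rewrite /P /= linearZ /= -/(sgtau y) /GRing.scale /= mulVf// sgtau_neq0.
have : P (xget 0 P) by apply: (@xgetPex _ 0 P); eexists; exact: P1.
set a := xget 0 P; rewrite /P /= => a1.
have ea := L_tau Uy (subvsP a); rewrite ea; congr (_ *: _).
have : sg y (vsproj (Lfib H y) (vsval a)) = 1 by rewrite vsvalK.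
rewrite {1}ea linearZ /= linearZ /= -/(sgtau y) /GRing.scale /= => e.
by apply: (mulIf (sgtau_neq0 Uy)); rewrite mulVf ?sgtau_neq0.
Qed.

Lemma sgtau_smooth : smooth_fun U (sgtau : M -> R^o).
Proof.
apply: (smooth_sg (al := fun y => vsproj (Lfib H y) (tau y))); first exact: frame_open fr.
apply: smooth_form_eq (frame_open fr) _ (frame_smootht fr) => y Uy.
by rewrite vsprojK// tau_L.
Qed.

Lemma theta_smooth_in : smooth_form U theta.
Proof.
have oU := frame_open fr.
have h : smooth_form U (fun y => ((sgtau y)^-1 : R) *: tau y).
  apply: (@smooth_formZ _ _ _ _ (fun y => (sgtau y)^-1 : R^o)) => //; last exact: frame_smootht fr.
  by apply: smooth_funV => //; [exact: sgtau_neq0|exact: sgtau_smooth].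
by apply: smooth_form_eq oU _ h => y Uy; rewrite thetaE.
Qed.

End InFrame.

Lemma theta_frame x : exists U X Z w tau, U x /\ is_frame H E F U X Z w tau.
Proof.
have [[sE sF] _ _ _] := splitH; have [sH _] := contactH.
exact: frame_exists.
Qed.

Lemma theta_smooth : smooth_form setT theta.
Proof.
apply: smooth_form_pointwise => x _.
have [U [X [Z [w [tau [Ux fr]]]]]] := theta_frame x.
by exists U => //; apply: theta_smooth_in fr.
Qed.

Lemma theta_neq0 x : theta x != 0.
Proof.
have [U [X [Z [w [tau [Ux fr]]]]]] := theta_frame x.
rewrite (thetaE fr Ux) scaler_eq0 invr_eq0 (negbTE (sgtau_neq0 fr Ux)) /=.
apply/negP => /eqP t0; have := frame_tZ fr Ux; rewrite t0 zero_lfunE => /eqP.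
by rewrite eq_sym oner_eq0.
Qed.

Lemma L_theta x (a : cotangent x) : a \in Lfib H x ->
  a = (sg x (vsproj (Lfib H x) a) : R) *: theta x.
Proof.
move=> aL; have [U [X [Z [w [tau [Ux fr]]]]]] := theta_frame x.
have -> : sg x (vsproj (Lfib H x) a) = a (Z x) * sgtau tau x.
  by rewrite {1}(L_tau fr Ux aL) linearZ /= linearZ.
rewrite (thetaE fr Ux) scalerA mulfK ?(sgtau_neq0 fr Ux)//.
exact: (L_tau fr Ux aL).
Qed.

(** The exterior derivative of the contact form on the whole tangent space;
    [Jform] below is its restriction to [H]. *)
Definition levi2 x (u v : tangent x) : R := ext_deriv theta u v.

Lemma levi2C x (u v : tangent x) : levi2 u v = - levi2 v u.
Proof. exact: ext_derivC. Qed.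

Lemma levi2_linearl x (v : tangent x) : linear (fun u : tangent x => levi2 u v : R^o).
Proof. exact: (ext_deriv_linearl openT theta_smooth). Qed.

Lemma levi2_linearr x (u : tangent x) : linear (fun v : tangent x => levi2 u v : R^o).
Proof. exact: (ext_deriv_linearr openT theta_smooth). Qed.

Lemma levi2_smooth U X Y : open U -> smooth_field U X -> smooth_field U Y ->
  smooth_fun U (fun x => levi2 (X x) (Y x) : R^o).
Proof.
move=> oU sX sY; apply: ext_deriv_smooth => //.
exact: smooth_form_sub theta_smooth.
Qed.

Definition Jform x : Hform H 2 x := levi H theta x.

Lemma JformE x (u v : Hfib H x) : Jform [tuple u; v] = levi2 (vsval u) (vsval v).
Proof. by []. Qed.

Lemma Jform_line x : levi_line x (@Jform x).
Proof.
exists setT, theta; split=> //; first exact: openT.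
by split=> [|y _]; [exact: theta_smooth|exact: theta_L].
Qed.

Lemma levi_lineZ x c : levi_line x ((c : R) *: @Jform x).
Proof.
exists setT, (fun y => (c : R) *: theta y); split=> //; first exact: openT.
  split=> [|y _]; last by rewrite rpredZ// theta_L.
  by apply: (@smooth_formZ _ _ _ _ (fun=> c)); [exact: openT|exact: smooth_fun_cst|exact: theta_smooth].
apply/funext => v; rewrite /levi.
rewrite (@ext_derivZ _ _ _ setT (fun=> c) theta _ _ _ openT I (smooth_fun_cst _ _) theta_smooth).
by rewrite !dirder_cst !mul0r subrr add0r.
Qed.

(** A section of [L] is [g *: theta] for a smooth [g], and d (g theta) equals
    g d theta on [H] because [theta] vanishes there. *)
Lemma levi_lineP x (B : Hform H 2 x) : levi_line x B <-> exists c, B = (c : R) *: @Jform x.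
Proof.
split=> [[U [al [oU Ux [sal aL] ->]]]|[c ->]]; last exact: levi_lineZ.
pose g y : R^o := sg y (vsproj (Lfib H y) (al y)).
have sg' : smooth_fun U g.
  apply: (smooth_sg (al := fun y => vsproj (Lfib H y) (al y))) => //.
  by apply: smooth_form_eq oU _ sal => y Uy; rewrite vsprojK// aL.
exists (g x); apply/funext => v; rewrite /levi.
rewrite (@ext_deriv_eq _ _ _ U al (fun y => (g y : R) *: theta y) _ _ _ oU Ux); last first.
  by move=> y Uy; exact: L_theta (aL y Uy).
rewrite (@ext_derivZ _ _ _ U g theta _ _ _ oU Ux sg'); last exact: smooth_form_sub theta_smooth.
by rewrite !(theta_H (subvsP _)) !mulr0 subrr add0r.
Qed.

Lemma levi2_E x (u v : tangent x) : u \in E x -> v \in E x -> levi2 u v = 0.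
Proof.
move=> uE vE; have [_ _ nE _] := splitH.
have := nE x _ (Jform_line x) (vsproj (H x) u) (vsproj (H x) v).
by rewrite JformE !vsprojK ?(EH EF_H)//; apply.
Qed.

Lemma levi2_F x (u v : tangent x) : u \in F x -> v \in F x -> levi2 u v = 0.
Proof.
move=> uE vE; have [_ _ _ nF] := splitH.
have := nF x _ (Jform_line x) (vsproj (H x) u) (vsproj (H x) v).
by rewrite JformE !vsprojK ?(FH EF_H)//; apply.
Qed.

Lemma levi2_nondeg x (u : Hfib H x) :
  (forall v : Hfib H x, levi2 (vsval u) (vsval v) = 0) -> u = 0.
Proof.
move=> h; have [_ /(_ setT theta openT)] := contactH; apply => //.
- by split=> [|y _]; [exact: theta_smooth|exact: theta_L].
- exact: theta_neq0.
Qed.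

(** The Gram matrix of the Levi form in an adapted frame, which pairs [X k] with
    [X k.+2]. *)
Definition symp (j k : nat) : R := (k == j.+2)%:R - (j == k.+2)%:R.

Record is_aframe U (X : nat -> forall y, tangent y) (Z : forall y, tangent y)
    (w : nat -> forall y, cotangent y) (tau : forall y, cotangent y) : Prop := IsAFrame {
  aframe_frame :> is_frame H E F U X Z w tau;
  aframe_J : forall y, U y -> forall j k, (j < 4)%N -> (k < 4)%N ->
     levi2 (X j y) (X k y) = symp j k }.

(** The Levi form pairs [E] and [F] perfectly, as both are null; so the frame of
    [F] can be replaced by the one dual to the frame of [E]. *)
Lemma aframe_exists x : exists U X Z w tau, U x /\ is_aframe U X Z w tau.
Proof.
have [U [X [Z [w [tau [Ux fr]]]]]] := theta_frame x.
have oU := frame_open fr.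
have XE k y : U y -> (k < 2)%N -> X k y \in E y.
  move=> Uy k2; apply/(frame_E fr Uy); have k4 := ltn_trans k2 (isT : (2 < 4)%N).
  split; [exact: (frame_tX fr Uy)| |]; rewrite (frame_wX fr Uy)//.
    by rewrite (ltn_eqF k2).
  by rewrite (ltn_eqF (ltn_trans k2 _)).
have XF k y : U y -> (k < 2)%N -> X k.+2 y \in F y.
  move=> Uy k2; apply/(frame_F fr Uy); have k4 : (k.+2 < 4)%N by [].
  by split; [exact: (frame_tX fr Uy)| |]; rewrite (frame_wX fr Uy).
pose m y : 'M[R]_2 := \matrix_(a, b) levi2 (X a y) (X b.+2 y).
have sm a b : smooth_fun U (fun y => m y a b : R^o).
  under eq_fun do rewrite mxE.
  have a4 : (a < 4)%N by apply: ltn_trans (ltn_ord a) _.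
  apply: levi2_smooth => //; apply: (frame_smoothX fr) => //.
  by have := ltn_ord b; rewrite !ltnS.
have um y : U y -> m y \in unitmx.
  move=> Uy; rewrite -row_free_unit; apply: inj_row_free => a e.
  pose u : tangent y := a ord0 (inord 0) *: X 0%N y + a ord0 (inord 1) *: X 1%N y.
  have uE : u \in E y by rewrite rpredD ?rpredZ ?XE.
  have uF k : (k < 2)%N -> levi2 u (X k.+2 y) = 0.
    move=> k2; move/rowP: e => /(_ (Ordinal k2)); rewrite !mxE sum_I2 !mxE /= !inordK// => e.
    rewrite -[RHS]e /u (linD (levi2_linearl _)) !(linZ (levi2_linearl _)); reflexivity.
  have u0 : vsproj (H y) u = 0.
    apply: levi2_nondeg => v; rewrite vsprojK; last exact: (EH EF_H uE).
    have : vsval v \in (E y + F y)%VS by rewrite EF_H subvsP.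
    move=> /memv_addP[e1 e1E [f1 f1F ->]].
    rewrite (linD (levi2_linearr _)) (levi2_E uE e1E) add0r.
    have [t0 w0 w1] := (frame_F fr Uy f1).1 f1F.
    rewrite [f1](frame_expand fr Uy) t0 scale0r addr0 !big_ord_recl big_ord0 /= /bump /=.
    rewrite w0 w1 !scale0r !add0r addr0 (linD (levi2_linearr _)) !(linZ (levi2_linearr _)).
    by rewrite !uF// !scaler0 addr0.
  have u00 : u = 0 by rewrite -(vsprojK (EH EF_H uE)) u0 linear0.
  have wu k : (k < 2)%N -> a ord0 (inord k) = 0.
    move=> k2; have : w k y u = 0 by rewrite u00 linear0.
    have k4 := ltn_trans k2 (isT : (2 < 4)%N).
    rewrite /u linearD !linearZ /= !(frame_wX fr Uy)//.
    by case: k k2 {k4} => [|[|//]] _ /=; rewrite /GRing.scale /= ?mulr1 ?mulr0 ?addr0 ?add0r.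
  apply/rowP => k; rewrite mxE -(inord_val k); apply: wu; exact: ltn_ord.
pose X' k y : tangent y := if (k < 2)%N then X k y else
   \sum_(c < 2) invmx (m y) c (inord (k - 2)) *: X c.+2 y.
have X'J y a b : U y -> (a < 2)%N -> (b < 2)%N -> levi2 (X' a y) (X' b.+2 y) = (a == b)%:R.
  move=> Uy a2 b2; rewrite /X' a2 /= subn2 /=.
  rewrite (lin_comb (levi2_linearr _)).
  have := congr1 (fun A : 'M[R]_2 => A (inord a) (inord b)) (mulmxV (um y Uy)).
  rewrite !mxE -val_eqE /= !inordK// => <-; apply: eq_bigr => c _.
  by rewrite mxE inordK// mulrC.
have X'E k y : U y -> (k < 2)%N -> X' k y \in E y by move=> Uy k2; rewrite /X' k2; apply: XE.
have X'F k y : U y -> (k < 2)%N -> X' k.+2 y \in F y.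
  by move=> Uy k2; rewrite /X' /=; apply: rpred_sum => c _; rewrite rpredZ// XF.
have [||||||w' [tau' fr']] := @full_frame R M H E F EF_H EF_0 U X' Z oU.
- move=> k k4; rewrite /X'; case k2: (k < 2)%N; first exact: (frame_smoothX fr).
  apply: (smooth_field_comb (f := fun c y => invmx (m y) c (inord (k - 2)) : R^o)) => // c.
    exact: smooth_fun_invmx.
  by apply: (frame_smoothX fr); have := ltn_ord c; rewrite !ltnS.
- exact: (frame_smoothZ fr).
- by move=> y Uy; split; [exact: X'E|exact: X'E|exact: X'F|exact: X'F].
- by move=> y Uy; rewrite (frame_H fr Uy) (frame_tZ fr Uy) oner_eq0.
- move=> y Uy a b e.
  have h k : (k < 2)%N -> levi2 (a *: X' 0%N y + b *: X' 1%N y) (X' k.+2 y) = 0.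
    by move=> _; rewrite e (lin0 (levi2_linearl _)).
  move: (h 0%N isT) (h 1%N isT).
  rewrite !(linD (levi2_linearl _)) !(linZ (levi2_linearl _)) !X'J//=.
  by rewrite /GRing.scale /= !mulr1 !mulr0 addr0 add0r.
- move=> y Uy a b e.
  have h k : (k < 2)%N -> levi2 (X' k y) (a *: X' 2%N y + b *: X' 3%N y) = 0.
    by move=> _; rewrite e (lin0 (levi2_linearr _)).
  move: (h 0%N isT) (h 1%N isT).
  rewrite !(linD (levi2_linearr _)) !(linZ (levi2_linearr _)) !X'J//=.
  by rewrite /GRing.scale /= !mulr1 !mulr0 addr0 add0r.
exists U, X', Z, w', tau'; split=> //; split=> // y Uy.
have c22 j k : (j < 2)%N -> (k < 2)%N -> levi2 (X' j y) (X' k y) = 0.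
  by move=> j2 k2; apply: levi2_E; apply: X'E.
have c33 j k : (j < 2)%N -> (k < 2)%N -> levi2 (X' j.+2 y) (X' k.+2 y) = 0.
  by move=> j2 k2; apply: levi2_F; apply: X'F.
have c32 j k : (j < 2)%N -> (k < 2)%N -> levi2 (X' j.+2 y) (X' k y) = - (k == j)%:R.
  by move=> j2 k2; rewrite levi2C X'J.
have c23 := X'J y _ _ Uy.
have sp j k : (j < 2)%N -> (k < 2)%N -> [/\ symp j k = 0, symp j.+2 k.+2 = 0,
    symp j k.+2 = (j == k)%:R & symp j.+2 k = - (k == j)%:R].
  by case: j => [|[|//]] _; case: k => [|[|//]] _; split;
     rewrite /symp /= ?subr0 ?subrr ?sub0r ?oppr0.
have h j k : (j < 4)%N -> (k < 4)%N -> exists j' k' : nat, [/\ (j' < 2)%N, (k' < 2)%N,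
   (j = j' \/ j = j'.+2) & (k = k' \/ k = k'.+2)].
  move=> j4 k4; exists (if (j < 2)%N then j else j - 2)%N, (if (k < 2)%N then k else k - 2)%N.
  by case: j j4 => [|[|[|[|//]]]] _; case: k k4 => [|[|[|[|//]]]] _; split=> //; auto.
move=> j k /h{}h /h[j' [k' [j2 k2 Ej Ek]]]; have [s1 s2 s3 s4] := sp _ _ j2 k2.
case: Ej => ->; case: Ek => ->.
- by rewrite s1; apply: c22.
- by rewrite s3; apply: c23.
- by rewrite s4; apply: c32.
- by rewrite s2; apply: c33.
Qed.

End ContactForm.

(** * The linear system for the connection coefficients *)

Section Christoffel.
Variables (R : realType) (K : nat -> nat -> nat -> R).

(** Indices below 2 belong to [E], the indices 2 and 3 to [F]. *)
Definition same (i k : nat) := (i < 2)%N == (k < 2)%N.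
(** The index paired with [i] by [symp]. *)
Definition dual_index (i : nat) := if (i < 2)%N then i.+2 else (i - 2)%N.
(** The other index of the same type. *)
Definition partner (i : nat) := nth 0%N [:: 1; 0; 3; 2]%N i.

(** The multiple of the Levi form in the torsion of the coframe form [i], up to
    sign: see the elimination in [christoffel_unique]. *)
Definition trace_coef (i : nat) : R :=
  K (partner i) (dual_index i) (partner i)
  - K i (dual_index (partner i)) (partner i)
  - K (dual_index (partner i)) (dual_index (partner i)) (dual_index i).

(** The coefficient in a direction [j] of the type opposite to [i], as given by
    the torsion condition. *)
Definition mixed (j i k : nat) : R := K i j k + trace_coef i * (dual_index j == k)%:R.

Definition christoffel (j i k : nat) : R :=
  if ~~ same i k then 0 else
  if same j i then - mixed j (dual_index k) (dual_index i) else mixed j i k.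

(** Here [g j i k] stands for the value on [X k] of the derivative of the coframe
    form [i] along [X j], and [K i j k] for the value of the exterior derivative
    of that form on [X j], [X k]. The three fields say that the dual summands are
    preserved, that the Levi form is parallel, and that the torsion of a form is
    a multiple of the Levi form once an argument has the type of the form. *)
Record levi_civita_system (g : nat -> nat -> nat -> R) : Prop := LCSystem {
  lc_split : forall j i k, (j < 4)%N -> (i < 4)%N -> (k < 4)%N -> ~~ same i k -> g j i k = 0;
  lc_metric : forall j i k, (j < 4)%N -> (i < 4)%N -> (k < 4)%N -> same i k ->
     g j i k + g j (dual_index k) (dual_index i) = 0;
  lc_torsion : forall c, (c < 4)%N -> exists p, forall a k, (a < 4)%N -> (k < 4)%N -> same k c ->
     g a c k - g k c a - K c a k = p * symp R a k }.

Hypothesis KC : forall i j k, K i j k = - K i k j.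

Let K0 a b : K a b b = 0. Proof. by have := KC a b b; lra. Qed.

Lemma sympE j k : ~~ same j k -> (j < 4)%N -> (k < 4)%N ->
  symp R j k = (if (k < 2)%N then -1 else 1) * (dual_index j == k)%:R.
Proof.
case: j => [|[|[|[|//]]]]; case: k => [|[|[|[|//]]]] //= _ _ _;
by rewrite /symp /= ?mulr0 ?mulr1 ?subr0 ?sub0r.
Qed.

Lemma symp_same j k : same j k -> (j < 4)%N -> (k < 4)%N -> symp R j k = 0.
Proof.
case: j => [|[|[|[|//]]]]; case: k => [|[|[|[|//]]]] //= _ _ _;
by rewrite /symp /= subrr.
Qed.

(** Let [q c] be the unknown multiple in the torsion equation of the form [c].
    For a direction [j] of the type opposite to [i], the coefficient with [i] and
    [j] exchanged vanishes, so that the torsion equation gives [g j i k] in terms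
    of [q i]; the metric equation then gives it for the other directions. The
    torsion equation of the form [dual_index (partner c)] in two directions of
    its own type, where the Levi form vanishes, now determines [q c]. *)
Lemma christoffel_unique g j i k : levi_civita_system g ->
  (j < 4)%N -> (i < 4)%N -> (k < 4)%N -> g j i k = christoffel j i k.
Proof.
move=> [gE gJ gT].
have ex c : exists q, (c < 4)%N -> forall a k, (a < 4)%N -> (k < 4)%N -> same k c ->
    g a c k - g k c a - K c a k = q * (if (c < 2)%N then -1 else 1) * symp R a k.
  case: (ltnP c 4) => [/gT[p hp]|_]; last by exists 0.
  (* the sign makes [symp] a Kronecker delta in both types, see [sympE] *)
  exists (if (c < 2)%N then - p else p) => _ a k' a4 k4 s; rewrite hp//.
  by case: ifP => _; rewrite ?mulrN1 ?opprK ?mulr1.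
pose q c := sval (cid (ex c)); have hq c : (c < 4)%N -> _ := svalP (cid (ex c)).
have mix j' i' k' : (j' < 4)%N -> (i' < 4)%N -> (k' < 4)%N -> same i' k' -> ~~ same j' i' ->
    g j' i' k' = K i' j' k' + q i' * (dual_index j' == k')%:R.
  move=> j4 i4 k4 sik nji; have sjk : ~~ same j' k' by rewrite /same -(eqP sik).
  have ski : same k' i' by rewrite /same eq_sym.
  have := hq _ i4 j' k' j4 k4 ski.
  rewrite (sympE sjk j4 k4) (gE k' i' j') //; last by rewrite /same eq_sym.
  rewrite -(eqP sik) -/(q i'); case: ifP => _; lra.
have dual4 c : (c < 4)%N -> (dual_index c < 4)%N by case: c => [|[|[|[|]]]].
have qE c : (c < 4)%N -> q c = trace_coef c.
  move=> c4; rewrite /trace_coef; set b := partner c; set db := dual_index b; set dc := dual_index c.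
  have [b4 db4 dc4] : [/\ (b < 4)%N, (db < 4)%N & (dc < 4)%N].
    by rewrite /db /dc /b; case: (c) c4 => [|[|[|[|]]]].
  have [s1 s2 s3 s4 s5] : [/\ same dc db, same b c, ~~ same db c, ~~ same dc b & ~~ same db b].
    by rewrite /db /dc /b; case: (c) c4 => [|[|[|[|]]]].
  have [e1 e2 e3 e4] : [/\ dual_index db = b, dual_index dc = c, (c == b) = false & (b == c) = false].
    by rewrite /db /dc /b; case: (c) c4 => [|[|[|[|]]]].
  have := hq _ db4 db dc db4 dc4 s1; rewrite (symp_same _ db4 dc4); last by rewrite /same eq_sym.
  have s6 : same db dc by rewrite /same eq_sym.
  have := gJ db db dc db4 db4 dc4 s6; rewrite e1 e2.
  rewrite (mix db c b) //; last by rewrite /same eq_sym.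
  rewrite e1 eqxx.
  have := gJ dc db db dc4 db4 db4 (eqxx _); rewrite e1 (mix dc b b) ?/same ?eqxx // e2 e3 /=.
  lra.
move=> j4 i4 k4; rewrite /christoffel; case: ifP => [nik|/negbFE sik]; first exact: gE.
case: ifP => [sji|/negbT nji]; last by rewrite /mixed mix// qE.
have := gJ j i k j4 i4 k4 sik; rewrite (mix j (dual_index k) (dual_index i)) ?dual4//.
- by rewrite /mixed qE ?dual4// => e; apply/eqP; rewrite -subr_eq0 opprK; apply/eqP.
- by move: sik; case: (i) i4 => [|[|[|[|//]]]] _; case: (k) k4 => [|[|[|[|//]]]].
- by move: sik sji; case: (i) i4 => [|[|[|[|//]]]] _; case: (k) k4 => [|[|[|[|//]]]] _;
    case: (j) j4 => [|[|[|[|//]]]].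
Qed.

Lemma christoffel_system : levi_civita_system christoffel.
Proof.
split.
- by move=> j i k _ _ _ n; rewrite /christoffel n.
- move=> j i k; case: j => [|[|[|[|//]]]] _; case: i => [|[|[|[|//]]]] _;
  case: k => [|[|[|[|//]]]] _ // _; rewrite /christoffel /= ?addNr ?subrr; reflexivity.
- move=> c c4; exists (if (c < 2)%N then - trace_coef c else trace_coef c) => a k a4 k4 skc.
  have [sak|nak] := boolP (same a k); last first.
    rewrite (sympE nak a4 k4) /christoffel.
    have -> : same c k by rewrite /same eq_sym.
    have -> : same a c = false by apply/negbTE; rewrite /same -(eqP skc).
    have -> : same c a = false by apply/negbTE; rewrite /same -(eqP skc) eq_sym.
    by rewrite /= /mixed (eqP skc); case: ifP => _; lra.
  rewrite symp_same// mulr0.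
  have KC' := KC c a k.
  move: c4 a4 k4 skc sak KC'; rewrite /christoffel /mixed /trace_coef.
  case: c => [|[|[|[|//]]]] _; case: a => [|[|[|[|//]]]] _; case: k => [|[|[|[|//]]]] _ // _ _;
  rewrite /= ?mulr1 ?mulr0 ?K0 => KC'; lra.
Qed.

End Christoffel.

(** * Alternating forms and derivatives of determinants *)

Section Tset.
Variables (k : nat) (T : Type).
Implicit Types (v : k.-tuple T) (i j : 'I_k) (u : T).

Lemma tnth_tset v i u j : tnth (tset v i u) j = if j == i then u else tnth v j.
Proof. by rewrite tnth_mktuple. Qed.

Lemma tset_same v i u u' : tset (tset v i u) i u' = tset v i u'.
Proof. by apply: eq_from_tnth => j; rewrite !tnth_tset; case: eqP. Qed.

Lemma tset_comm v i j u u' : i != j -> tset (tset v i u) j u' = tset (tset v j u') i u.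
Proof.
move=> ij; apply: eq_from_tnth => l; rewrite !tnth_tset.
by case: (eqVneq l i) => [->|//]; rewrite (negbTE ij).
Qed.

Lemma tset_id v i : tset v i (tnth v i) = v.
Proof. by apply: eq_from_tnth => j; rewrite tnth_tset; case: eqP => [->|]. Qed.

Lemma tset_mktuple (f : 'I_k -> T) i u :
  tset [tuple f j | j < k] i u = [tuple if j == i then u else f j | j < k].
Proof. by apply: eq_from_tnth => j; rewrite tnth_tset !tnth_mktuple. Qed.

End Tset.

Section AltForm.
Variables (R : realType) (n : nat) (M : smooth_manifold R n) (H : vdistribution M).
Variables (k : nat) (x : M) (f : Hform H k x).
Hypothesis af : altform f.

Lemma alt_linear v i : linear (fun u : Hfib H x => f (tset v i u)).
Proof. by case: af => h _; apply: h. Qed.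

Lemma alt_eq0 v i j : i != j -> tnth v i = tnth v j -> f v = 0.
Proof. by case: af => _; apply. Qed.

Lemma alt_swap v i j a b : i != j ->
  f (tset (tset v i a) j b) + f (tset (tset v i b) j a) = 0.
Proof.
move=> ij; have ji : j != i by rewrite eq_sym.
pose g a b := f (tset (tset v i a) j b).
have gr a' : linear (g a') by exact: alt_linear.
have gl b' : linear (fun a' => g a' b').
  by move=> c p q; rewrite /g !(tset_comm _ _ _ ij) alt_linear.
have g0 a' : g a' a' = 0.
  by apply: (alt_eq0 ij); rewrite !tnth_tset !eqxx (negbTE ij).
have := g0 (a + b); rewrite (linD (gr _)) (linD (gl a)) (linD (gl b)) !g0 add0r addr0.
by rewrite addrC.
Qed.

End AltForm.

Section DirderProd.
Variables (R : realType) (n : nat) (M : smooth_manifold R n).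
Variables (U : set M) (x : M) (v : tangent x).
Hypotheses (oU : open U) (Ux : U x).

Lemma dirder_prod (I : eqType) (r : seq I) (f : I -> M -> R^o) : uniq r ->
  (forall i, smooth_fun U (f i)) ->
  dirder v (fun y => \prod_(i <- r) (f i y : R) : R^o) =
  \sum_(i <- r) (dirder v (f i) : R) * \prod_(j <- r | j != i) (f j x : R) :> R.
Proof.
move=> + sf; elim: r => [|l r IH] /=.
  by move=> _; under eq_fun do rewrite big_nil; rewrite big_nil dirder_cst.
move=> /andP[lr ur]; under eq_fun do rewrite big_cons; rewrite big_cons.
have e1 := @dirderM _ _ _ x U Ux v (f l) (fun y => \prod_(i <- r) (f i y : R) : R^o) (sf l)
  (smooth_fun_prod oU _ (fun i _ => sf i)).
apply: (etrans e1); rewrite (IH ur) addrC; congr (_ + _).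
  rewrite mulrC big_cons eqxx /=; congr (_ * _).
  by rewrite big_seq [RHS]big_seq_cond; apply: eq_bigl => j; case: eqVneq => [->|]; rewrite ?(negbTE lr) ?andbT.
rewrite mulr_sumr [LHS]big_seq [RHS]big_seq; apply: eq_bigr => i ir.
rewrite big_cons; case: eqVneq => [e|_]; first by rewrite e ir in lr.
by rewrite mulrCA.
Qed.

Lemma dirder_det m (A : M -> 'M[R]_m) : (forall a b, smooth_fun U (fun y => A y a b : R^o)) ->
  dirder v (fun y => \det (A y) : R^o) =
  \sum_i \det (\matrix_(a, b) if a == i then (dirder v (fun y => A y i b : R^o) : R) else A x a b) :> R.
Proof.
move=> sA.
have sP (s : {perm 'I_m}) : smooth_fun U (fun y => \prod_i (A y i (s i) : R) : R^o).
  by apply: smooth_fun_prod.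
rewrite /determinant.
have e1 := @dirder_sum _ _ _ x U oU Ux v R^o _ (index_enum {perm 'I_m}) xpredT
  (fun (s : {perm 'I_m}) y => ((-1) ^+ s : R) * \prod_i (A y i (s i) : R) : R^o)
  (fun s _ => smooth_funM oU (smooth_fun_cst _ _) (sP s)).
apply: (etrans e1); rewrite exchange_big /=; apply: eq_bigr => s _.
apply: (etrans (dirderM Ux v (smooth_fun_cst U ((-1) ^+ s : R^o)) (sP s))).
rewrite dirder_cst mulr0 addr0.
rewrite (dirder_prod (f := fun i y => A y i (s i) : R^o) (index_enum_uniq _)) //.
rewrite mulr_sumr; apply: eq_bigr => i _; congr (_ * _).
rewrite [RHS](bigD1 i) //= mxE eqxx; congr (_ * _).
by apply: eq_bigr => j ji; rewrite mxE (negbTE ji).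
Qed.

End DirderProd.

Section DetReplace.
Variables (R : comNzRingType) (m : nat) (A B : 'M[R]_m).

Lemma det_replace_row i :
  \det (\matrix_(a, b) if a == i then B i b else A a b) = \sum_j B i j * cofactor A i j.
Proof.
rewrite (expand_det_row _ i); apply: eq_bigr => j _; rewrite mxE eqxx; congr (_ * _).
rewrite /cofactor; congr (_ * \det _); apply/matrixP => a b; rewrite !mxE.
by rewrite eq_sym (negbTE (neq_lift _ _)).
Qed.

Lemma det_replace_col j :
  \det (\matrix_(a, b) if b == j then B a j else A a b) = \sum_i B i j * cofactor A i j.
Proof.
rewrite (expand_det_col _ j); apply: eq_bigr => i _; rewrite mxE eqxx; congr (_ * _).
rewrite /cofactor; congr (_ * \det _); apply/matrixP => a b; rewrite !mxE.
by rewrite eq_sym (negbTE (neq_lift _ _)).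
Qed.

(** Both sides are the trace of [\adj A *m B]. *)
Lemma sum_det_replace :
  \sum_i \det (\matrix_(a, b) if a == i then B i b else A a b) =
  \sum_j \det (\matrix_(a, b) if b == j then B a j else A a b).
Proof.
under eq_bigr do rewrite det_replace_row; rewrite exchange_big /=.
by apply: eq_bigr => j _; rewrite det_replace_col.
Qed.

End DetReplace.

(** * Connections on forms given by coefficients in a frame *)

Section Sections.
Variables (R : realType) (n : nat) (M : smooth_manifold R n) (H : vdistribution M).
Implicit Types (U V : set M) (x y : M).

Lemma dirder_smooth U (f : M -> R^o) (X : forall x, tangent x) : open U ->
  smooth_fun U f -> smooth_field U X -> smooth_fun U (fun x => dirder (X x) f : R^o).
Proof.
move=> oU sf sX i m.
have oUi : open (U `&` chart_dom i) by apply: openI => //; apply: chart_dom_open.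
have oI := @open_chart_image _ _ _ U i oU.
have h : Ck_on m (chart_phi i @` (U `&` chart_dom i)) (fun z => \sum_k
  (((fun x => vcomp i (X x) ord0 k : R^o) \o chart_psi i) z : R) *
  ('D_(delta_mx ord0 k) (f \o chart_psi i) z : R) : R^o).
  apply: Ck_on_sum => // k _; apply: Ck_onM => //; last first.
    by have [_] := sf i m.+1; apply.
  have := smooth_fun_coord oUi k (sX i); move=> /(_ i m); apply: Ck_on_sub.
  by apply: image_subset => x [].
apply: Ck_on_eq oI _ h => _ [x [Ux dx] <-] /=; rewrite !chart_phiK//.
rewrite (dirder_chart (X x) oU sf Ux dx).
have d := smooth_fun_differentiable sf Ux dx.
apply/esym; rewrite deriveE// [X in 'd _ _ X]row_sum_delta linear_sum.
by apply: eq_bigr => k _; rewrite linearZ -deriveE.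
Qed.

Lemma restrictHE x (a : cotangent x) (u : Hfib H x) : restrictH H a u = a (vsval u).
Proof. by rewrite /restrictH comp_lfunE lfunE. Qed.

Lemma Hsection_sub U V (Y : forall x, Hfib H x) : V `<=` U -> Hsection U Y -> Hsection V Y.
Proof. exact: smooth_field_sub. Qed.

Lemma Hform_section_sub k U V (s : forall x, Hform H k x) : V `<=` U ->
  Hform_section U s -> Hform_section V s.
Proof.
move=> VU [a b]; split=> [x /VU /a//|W X oW WV]; apply: b => //.
exact: subset_trans VU.
Qed.

Lemma Hdual_section_sub U V (s : forall x, Hdual H x) : V `<=` U ->
  Hdual_section U s -> Hdual_section V s.
Proof. by move=> VU a W X oW WV; apply: a => //; apply: subset_trans VU. Qed.

Lemma Hform_section_eq k U (s t : forall x, Hform H k x) : open U ->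
  (forall x, U x -> s x = t x) -> Hform_section U s -> Hform_section U t.
Proof.
move=> oU e [a b]; split=> [x Ux|W X oW WU sX]; first by rewrite -e//; apply: a.
by apply: smooth_fun_eq (b W X oW WU sX) => // x /WU Ux; rewrite e.
Qed.

Lemma Hsection_eq U (Y Y' : forall x, Hfib H x) : open U ->
  (forall x, U x -> Y x = Y' x) -> Hsection U Y -> Hsection U Y'.
Proof. by move=> oU e; apply: smooth_field_eq => // x Ux; rewrite e. Qed.

Lemma Hsection_comb U (I : finType) (f : I -> M -> R^o) (Y : I -> forall x, Hfib H x) :
  open U -> (forall l, smooth_fun U (f l)) -> (forall l, Hsection U (Y l)) ->
  Hsection U (fun x => \sum_l (f l x : R) *: Y l x).
Proof.
move=> oU sf sY; apply: smooth_field_eq oU _ (smooth_field_comb oU sf sY) => x Ux.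
by rewrite linear_sum; apply: eq_bigr => l _; rewrite linearZ.
Qed.

Lemma HsectionD U (Y Y' : forall x, Hfib H x) : open U ->
  Hsection U Y -> Hsection U Y' -> Hsection U (fun x => Y x + Y' x).
Proof.
move=> oU sY sY' i.
have oUi : open (U `&` chart_dom i) by apply: openI => //; apply: chart_dom_open.
apply: smooth_fun_eq oUi _ (smooth_funD oUi (sY i) (sY' i)) => x [Ux dx].
by rewrite -!/(vcomp i _) linearD (linD (vcomp_linear dx)).
Qed.

Lemma restrict_section U (al : forall x, cotangent x) : open U -> smooth_form U al ->
  Hdual_section U (fun x => restrictH H (al x) : Hdual H x).
Proof.
move=> oU sal V Y oV VU sY.
apply: smooth_fun_eq oV _ (pairing_smooth oV (smooth_form_sub VU sal) sY) => x Vx.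
by rewrite restrictHE.
Qed.

End Sections.

Section FrameConnection.
Variables (R : realType) (M : smooth_manifold R 5) (H E F : vdistribution M).
Variables (U : set M) (X : nat -> forall y : M, tangent y) (Z : forall y : M, tangent y).
Variables (w : nat -> forall y : M, cotangent y) (tau : forall y : M, cotangent y).
Variable Gc : nat -> nat -> nat -> M -> R^o.
Implicit Types (x y : M).

(** The frame and coframe as sections of [H] and of its dual. *)
Definition XH k y : Hfib H y := vsproj (H y) (X k y).
Definition wH k y : Hdual H y := restrictH H (w k y).
(** The section of [H] through [u] with constant coefficients in the frame. *)
Definition cst_ext x (u : Hfib H x) y : Hfib H y := \sum_(k < 4) (wH k x u : R) *: XH k y.
(** The derivative along [v] of the section [cst_ext u]. The coefficients [Gc]
    are those of the coframe, whence the sign. *)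
Definition conn_matrix x (v u : Hfib H x) : Hfib H x :=
  \sum_(l < 4) (- \sum_(j < 4) \sum_(k < 4) (wH j x v : R) * (wH k x u : R) * (Gc j l k x : R)) *: XH l x.
(** The covariant derivative of a form, with its arguments extended as
    constant-coefficient sections of the frame. All degrees are treated at once:
    degree 1 is the connection on [Hdual] and the others are induced by it. *)
Definition form_conn k (s : forall x, Hform H k x) x (v : Hfib H x) : Hform H k x := fun u =>
  (dirder (vsval v : tangent x) (fun y => s y [tuple cst_ext (tnth u i) y | i < k] : R^o) : R)
  - \sum_(i < k) (s x (tset u i (conn_matrix v (tnth u i))) : R).
(** The covariant derivative of the section [Y] of [H] along [v]. *)
Definition nabla_field (Y : forall x, Hfib H x) x (v : Hfib H x) : Hfib H x :=
  \sum_(k < 4) (dirder (vsval v : tangent x) (fun y => wH k y (Y y) : R^o) : R) *: XH k x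
  + conn_matrix v (Y x).

Hypothesis fr : is_frame H E F U X Z w tau.
Hypothesis sG : forall j i k, (j < 4)%N -> (i < 4)%N -> (k < 4)%N -> smooth_fun U (Gc j i k).

Let oU : open U. Proof. exact: frame_open fr. Qed.

Lemma wHE k x (u : Hfib H x) : wH k x u = w k x (vsval u).
Proof. exact: restrictHE. Qed.

Lemma vsval_XH k y : U y -> (k < 4)%N -> vsval (XH k y) = X k y.
Proof. by move=> Uy k4; rewrite vsprojK// (frame_H fr Uy) (frame_tX fr Uy). Qed.

Lemma wH_XH i k y : U y -> (i < 4)%N -> (k < 4)%N -> wH i y (XH k y) = (k == i)%:R.
Proof. by move=> Uy i4 k4; rewrite wHE vsval_XH// (frame_wX fr Uy). Qed.

Lemma cst_ext_at x (u : Hfib H x) : U x -> cst_ext u x = u.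
Proof.
move=> Ux; apply: subvs_inj; rewrite [RHS](frame_expand fr Ux) linear_sum.
have /eqP-> : tau x (vsval u) == 0 :> R by rewrite -(frame_H fr Ux) subvsP.
rewrite scale0r addr0; apply: eq_bigr => k _.
by rewrite linearZ /= vsval_XH// wHE.
Qed.

Lemma H_expand x (u : Hfib H x) : U x -> u = \sum_(k < 4) (wH k x u : R) *: XH k x.
Proof. by move=> Ux; rewrite -[LHS](cst_ext_at _ Ux). Qed.

Lemma H_ext x (u v : Hfib H x) : U x ->
  (forall k, (k < 4)%N -> wH k x u = wH k x v) -> u = v.
Proof.
move=> Ux e; rewrite (H_expand u Ux) (H_expand v Ux).
by apply: eq_bigr => k _; rewrite e.
Qed.

Lemma cst_ext_linear x y : linear (fun u : Hfib H x => cst_ext u y).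
Proof.
move=> a u v; rewrite /cst_ext scaler_sumr -big_split; apply: eq_bigr => k _ /=.
by rewrite linearP scalerDl scalerA.
Qed.

Lemma wH_lin k x a (u u' : Hfib H x) :
  wH k x (a *: u + u') = a * (wH k x u : R) + (wH k x u' : R) :> R.
Proof. exact: linearP. Qed.

Lemma conn_matrix_linearr x (v : Hfib H x) : linear (conn_matrix v).
Proof.
move=> a u u'; rewrite /conn_matrix scaler_sumr -big_split; apply: eq_bigr => l _ /=.
rewrite scalerA -scalerDl; congr (_ *: _).
rewrite mulrN -opprD; congr (- _); rewrite mulr_sumr -big_split; apply: eq_bigr => j _ /=.
rewrite mulr_sumr -big_split; apply: eq_bigr => k _ /=.
rewrite wH_lin; ring.
Qed.

Lemma conn_matrix_linearl x (u : Hfib H x) : linear (fun v => conn_matrix v u).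
Proof.
move=> a v v'; rewrite /conn_matrix scaler_sumr -big_split; apply: eq_bigr => l _ /=.
rewrite scalerA -scalerDl; congr (_ *: _).
rewrite mulrN -opprD; congr (- _); rewrite mulr_sumr -big_split; apply: eq_bigr => j _ /=.
rewrite mulr_sumr -big_split; apply: eq_bigr => k _ /=.
rewrite wH_lin; ring.
Qed.

Lemma conn_matrix_XH x j k : U x -> (j < 4)%N -> (k < 4)%N ->
  conn_matrix (XH j x) (XH k x) = \sum_(l < 4) (- (Gc j l k x : R)) *: XH l x.
Proof.
move=> Ux j4 k4; apply: eq_bigr => l _; congr (- _ *: _).
rewrite (bigD1 (Ordinal j4)) //= [X in _ + X]big1 ?addr0; last first.
  move=> j' nj; rewrite big1// => k' _; rewrite (wH_XH Ux)// [j == j' :> nat](_ : _ = false) ?mul0r//.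
  by apply/negbTE; rewrite eq_sym.
rewrite (bigD1 (Ordinal k4)) //= [X in _ + X]big1 ?addr0; last first.
  move=> k' nj; rewrite (wH_XH (k := k) Ux)// [k == k' :> nat](_ : _ = false) ?mulr0 ?mul0r//.
  by apply/negbTE; rewrite eq_sym.
by rewrite !wH_XH// !eqxx !mul1r.
Qed.

Section Local.
Variable V : set M.
Hypotheses (oV : open V) (VU : V `<=` U).

Lemma XH_section k : (k < 4)%N -> Hsection V (XH k).
Proof.
move=> k4; apply: (@smooth_field_eq _ _ _ V (X k)) => //; last first.
  exact: smooth_field_sub VU (frame_smoothX fr k4).
by move=> y /VU Uy; rewrite vsval_XH.
Qed.

Lemma comb_section (f : nat -> M -> R^o) : (forall k, (k < 4)%N -> smooth_fun V (f k)) ->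
  Hsection V (fun y => \sum_(k < 4) (f k y : R) *: XH k y).
Proof.
move=> sf; apply: (Hsection_comb (f := fun (k : 'I_4) => f k) (Y := fun (k : 'I_4) => XH k)) => // k.
  by apply: sf; apply: ltn_ord.
by apply: XH_section; apply: ltn_ord.
Qed.

Lemma cst_ext_section x (u : Hfib H x) : Hsection V (cst_ext u).
Proof. by apply: (comb_section (f := fun k _ => wH k x u)) => k _; apply: smooth_fun_cst. Qed.

Lemma wH_section k : (k < 4)%N -> Hdual_section V (wH k).
Proof.
by move=> k4; apply: restrict_section => //; apply: smooth_form_sub VU (frame_smoothw fr k4).
Qed.

Lemma coef_smooth k Y : (k < 4)%N -> Hsection V Y -> smooth_fun V (fun y => wH k y (Y y) : R^o).
Proof. by move=> k4 sY; apply: (wH_section k4 (V := V)). Qed.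

Lemma conn_matrix_section A Y : Hsection V A -> Hsection V Y -> Hsection V (fun x => conn_matrix (A x) (Y x)).
Proof.
move=> sA sY; apply: (comb_section (f := fun l x => - \sum_(j < 4) \sum_(k < 4)
   (wH j x (A x) : R) * (wH k x (Y x) : R) * (Gc j l k x : R) : R^o)) => l l4.
apply: smooth_funN => //; apply: smooth_fun_sum => // j _; apply: smooth_fun_sum => // k _.
apply: smooth_funM => //; first by apply: smooth_funM => //; apply: coef_smooth => //; apply: ltn_ord.
by apply: smooth_fun_sub VU (sG _ _ _) => //; apply: ltn_ord.
Qed.

Lemma nabla_field_section A Y : Hsection V A -> Hsection V Y -> Hsection V (fun x => nabla_field Y (A x)).
Proof.
move=> sA sY.
refine (@HsectionD _ _ _ _ V (fun x => \sum_(k < 4) (dirder (vsval (A x) : tangent x)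
   (fun y => wH k y (Y y) : R^o) : R) *: XH k x) (fun x => conn_matrix (A x) (Y x)) oV _ (conn_matrix_section sA sY)).
apply: (comb_section (f := fun k x => dirder (vsval (A x) : tangent x) (fun y => wH k y (Y y) : R^o))) => k k4.
exact: (dirder_smooth oV (coef_smooth k4 sY) sA).
Qed.

End Local.
End FrameConnection.

Section FormConnTheory.
Variables (R : realType) (M : smooth_manifold R 5) (H E F : vdistribution M).
Variables (U : set M) (X : nat -> forall y : M, tangent y) (Z : forall y : M, tangent y).
Variables (w : nat -> forall y : M, cotangent y) (tau : forall y : M, cotangent y).
Variable Gc : nat -> nat -> nat -> M -> R^o.
Hypothesis fr : is_frame H E F U X Z w tau.
Hypothesis sG : forall j i k, (j < 4)%N -> (i < 4)%N -> (k < 4)%N -> smooth_fun U (Gc j i k).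

Local Notation xh := (XH H X).
Local Notation wh := (wH H w).
Local Notation ext := (cst_ext X w).
Local Notation gm := (conn_matrix X w Gc).
Local Notation DD := (form_conn X w Gc).
Local Notation nh := (nabla_field X w Gc).

Section Form.
Variables (k : nat) (V : set M).
Hypotheses (oV : open V) (VU : V `<=` U).
Implicit Types (s t : forall x, Hform H k x).

Lemma form_connE s x (v : Hfib H x) u : DD s v u =
  (dirder (vsval v : tangent x) (fun y => s y [tuple ext (tnth u i) y | i < k] : R^o) : R)
  - \sum_(i < k) (s x (tset u i (gm v (tnth u i))) : R).
Proof. by []. Qed.

Lemma Hform_linE x (f g : Hform H k x) (a : R) u : (a *: f + g) u = a * (f u : R) + (g u : R) :> R.
Proof. by []. Qed.

Lemma ext_smooth s x (u : k.-tuple (Hfib H x)) : Hform_section V s ->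
  smooth_fun V (fun y => s y [tuple ext (tnth u i) y | i < k] : R^o).
Proof.
by move=> [_ h]; apply: (h V (fun i => ext (tnth u i))) => // j; apply: (cst_ext_section fr oV VU).
Qed.

Lemma ext_tset x (u : k.-tuple (Hfib H x)) i a y :
  [tuple ext (tnth (tset u i a) j) y | j < k] = tset [tuple ext (tnth u j) y | j < k] i (ext a y).
Proof.
rewrite tset_mktuple; apply: eq_from_tnth => j; rewrite !tnth_mktuple.
by case: eqP.
Qed.

Lemma ext_at x (u : k.-tuple (Hfib H x)) : V x -> [tuple ext (tnth u i) x | i < k] = u.
Proof.
by move=> /VU Ux; apply: eq_from_tnth => j; rewrite tnth_mktuple (cst_ext_at fr).
Qed.

Lemma form_conn_linear s x : Hform_section V s -> V x -> linear (@form_conn R M H X w Gc k s x).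
Proof.
move=> ss Vx a v v'; apply/funext => u.
rewrite [RHS]Hform_linE !form_connE linearP (dirder_linear Vx (ext_smooth u ss)).
have -> : \sum_(i < k) (s x (tset u i (gm (a *: v + v') (tnth u i))) : R)
   = a * (\sum_(i < k) (s x (tset u i (gm v (tnth u i))) : R))
     + \sum_(i < k) (s x (tset u i (gm v' (tnth u i))) : R).
  rewrite mulr_sumr -big_split; apply: eq_bigr => i _.
  have [al _] := ss; have l := alt_linear (al x Vx) u i.
  by rewrite (@conn_matrix_linearl R M H X w Gc x (tnth u i) a v v') l.
rewrite /GRing.scale /=; ring.
Qed.

Lemma form_conn_alt s x v : Hform_section V s -> V x -> altform (DD s v : Hform H k x).
Proof.
move=> ss Vx; have [al _] := ss; have ax := al x Vx.
split=> [u i a b c|u i j ij e].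
  rewrite !form_connE.
  have e1 : dirder (vsval v : tangent x)
      (fun y => s y [tuple ext (tnth (tset u i (a *: b + c)) j) y | j < k] : R^o)
     = a * (dirder (vsval v : tangent x) (fun y => s y [tuple ext (tnth (tset u i b) j) y | j < k] : R^o) : R)
     + (dirder (vsval v : tangent x) (fun y => s y [tuple ext (tnth (tset u i c) j) y | j < k] : R^o) : R) :> R.
    have sb := ext_smooth (tset u i b) ss; have sc := ext_smooth (tset u i c) ss.
    have sab := smooth_funM oV (smooth_fun_cst V (a : R^o)) sb.
    apply: etrans (etrans (dirderD Vx (vsval v : tangent x) sab sc) _); last first.
      rewrite (dirderM Vx _ (smooth_fun_cst V (a : R^o)) sb) dirder_cst mulr0 addr0; reflexivity.
    apply: (dirder_eq oV Vx) => y Vy; rewrite !ext_tset cst_ext_linear.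
    by rewrite (alt_linear (al y Vy) _ i).
  rewrite e1.
  have e2 : \sum_(l < k) (s x (tset (tset u i (a *: b + c)) l (gm v (tnth (tset u i (a *: b + c)) l))) : R)
    = a * (\sum_(l < k) (s x (tset (tset u i b) l (gm v (tnth (tset u i b) l))) : R))
    + \sum_(l < k) (s x (tset (tset u i c) l (gm v (tnth (tset u i c) l))) : R).
    rewrite mulr_sumr -big_split; apply: eq_bigr => l _ /=.
    rewrite !tnth_tset; case: (eqVneq l i) => [->|li].
      by rewrite !tset_same conn_matrix_linearr (alt_linear ax).
    have il : i != l by rewrite eq_sym.
    by rewrite !(tset_comm _ _ _ il) (alt_linear ax).
  rewrite e2 /GRing.scale /=; ring.
rewrite form_connE (bigD1 i) //= (bigD1 j) //=; last by rewrite eq_sym.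
rewrite big1 => [|l /andP[li lj]]; last first.
  apply: (alt_eq0 ax ij); rewrite !tnth_tset.
  by rewrite eq_sym (negbTE li) eq_sym (negbTE lj).
have -> : dirder (vsval v : tangent x) (fun y => s y [tuple ext (tnth u l) y | l < k] : R^o) = 0.
  rewrite -(dirder_cst (vsval v : tangent x) (0 : R^o)); apply: (dirder_eq oV Vx) => y Vy.
  by apply: (alt_eq0 (al y Vy) ij); rewrite !tnth_mktuple e.
have sw := alt_swap ax u (gm v (tnth u i)) (tnth u i) ij.
have e3 : tset (tset u i (gm v (tnth u i))) j (tnth u i) = tset u i (gm v (tnth u i)).
  by rewrite e (tset_comm _ _ _ ij) tset_id.
have e4 : tset (tset u i (tnth u i)) j (gm v (tnth u i)) = tset u j (gm v (tnth u j)).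
  by rewrite tset_id e.
by rewrite e3 e4 in sw; rewrite addr0 sw subr0.
Qed.

Lemma form_conn_local s t x (v : Hfib H x) : V x -> (forall y, V y -> s y = t y) -> DD s v = DD t v.
Proof.
move=> Vx e; apply/funext => u; rewrite !form_connE e//; congr (_ - _).
by apply: (dirder_eq oV Vx) => y Vy; rewrite e.
Qed.

Lemma form_conn_lin s t x (v : Hfib H x) (a : R) : Hform_section V s -> Hform_section V t -> V x ->
  DD (fun y => a *: s y + t y) v = a *: DD s v + DD t v.
Proof.
move=> ss st Vx; apply/funext => u; rewrite [RHS]Hform_linE !form_connE.
have sb := ext_smooth u ss; have sc := ext_smooth u st.
have sab := smooth_funM oV (smooth_fun_cst V (a : R^o)) sb.
have e1 := etrans (dirderD Vx (vsval v : tangent x) sab sc) (f_equal (fun r : R => r + _)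
  (dirderM Vx _ (smooth_fun_cst V (a : R^o)) sb)).
rewrite dirder_cst mulr0 addr0 in e1.
rewrite mulrBr mulr_sumr addrACA -opprD -big_split /=.
congr (_ - _); exact: e1.
Qed.

Lemma form_conn_leibniz s x (v : Hfib H x) (f : M -> R^o) : Hform_section V s -> smooth_fun V f -> V x ->
  DD (fun y => (f y : R) *: s y) v
  = (f x : R) *: DD s v + (dirder (vsval v : tangent x) f : R) *: (s x : Hform H k x).
Proof.
move=> ss sf Vx; apply/funext => u; rewrite [RHS]Hform_linE !form_connE.
have sb := ext_smooth u ss.
have e1 := dirderM Vx (vsval v : tangent x) sf sb; rewrite /= ext_at// in e1.
have -> : ((dirder (vsval v : tangent x) f : R) *: (s x : Hform H k x)) u
   = (dirder (vsval v : tangent x) f : R) * (s x u : R) by [].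
have -> : \sum_(i < k) (((f x : R) *: s x : Hform H k x) (tset u i (gm v (tnth u i))) : R)
   = (f x : R) * \sum_(i < k) (s x (tset u i (gm v (tnth u i))) : R) by rewrite mulr_sumr.
rewrite mulrBr addrAC; congr (_ - _).
by apply: (etrans e1); rewrite [X in _ + X]mulrC.
Qed.

End Form.
End FormConnTheory.

Section DirderN.
Variables (R : realType) (n : nat) (M : smooth_manifold R n) (V : set M) (x : M) (v : tangent x).
Hypotheses (oV : open V) (Vx : V x).

Lemma dirderN (f : M -> R^o) : smooth_fun V f ->
  dirder v (fun y => - (f y : R) : R^o) = - (dirder v f : R) :> R.
Proof.
move=> sf.
have e : dirder v (fun y => - (f y : R) : R^o) = dirder v (fun y => (-1 : R) * (f y : R) : R^o).
  by apply: (dirder_eq oV Vx) => y _; rewrite mulN1r.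
apply: (etrans e); apply: (etrans (dirderM Vx v (smooth_fun_cst V (-1 : R^o)) sf)).
by rewrite dirder_cst mulr0 addr0 mulN1r.
Qed.

Lemma dirder_cstB (c : R) (f : M -> R^o) : smooth_fun V f ->
  dirder v (fun y => c - (f y : R) : R^o) = - (dirder v f : R) :> R.
Proof.
move=> sf; apply: (etrans (dirderD Vx v (smooth_fun_cst V (c : R^o)) (smooth_funN oV sf))).
by rewrite dirder_cst add0r dirderN.
Qed.

End DirderN.

Section FormConnKey.
Variables (R : realType) (M : smooth_manifold R 5) (H E F : vdistribution M).
Variables (U : set M) (X : nat -> forall y : M, tangent y) (Z : forall y : M, tangent y).
Variables (w : nat -> forall y : M, cotangent y) (tau : forall y : M, cotangent y).
Variable Gc : nat -> nat -> nat -> M -> R^o.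
Hypothesis fr : is_frame H E F U X Z w tau.
Hypothesis sG : forall j i k, (j < 4)%N -> (i < 4)%N -> (k < 4)%N -> smooth_fun U (Gc j i k).

Local Notation xh := (XH H X).
Local Notation wh := (wH H w).
Local Notation ext := (cst_ext X w).
Local Notation gm := (conn_matrix X w Gc).
Local Notation DD := (form_conn X w Gc).
Local Notation nh := (nabla_field X w Gc).

Section Form.
Variables (V : set M).
Hypotheses (oV : open V) (VU : V `<=` U).

Section Key.
Variables (k : nat) (s : forall x, Hform H k x) (Y : 'I_k -> forall x, Hfib H x) (x : M) (v : Hfib H x).
Arguments s : clear implicits.
Hypotheses (ss : Hform_section V s) (sY : forall j, Hsection V (Y j)) (Vx : V x).

(* the arguments with index below [m] already have constant coefficients *)
Let mixY m i y := if (val i < m)%N then ext (Y i x) y else Y i y.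
Let dY i : Hfib H x :=
  \sum_(c < 4) (dirder (vsval v : tangent x) (fun y => wh c y (Y i y) : R^o) : R) *: xh c x.
Let T := [tuple Y j x | j < k].

Let mixY_section m i : Hsection V (mixY m i).
Proof.
by rewrite /mixY; case: (val i < m)%N; [exact: (cst_ext_section fr oV VU)|exact: sY].
Qed.

Let mixY_x m : [tuple mixY m i x | i < k] = T.
Proof.
apply: eq_from_tnth => j; rewrite !tnth_mktuple /mixY.
by case: ifP => // _; rewrite (cst_ext_at fr)//; apply: VU.
Qed.

Let freeze_step (i : 'I_k) :
  dirder (vsval v : tangent x) (fun y => s y [tuple mixY i.+1 j y | j < k] : R^o)
  = (dirder (vsval v : tangent x) (fun y => s y [tuple mixY i j y | j < k] : R^o) : R)
    - (s x (tset T i (dY i)) : R) :> R.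
Proof.
pose P (c : 'I_4) y : R^o := (wh c x (Y i x) : R) - (wh c y (Y i y) : R).
pose Q (c : 'I_4) y : R^o := s y [tuple if j == i then xh c y else mixY i j y | j < k].
have sc c := coef_smooth fr oV VU (ltn_ord c) (sY i).
have sP c : smooth_fun V (P c) := smooth_funB oV (smooth_fun_cst V _) (sc c).
have sQ c : smooth_fun V (Q c).
  have [_ h] := ss; apply: (h V (fun j y => if j == i then xh c y else mixY i j y) oV (@subset_refl _ V)) => j.
  case: (j == i); first exact: (XH_section fr oV VU (ltn_ord c)).
  exact: mixY_section.
have sPQ c := smooth_funM oV (sP c) (sQ c).
have s1 : smooth_fun V (fun y => s y [tuple mixY i j y | j < k] : R^o).
  have [_ h] := ss; apply: (h V (fun j y => mixY i j y) oV (@subset_refl _ V)) => j.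
  exact: mixY_section.
have e y : V y -> s y [tuple mixY i.+1 j y | j < k]
    = (s y [tuple mixY i j y | j < k] : R) + \sum_(c < 4) (P c y : R) * (Q c y : R) :> R.
  move=> Vy; have [al _] := ss; have l := alt_linear (al y Vy) [tuple mixY i j y | j < k] i.
  have e1 : [tuple mixY i j y | j < k] = tset [tuple mixY i j y | j < k] i (Y i y).
    rewrite tset_mktuple; apply: eq_from_tnth => j; rewrite !tnth_mktuple.
    by case: eqP => [->|//]; rewrite /mixY ltnn.
  have e2 : [tuple mixY i.+1 j y | j < k] = tset [tuple mixY i j y | j < k] i (ext (Y i x) y).
    rewrite tset_mktuple; apply: eq_from_tnth => j; rewrite !tnth_mktuple.
    case: eqP => [->|/eqP ji]; first by rewrite /mixY ltnS leqnn.
    by rewrite /mixY ltnS leq_eqVlt val_eqE (negbTE ji).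
  have e3 : s y [tuple mixY i.+1 j y | j < k] =
      \sum_(c < 4) (wh c x (Y i x) : R) * (s y (tset [tuple mixY i j y | j < k] i (xh c y)) : R) :> R.
    by rewrite e2; apply: (lin_comb l).
  have e4 : s y [tuple mixY i j y | j < k] =
      \sum_(c < 4) (wh c y (Y i y) : R) * (s y (tset [tuple mixY i j y | j < k] i (xh c y)) : R) :> R.
    rewrite [in LHS]e1 [X in tset _ _ X](H_expand fr _ (VU Vy)); exact: (lin_comb l).
  rewrite e3 e4 -big_split; apply: eq_bigr => c _ /=.
  rewrite /Q -tset_mktuple /P; ring.
apply: (etrans (dirder_eq oV Vx (vsval v : tangent x) e)).
apply: (etrans (dirderD Vx (vsval v : tangent x) s1 (smooth_fun_sum oV _ (fun c _ => sPQ c)))).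
congr (_ + _).
apply: (etrans (dirder_sum oV Vx (vsval v : tangent x) _ (fun c _ => sPQ c))).
have [al _] := ss; have l := alt_linear (al x Vx) T i.
rewrite /dY (lin_comb l) -sumrN; apply: eq_bigr => c _.
apply: (etrans (dirderM Vx (vsval v : tangent x) (sP c) (sQ c))).
have -> : P c x = 0 by rewrite /P subrr.
have -> : Q c x = s x (tset T i (xh c x)) by rewrite /Q -tset_mktuple mixY_x.
rewrite mul0r add0r (dirder_cstB (vsval v : tangent x) oV Vx _ (sc c)).
by rewrite mulrN mulrC.
Qed.

Let freeze m : (m <= k)%N ->
  dirder (vsval v : tangent x) (fun y => s y [tuple mixY m j y | j < k] : R^o)
  = (dirder (vsval v : tangent x) (fun y => s y [tuple Y j y | j < k] : R^o) : R)
    - \sum_(i < k | (i < m)%N) (s x (tset T i (dY i)) : R) :> R.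
Proof.
elim: m => [_|m IH mk]; first by rewrite big_pred0// subr0.
apply: (etrans (freeze_step (Ordinal mk))); rewrite (IH (ltnW mk)).
rewrite [in RHS](bigD1 (Ordinal mk))//= opprD addrA addrAC; congr (_ - _ - _).
apply: eq_bigl => j; rewrite ltnS [in RHS]leq_eqVlt andb_orl.
rewrite -val_eqE /= andbN /= andbC.
by case: ltngtP.
Qed.

(** Arbitrary sections as arguments are replaced by their constant-coefficient
    extensions one at a time, and each replacement contributes the derivatives of the coefficients, that is the difference
    between [nabla_field] and [conn_matrix]. *)
Lemma form_conn_key : DD s v T = (dirder (vsval v : tangent x) (fun y => s y [tuple Y j y | j < k] : R^o) : R)
   - \sum_(i < k) (s x (tset T i (nh (Y i) v)) : R) :> R.
Proof.
rewrite form_connE; have f := freeze (leqnn k).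
have e1 : dirder (vsval v : tangent x) (fun y => s y [tuple ext (tnth T i) y | i < k] : R^o)
   = dirder (vsval v : tangent x) (fun y => s y [tuple mixY k j y | j < k] : R^o).
  apply: (dirder_eq oV Vx) => y _; congr (s y _); apply: eq_from_tnth => j.
  by rewrite !tnth_mktuple /mixY ltn_ord.
rewrite e1 f -addrA -opprD; congr (_ - _).
rewrite (eq_bigl xpredT); last by move=> j; apply: ltn_ord.
rewrite -big_split; apply: eq_bigr => i _ /=.
have [al _] := ss; have l := alt_linear (al x Vx) T i.
by rewrite /nabla_field tnth_mktuple -(linD l).
Qed.

End Key.
End Form.

Lemma form_conn_section V k (s : forall x, Hform H k x) A : open V -> V `<=` U -> Hform_section V s -> Hsection V A ->
  Hform_section V (fun x => DD s (A x)).
Proof.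
move=> oV VU ss sA; split=> [x Vx|W Y oW WV sY]; first exact: (form_conn_alt _ fr oV VU _ ss Vx).
have ssW := Hform_section_sub WV ss; have sAW := Hsection_sub WV sA.
have WU := subset_trans WV VU.
have s1 : smooth_fun W (fun y => s y [tuple Y j y | j < k] : R^o) by have [_ h] := ssW; apply: h.
have h1 := dirder_smooth oW s1 sAW.
have h2 i : smooth_fun W (fun x => s x (tset [tuple Y j x | j < k] i (nh (Y i) (A x))) : R^o).
  have [_ h] := ssW.
  have := h W (fun j x => if j == i then nh (Y i) (A x) else Y j x) oW (@subset_refl _ W).
  have hs j : Hsection W (fun x => if j == i then nh (Y i) (A x) else Y j x).
    case: (j == i); last exact: sY.
    exact: (nabla_field_section fr sG oW WU sAW (sY i)).
  move=> /(_ hs); apply: smooth_fun_eq => // x _; by rewrite tset_mktuple.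
apply: (smooth_fun_eq oW _ (smooth_funB oW h1 (smooth_fun_sum oW (index_enum 'I_k) (fun i _ => h2 i)))).
by move=> x Wx; rewrite (form_conn_key oW WU (A x) ssW sY Wx).
Qed.

(** The identification of [Hdual] with forms of degree 1. *)
Definition lift1 (a : forall x, Hdual H x) y : Hform H 1 y := fun t => a y (tnth t ord0).
Definition conn (a : forall x, Hdual H x) x (v : Hfib H x) : Hdual H x :=
  linfun (fun u : Hfib H x => DD (lift1 a) v [tuple u] : R^o).

Lemma lift1_section V a : Hdual_section V a -> Hform_section V (lift1 a).
Proof.
move=> sa; split=> [x Vx|W Y oW WV sY].
  split=> [t i c p q|t i j]; last by rewrite !ord1.
  by rewrite /lift1 !tnth_tset !ord1 !eqxx linearP.
apply: smooth_fun_eq oW _ (sa W (Y ord0) oW WV (sY ord0)) => x Wx.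
by rewrite /lift1 tnth_mktuple.
Qed.

Lemma tset1 (T : Type) (a b : T) : tset [tuple a] ord0 b = [tuple b].
Proof. by apply: eq_from_tnth => j; rewrite tnth_tset !ord1. Qed.

Section ConnTheory.
Variables (V : set M).
Hypotheses (oV : open V) (VU : V `<=` U).
Implicit Types (a b : forall x, Hdual H x).

Lemma connD a x (v u : Hfib H x) : Hdual_section V a -> V x ->
  conn a v u = DD (lift1 a) v [tuple u].
Proof.
move=> sa Vx; have al := form_conn_alt Gc fr oV VU v (lift1_section sa) Vx.
have l : linear (fun u : Hfib H x => DD (lift1 a) v [tuple u] : R^o).
  by move=> c p q; have := alt_linear al [tuple u] ord0 c p q; rewrite !tset1.
pose hl := GRing.isLinear.Build _ _ _ _ _ l.
pose r : {linear _ -> _} := HB.pack (fun u : Hfib H x => DD (lift1 a) v [tuple u] : R^o) hl.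
exact: (lfunE r u).
Qed.

Lemma connE a x (v u : Hfib H x) : Hdual_section V a -> V x ->
  conn a v u = (dirder (vsval v : tangent x) (fun y => a y (ext u y) : R^o) : R)
    - (a x (gm v u) : R) :> R.
Proof.
move=> sa Vx; rewrite connD// form_connE big_ord1 /lift1; congr (_ - _).
  by apply: (dirder_eq oV Vx) => y _; rewrite tnth_mktuple.
by rewrite tnth_tset eqxx.
Qed.

Lemma conn_nabla_field a Y x (v : Hfib H x) : Hdual_section V a -> Hsection V Y -> V x ->
  conn a v (Y x) = (dirder (vsval v : tangent x) (fun y => a y (Y y) : R^o) : R)
    - (a x (nh Y v) : R) :> R.
Proof.
move=> sa sY Vx; rewrite connD//.
have := form_conn_key oV VU v (Y := fun=> Y) (lift1_section sa) (fun=> sY) Vx.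
have lt z T : @lift1 a x (tset T ord0 z) = a x z by rewrite /lift1 tnth_tset eqxx.
rewrite big_ord1 lt.
have -> : [tuple Y x | _ < 1] = [tuple Y x] by apply: eq_from_tnth => j; rewrite tnth_mktuple !ord1.
move=> ->; congr (_ - _).
by apply: (dirder_eq oV Vx) => y _; rewrite /lift1 tnth_mktuple.
Qed.

Lemma conn_linear a x : Hdual_section V a -> V x -> linear (@conn a x).
Proof.
move=> sa Vx c v v'; apply/lfunP => u; rewrite add_lfunE scale_lfunE !connD//.
by rewrite (form_conn_linear Gc fr oV VU (lift1_section sa) Vx).
Qed.

Lemma conn_section a A : Hdual_section V a -> Hsection V A ->
  Hdual_section V (fun x => conn a (A x)).
Proof.
move=> sa sA W Y oW WV sY.
have [_ h] := form_conn_section oV VU (lift1_section sa) sA.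
apply: smooth_fun_eq oW _ (h W (fun=> Y) oW WV (fun=> sY)) => x Wx.
rewrite connD//; last exact: WV.
by congr (form_conn _ _ _ _ _ _); apply: eq_from_tnth => j; rewrite tnth_mktuple !ord1.
Qed.

Lemma conn_local a b x (v : Hfib H x) : Hdual_section V a -> Hdual_section V b -> V x ->
  (forall y, V y -> a y = b y) -> conn a v = conn b v.
Proof.
move=> sa sb Vx e; apply/lfunP => u; rewrite !connD//.
rewrite (form_conn_local X w Gc oV v (s := lift1 a) (t := lift1 b) Vx) // => y Vy.
by apply/funext => t; rewrite /lift1 e.
Qed.

Lemma Hdual_section_lin a b (c : R) : Hdual_section V a -> Hdual_section V b ->
  Hdual_section V (fun y => c *: a y + b y).
Proof.
move=> sa sb W Y oW WV sY.
have h := smooth_funD oW (smooth_funM oW (smooth_fun_cst W (c : R^o)) (sa W Y oW WV sY)) (sb W Y oW WV sY).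
by apply: smooth_fun_eq oW _ h => x Wx; rewrite add_lfunE scale_lfunE.
Qed.

Lemma Hdual_section_scale a (f : M -> R^o) : Hdual_section V a -> smooth_fun V f ->
  Hdual_section V (fun y => (f y : R) *: a y).
Proof.
move=> sa sf W Y oW WV sY.
have h := smooth_funM oW (smooth_fun_sub WV sf) (sa W Y oW WV sY).
by apply: smooth_fun_eq oW _ h => x Wx; rewrite scale_lfunE.
Qed.

Lemma conn_lin a b x (v : Hfib H x) (c : R) : Hdual_section V a -> Hdual_section V b -> V x ->
  conn (fun y => c *: a y + b y) v = c *: conn a v + conn b v.
Proof.
move=> sa sb Vx; apply/lfunP => u; rewrite add_lfunE scale_lfunE.
rewrite !connD//; last exact: Hdual_section_lin.
have -> : lift1 (fun y => c *: a y + b y) = (fun y => c *: @lift1 a y + @lift1 b y).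
  by apply: functional_extensionality_dep => y; apply/funext => t; rewrite /lift1 add_lfunE scale_lfunE.
by rewrite (form_conn_lin Gc fr oV VU v c (lift1_section sa) (lift1_section sb) Vx).
Qed.

Lemma conn_leibniz a x (v : Hfib H x) (f : M -> R^o) : Hdual_section V a -> smooth_fun V f -> V x ->
  conn (fun y => (f y : R) *: a y) v
  = (f x : R) *: conn a v + (dirder (vsval v : tangent x) f : R) *: a x.
Proof.
move=> sa sf Vx; apply/lfunP => u; rewrite add_lfunE !scale_lfunE.
rewrite !connD//; last exact: Hdual_section_scale.
have -> : lift1 (fun y => (f y : R) *: a y) = (fun y => (f y : R) *: @lift1 a y).
  by apply: functional_extensionality_dep => y; apply/funext => t; rewrite /lift1 scale_lfunE.
by rewrite (form_conn_leibniz Gc fr oV VU v (lift1_section sa) sf Vx).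
Qed.

Lemma wedge_section k (b : 'I_k -> forall x, Hdual H x) : (forall i, Hdual_section V (b i)) ->
  Hform_section V (fun y => wedge (fun i => b i y) : Hform H k y).
Proof.
move=> sb; split=> [x Vx|W Y oW WV sY].
  pose N t : 'M[R]_k := \matrix_(j, i) (b i x (tnth t j) : R).
  have eN t : wedge (fun i => b i x) t = \det (N t).
    by rewrite /wedge -det_tr; congr (\det _); apply/matrixP => i j; rewrite !mxE.
  split=> [t i c p q|t i j ij e]; rewrite !eN.
    rewrite (determinant_multilinear (B := N (tset t i p)) (C := N (tset t i q))
      (i0 := i) (b := c) (c := 1)) ?mul1r//.
    - by apply/rowP => l; rewrite !mxE !tnth_tset eqxx linearP mul1r.
    - by apply/matrixP => l l'; rewrite !mxE !tnth_tset eq_sym (negbTE (neq_lift _ _)).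
    - by apply/matrixP => l l'; rewrite !mxE !tnth_tset eq_sym (negbTE (neq_lift _ _)).
  by apply: (determinant_alternate ij) => l; rewrite !mxE e.
have h : smooth_fun W (fun y => \det (\matrix_(i, j) (b i y (Y j y) : R)) : R^o).
  apply: (smooth_fun_det oW) => i j.
  under eq_fun do rewrite mxE; exact: (sb i W (Y j) oW WV (sY j)).
apply: (smooth_fun_eq oW _ h) => x Wx.
by rewrite /wedge; congr (\det _); apply/matrixP => i j; rewrite !mxE tnth_mktuple.
Qed.

(** Evaluated on arguments, a wedge product is a determinant. The derivatives of
    the forms replace its rows, whereas the connection terms of [form_conn]
    replace its columns; [sum_det_replace] exchanges the two. *)
Lemma form_conn_wedge k (b : 'I_k -> forall x, Hdual H x) x (v : Hfib H x) :
  (forall i, Hdual_section V (b i)) -> V x ->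
  DD (fun y => wedge (fun i => b i y)) v
  = \sum_(i < k) wedge (fun j => if j == i then conn (b j) v else b j x) :> Hform H k x.
Proof.
move=> sb Vx; apply/funext => u.
have -> : (\sum_(i < k) wedge (fun j => if j == i then conn (b j) v else b j x) : Hform H k x) u
  = \sum_(i < k) wedge (fun j => if j == i then conn (b j) v else b j x) u.
  by rewrite fct_sumE.
rewrite form_connE.
pose A y : 'M[R]_k := \matrix_(i, j) (b i y (ext (tnth u j) y) : R).
have sA i j : smooth_fun V (fun y => A y i j : R^o).
  under eq_fun do rewrite mxE; exact: (sb i V _ oV (@subset_refl _ V) (cst_ext_section fr oV VU _)).
have Ax i j : A x i j = b i x (tnth u j) by rewrite mxE (cst_ext_at fr)//; apply: VU.
pose B : 'M[R]_k := \matrix_(i, j) (b i x (gm v (tnth u j)) : R).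
have e1 : dirder (vsval v : tangent x) (fun y => wedge (fun i => b i y) [tuple ext (tnth u i) y | i < k] : R^o)
  = dirder (vsval v : tangent x) (fun y => \det (A y) : R^o).
  apply: (dirder_eq oV Vx) => y _; rewrite /wedge; congr (\det _).
  by apply/matrixP => i j; rewrite !mxE tnth_mktuple.
rewrite e1 (dirder_det _ oV Vx sA).
have -> : \sum_(i < k) (wedge (fun i0 => b i0 x) (tset u i (gm v (tnth u i))) : R)
  = \sum_j \det (\matrix_(a, d) if d == j then B a j else A x a d).
  apply: eq_bigr => i _; rewrite /wedge; congr (\det _); apply/matrixP => a d; rewrite !mxE tnth_tset.
  by case: eqP => // _; rewrite (cst_ext_at fr)//; apply: VU.
rewrite -sum_det_replace -sumrB; apply: eq_bigr => i _.
pose D : 'M[R]_k := \matrix_(a, d) (dirder (vsval v : tangent x) (fun y => A y a d : R^o) : R).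
have -> : \det (\matrix_(a, d) (if a == i then (dirder (vsval v : tangent x) (fun y => A y i d : R^o) : R) else A x a d))
  = \sum_j D i j * cofactor (A x) i j.
  rewrite -det_replace_row; congr (\det _); apply/matrixP => a d; rewrite !mxE; by [].
rewrite det_replace_row -sumrB.
pose C : 'M[R]_k := \matrix_(a, d) (conn (b a) v (tnth u d) : R).
have -> : wedge (fun j => if j == i then conn (b j) v else b j x) u
   = \det (\matrix_(a, d) (if a == i then C i d else A x a d)).
  rewrite /wedge; congr (\det _); apply/matrixP => a d; rewrite !mxE.
  by case: eqP => [->|_] //; rewrite (cst_ext_at fr)//; apply: VU.
rewrite det_replace_row; apply: eq_bigr => j _; rewrite -mulrBl; congr (_ * _).
rewrite !mxE (connE _ _ (sb i) Vx); congr (_ - _).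
by apply: (dirder_eq oV Vx) => y _; rewrite mxE.
Qed.

End ConnTheory.
End FormConnKey.

Section FrameChange.
Variables (R : realType) (M : smooth_manifold R 5) (H E F : vdistribution M).
Variables (U U' : set M) (X X' : nat -> forall y : M, tangent y) (Z Z' : forall y : M, tangent y).
Variables (w w' : nat -> forall y : M, cotangent y) (tau tau' : forall y : M, cotangent y).
Variables Gc Gc' : nat -> nat -> nat -> M -> R^o.
Hypothesis fr : is_frame H E F U X Z w tau.
Hypothesis fr' : is_frame H E F U' X' Z' w' tau'.
Variables (V : set M) (x : M) (v : Hfib H x).
Hypotheses (oV : open V) (VU : V `<=` U) (VU' : V `<=` U') (Vx : V x).
Hypothesis conn_eq : forall a, Hdual_section V a -> conn X w Gc a v = conn X' w' Gc' a v.

(** The connection on [H] is dual to the one on [Hdual], so it depends on the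
    frame only through the latter. *)
Lemma nabla_field_frame_change Y : Hsection V Y -> nabla_field X w Gc Y v = nabla_field X' w' Gc' Y v.
Proof.
move=> sY; apply: (H_ext fr' (VU' Vx)) => k k4.
have sw := wH_section fr' oV VU' k4.
have := conn_nabla_field Gc fr oV VU v sw sY Vx; have := conn_nabla_field Gc' fr' oV VU' v sw sY Vx.
move=> e1; rewrite conn_eq// e1 => /addrI/oppr_inj ->; reflexivity.
Qed.

Lemma form_conn_frame_change k (s : forall x, Hform H k x) : Hform_section V s ->
  form_conn X w Gc s v = form_conn X' w' Gc' s v.
Proof.
move=> ss; apply/funext => u.
have sY j : Hsection V (cst_ext X w (tnth u j)) := cst_ext_section fr oV VU _.
have eu : [tuple cst_ext X w (tnth u j) x | j < k] = u.
  by apply: eq_from_tnth => j; rewrite tnth_mktuple (cst_ext_at fr)//; apply: VU.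
have := form_conn_key Gc fr oV VU v ss sY Vx; have := form_conn_key Gc' fr' oV VU' v ss sY Vx.
rewrite !eu => -> ->; congr (_ - _); apply: eq_bigr => i _.
by rewrite nabla_field_frame_change.
Qed.

End FrameChange.

(** * The trace-free part of a 2-form *)

Section TwoForms.
Variables (R : realType) (n : nat) (M : smooth_manifold R n) (H : vdistribution M).
Variable x : M.
Implicit Types (B : Hform H 2 x) (u v : Hfib H x).

Lemma tuple2E (t : 2.-tuple (Hfib H x)) : t = [tuple tnth t ord0; tnth t ord_max].
Proof.
apply: eq_from_tnth => i; have : i = ord0 \/ i = ord_max.
  by case: i => [[|[|//]] p]; [left|right]; apply: val_inj.
by case=> ->; rewrite !(tnth_nth 0).
Qed.

Lemma tuple2_tset0 u u' v : tset [tuple u; v] ord0 u' = [tuple u'; v].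
Proof. by rewrite [LHS]tuple2E !tnth_tset /=; congr [tuple _; _]; rewrite (tnth_nth 0). Qed.

Lemma tuple2_tset1 u v v' : tset [tuple u; v] ord_max v' = [tuple u; v'].
Proof. by rewrite [LHS]tuple2E !tnth_tset /=; congr [tuple _; _]; rewrite (tnth_nth 0). Qed.

Lemma alt2_linl B v : altform B -> linear (fun u => B [tuple u; v]).
Proof.
move=> aB a p q; have l := alt_linear aB [tuple 0; v] ord0 a p q.
by rewrite !tuple2_tset0 in l.
Qed.

Lemma alt2_linr B u : altform B -> linear (fun v => B [tuple u; v]).
Proof.
move=> aB a p q; have l := alt_linear aB [tuple u; 0] ord_max a p q.
by rewrite !tuple2_tset1 in l.
Qed.

Lemma alt2_self B u : altform B -> B [tuple u; u] = 0.
Proof.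
by move=> aB; apply: (alt_eq0 aB (i := ord0) (j := ord_max)).
Qed.

Lemma alt2C B u v : altform B -> B [tuple u; v] = - (B [tuple v; u] : R) :> R.
Proof.
move=> aB; have := alt2_self (u + v) aB.
rewrite (linD (alt2_linl _ aB)) !(linD (alt2_linr _ aB)) !alt2_self// add0r addr0 => /eqP.
by rewrite addr_eq0 => /eqP.
Qed.

Lemma altform2 B : (forall v, linear (fun u => B [tuple u; v])) ->
  (forall u, linear (fun v => B [tuple u; v])) -> (forall u, B [tuple u; u] = 0) -> altform B.
Proof.
move=> ll lr l0; have i2 (i : 'I_2) : i = ord0 \/ i = ord_max.
  by case: i => [[|[|//]] p]; [left|right]; apply: val_inj.
split=> [t i|t i j ij e].
  rewrite (tuple2E t); case: (i2 i) => -> a p q.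
    by rewrite !tuple2_tset0 ll.
  by rewrite !tuple2_tset1 lr.
have e' : tnth t ord0 = tnth t ord_max.
  by case: (i2 i) ij e => ->; case: (i2 j) => ->; rewrite ?eqxx.
by rewrite (tuple2E t) e' l0.
Qed.

Lemma altform_lin k (f g : Hform H k x) (a : R) : altform f -> altform g -> altform (a *: f + g).
Proof.
move=> af ag; have lE t : (a *: f + g) t = a * (f t : R) + (g t : R) :> R by [].
split=> [t i c p q|t i j ij e].
  rewrite !lE (alt_linear af) (alt_linear ag) /GRing.scale /=; ring.
by rewrite lE (alt_eq0 af ij e) (alt_eq0 ag ij e) mulr0 addr0.
Qed.

Lemma altform0 k : altform (0 : Hform H k x).
Proof.
have z t : (0 : Hform H k x) t = 0 by [].
by split=> [t i c p q|//]; rewrite !z scaler0 addr0.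
Qed.

Lemma altformB k (f g : Hform H k x) : altform f -> altform g -> altform (f - g).
Proof. by move=> af ag; rewrite addrC -scaleN1r; apply: altform_lin. Qed.

Lemma altformZ k (f : Hform H k x) (a : R) : altform f -> altform (a *: f).
Proof. by move=> af; rewrite -[_ *: _]addr0; apply: altform_lin => //; exact: altform0. Qed.

Lemma gram_lin B B' a : gram (a *: B + B') = a *: gram B + gram B'.
Proof. by apply/matrixP => i j; rewrite !mxE. Qed.

Lemma gramZ B a : gram (a *: B) = a *: gram B.
Proof. by apply/matrixP => i j; rewrite !mxE. Qed.

Section Nondegenerate.
Variable J : Hform H 2 x.
Hypotheses (J_altform : altform J) (ndJ : forall u, (forall v, J [tuple u; v] = 0) -> u = 0).

Let b i : Hfib H x := tnth (vbasis {:Hfib H x}) i.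

Let b_expand u : u = \sum_i coord (vbasis {:Hfib H x}) i u *: b i.
Proof.
rewrite {1}(coord_vbasis (memvf u)); apply: eq_bigr => i _.
by rewrite /b (tnth_nth 0).
Qed.

Lemma gram_unit : gram J \in unitmx.
Proof.
rewrite -row_free_unit; apply: inj_row_free => a e.
have u0 : \sum_i a ord0 i *: b i = 0.
  apply: ndJ => v; rewrite (b_expand v) (lin_comb (alt2_linr _ J_altform)) big1// => j _.
  rewrite (lin_comb (alt2_linl _ J_altform)).
  move/rowP: e => /(_ j); rewrite !mxE => e.
  rewrite (_ : \sum_i _ = 0) ?scaler0// -[RHS]e; apply: eq_bigr => i _.
  by rewrite !mxE.
have := basis_free (vbasisP {:Hfib H x}) => /freeP h.
apply/rowP => i; rewrite mxE; apply: (h (fun i => a ord0 i)).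
by rewrite -[RHS]u0; apply: eq_bigr => j _; rewrite /b (tnth_nth 0).
Qed.

Definition jtrace B : R := \tr (invmx (gram J) *m gram B).

Lemma jtrace_lin B B' a : jtrace (a *: B + B') = a * jtrace B + jtrace B'.
Proof. by rewrite /jtrace gram_lin mulmxDr -scalemxAr mxtraceD mxtraceZ. Qed.

Lemma jtraceB B B' : jtrace (B - B') = jtrace B - jtrace B'.
Proof. by rewrite addrC -scaleN1r jtrace_lin mulN1r addrC. Qed.

Lemma jtraceZ B a : jtrace (a *: B) = a * jtrace B.
Proof. by rewrite /jtrace gramZ -scalemxAr mxtraceZ. Qed.

Lemma jtraceJ : jtrace J = (\dim {:Hfib H x})%:R.
Proof. by rewrite /jtrace mulVmx ?gram_unit// mxtrace1. Qed.

(** With [Q] the matrix of [pi], the hypotheses read [Q *m B = B = B *m Q^T] and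
    [invmx J *m Q = invmx J - Q^T *m invmx J]; moving [Q] around the trace then
    gives [jtrace B = jtrace B - jtrace B]. *)
Lemma jtrace_projection B (pi : Hfib H x -> Hfib H x) : altform B -> linear pi ->
  (forall u v, B [tuple pi u; v] = B [tuple u; v]) ->
  (forall u v, J [tuple pi u; v] = J [tuple u; v - pi v]) -> jtrace B = 0.
Proof.
move=> aB lpi BP JP.
have BP' u v : B [tuple u; pi v] = B [tuple u; v] by rewrite alt2C// BP -alt2C.
pose Q : 'M[R]_(\dim {:Hfib H x}) := \matrix_(i, j) coord (vbasis {:Hfib H x}) j (pi (b i)).
have piE i : pi (b i) = \sum_j Q i j *: b j.
  by rewrite (b_expand (pi (b i))); apply: eq_bigr => j _; rewrite mxE.
have QB : Q *m gram B = gram B.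
  apply/matrixP => i j; rewrite !mxE -[RHS]BP piE (lin_comb (alt2_linl _ aB)).
  by apply: eq_bigr => l _; rewrite [gram B _ _]mxE.
have BQ : gram B *m Q^T = gram B.
  apply/matrixP => i j; rewrite !mxE -[RHS]BP' piE (lin_comb (alt2_linr _ aB)).
  by apply: eq_bigr => l _; rewrite [gram B _ _]mxE [Q^T _ _]mxE mulrC.
have QJ : Q *m gram J = gram J - gram J *m Q^T.
  apply/matrixP => i j; rewrite !mxE.
  have := JP (b i) (b j); rewrite (linD (alt2_linr _ J_altform)) -scaleN1r (linZ (alt2_linr _ J_altform)).
  rewrite !piE (lin_comb (alt2_linl _ J_altform)) (lin_comb (alt2_linr _ J_altform)) scaleN1r => e.
  apply: etrans (etrans _ e) _; first by apply: eq_bigr => l _; rewrite [gram J _ _]mxE.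
  congr (_ - _); apply: eq_bigr => l _.
  by rewrite [gram J _ _]mxE [Q^T _ _]mxE mulrC.
have uJ := gram_unit.
have JQ : invmx (gram J) *m Q = invmx (gram J) - Q^T *m invmx (gram J).
  apply: (can_inj (mulmxK uJ)); rewrite -mulmxA QJ mulmxBl mulmxBr !mulmxA.
  by rewrite mulVmx// mul1mx -mulmxA mulVmx// mulmx1.
have e : jtrace B = jtrace B - jtrace B.
  rewrite /jtrace -{1}QB mulmxA JQ mulmxBl mxtraceD; congr (_ + _).
  by rewrite raddfN /= -mulmxA mxtrace_mulC -mulmxA BQ.
by rewrite e subrr.
Qed.

End Nondegenerate.
End TwoForms.

Section Perp.
Variables (R : realType) (M : smooth_manifold R 5) (H E F : vdistribution M).
Hypothesis contactH : contact_distribution H.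
Hypothesis splitH : legendrean_splitting H E F.
Variable sg : forall x : M, 'Hom(subvs_of (Lfib H x), R^o).
Hypothesis smooth_sg : Ldual_section sg.
Hypothesis sg_neq0 : forall x : M, sg x != 0.
Variable x : M.
Implicit Types (B C N D : Hform H 2 x) (u v : Hfib H x).

Let J : Hform H 2 x := @Jform R M H sg x.

Let Jtup u v : J [tuple u; v] = levi2 sg (vsval u : tangent x) (vsval v : tangent x).
Proof. by []. Qed.

Lemma Jform_alt : altform J.
Proof.
apply: altform2 => [v a p q|v a p q|u].
- by rewrite !Jtup linearP (levi2_linearl contactH splitH smooth_sg sg_neq0).
- by rewrite !Jtup linearP (levi2_linearr contactH splitH smooth_sg sg_neq0).
- have := levi2C sg (vsval u : tangent x) (vsval u : tangent x); rewrite Jtup.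
  set a := levi2 _ _ _; move=> e; lra.
Qed.

Lemma Jform_nondeg u : (forall v, J [tuple u; v] = 0) -> u = 0.
Proof. exact: (levi2_nondeg contactH splitH smooth_sg sg_neq0). Qed.

Let lineP B : levi_line x B <-> exists c, B = (c : R) *: J.
Proof. exact: (levi_lineP contactH splitH smooth_sg sg_neq0). Qed.

Lemma dim_Hfib_gt0 : (0 < \dim {:Hfib H x})%N.
Proof.
have [U [X [Z [w [tau [Ux fr]]]]]] := theta_frame contactH splitH x.
rewrite lt0n dimv_eq0; apply/negP => /eqP e.
have : wH H w 0%N x (XH H X 0%N x) = 1 by rewrite (wH_XH fr Ux).
have -> : XH H X 0%N x = 0 by apply/eqP; rewrite -memv0 -e memvf.
by rewrite linear0 => /eqP; rewrite eq_sym oner_eq0.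
Qed.

Lemma jtraceJ_neq0 : jtrace J J != 0.
Proof.
rewrite jtraceJ; [|exact: Jform_alt|exact: Jform_nondeg].
by rewrite pnatr_eq0 -lt0n dim_Hfib_gt0.
Qed.

Lemma tracefreeP B : tracefree B <-> jtrace J B = 0.
Proof.
split=> [h|h J' /lineP[c ->]]; first by apply: h; apply/lineP; exists 1; rewrite scale1r.
rewrite gramZ; have [->|c0] := eqVneq c 0.
  rewrite scale0r /invmx; case: ifP => [|_]; last by rewrite mul0mx mxtrace0.
  rewrite -row_free_unit /row_free mxrank0 eq_sym.
  by have := dim_Hfib_gt0; rewrite lt0n => /negbTE ->.
have uc : c \is a GRing.unit by rewrite unitfE.
rewrite invmxZ ?unitmxZ//; last by apply: gram_unit; [exact: Jform_alt|exact: Jform_nondeg].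
by rewrite -scalemxAl mxtraceZ -[\tr _]/(jtrace J B) h mulr0.
Qed.

(** The multiple of the Levi form to be removed is found by comparing traces,
    since that of the Levi form itself does not vanish. *)
Lemma perpE B : altform B -> perp B = B - (jtrace J B / jtrace J J) *: J.
Proof.
move=> aB; set c := _ / _; rewrite /perp; set P := (X in xget 0 X).
have P0 : P (B - c *: J).
  split.
  - by apply: altformB => //; apply: altformZ; exact: Jform_alt.
  - by apply/tracefreeP; rewrite jtraceB jtraceZ /c mulfVK ?jtraceJ_neq0// subrr.
  - by apply/lineP; exists c; rewrite opprB addrCA subrr addr0.
have : P (xget 0 P) by apply: (@xgetPex _ 0 P); eexists; exact: P0.
move: (xget 0 P) => C [_ /tracefreeP tC /lineP[d e]].
have -> : C = B - d *: J by rewrite -e opprB addrCA subrr addr0.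
congr (_ - _ *: _); apply: (mulIf jtraceJ_neq0).
by rewrite /c mulfVK ?jtraceJ_neq0// -jtraceZ -e jtraceB tC subr0.
Qed.

Lemma perp_diff N D : altform N -> altform D -> exists p, perp N - perp D = N - D - p *: J.
Proof.
move=> aN aD; exists (jtrace J N / jtrace J J - jtrace J D / jtrace J J).
rewrite !perpE// scalerBl; set a := _ *: _; set b := _ *: _.
by rewrite !opprB !addrA [LHS]addrAC [RHS]addrAC (addrAC N (- a)).
Qed.

(** [perp N - perp D] is trace-free as well and differs from [N - D] by a
    multiple of the Levi form, so the multiples agree. *)
Lemma perp_diff_tracefree N D p : altform N -> altform D ->
  jtrace J (N - D - p *: J) = 0 -> perp N - perp D = N - D - p *: J.
Proof.
move=> aN aD; have [q e] := perp_diff aN aD; rewrite e !jtraceB jtraceZ => t0.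
have : jtrace J (perp N - perp D) = 0.
  have tp B : altform B -> jtrace J (perp B) = 0.
    by move=> aB; rewrite perpE// jtraceB jtraceZ mulfVK ?jtraceJ_neq0// subrr.
  by rewrite jtraceB !tp// subrr.
rewrite e !jtraceB jtraceZ => t1; congr (_ - _ *: _).
by apply: (mulIf jtraceJ_neq0); apply/eqP; rewrite -subr_eq0; apply/eqP; lra.
Qed.

Variables (U : set M) (X : nat -> forall y : M, tangent y) (Z : forall y : M, tangent y).
Variables (w : nat -> forall y : M, cotangent y) (tau : forall y : M, cotangent y).
Hypothesis fr : is_frame H E F U X Z w tau.
Hypothesis Ux : U x.

Let proj (k : nat) u : Hfib H x := (wH H w k x u : R) *: XH H X k x + (wH H w k.+1 x u : R) *: XH H X k.+1 x.

Let proj_linear k : linear (proj k).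
Proof.
by move=> a u v; rewrite /proj !wH_lin !scalerDl scalerDr !scalerA addrACA.
Qed.

Let proj_sum u : u = proj 0 u + proj 2 u.
Proof.
rewrite {1}(H_expand fr u Ux) !big_ord_recl big_ord0 /= /bump /=.
by rewrite /proj addr0 !addrA.
Qed.

Lemma frame_XE k : (k < 2)%N -> X k x \in E x.
Proof.
move=> k2; apply/(frame_E fr Ux); have k4 := ltn_trans k2 (isT : (2 < 4)%N).
split; [exact: (frame_tX fr Ux)| |]; rewrite (frame_wX fr Ux)//.
  by rewrite (ltn_eqF k2).
by rewrite (ltn_eqF (ltn_trans k2 _)).
Qed.

Lemma frame_XF k : (k < 2)%N -> X k.+2 x \in F x.
Proof.
move=> k2; apply/(frame_F fr Ux); have k4 : (k.+2 < 4)%N by [].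
by split; [exact: (frame_tX fr Ux)| |]; rewrite (frame_wX fr Ux).
Qed.

Let proj0E u : vsval (proj 0 u) \in E x.
Proof. by rewrite linearD !linearZ /= !(vsval_XH fr)// rpredD// rpredZ// frame_XE. Qed.

Let proj2F u : vsval (proj 2 u) \in F x.
Proof. by rewrite linearD !linearZ /= !(vsval_XH fr)// rpredD// rpredZ// frame_XF. Qed.

Let JE u v : vsval u \in E x -> vsval v \in E x -> J [tuple u; v] = 0.
Proof. exact: (levi2_E contactH splitH smooth_sg sg_neq0). Qed.

Let JF u v : vsval u \in F x -> vsval v \in F x -> J [tuple u; v] = 0.
Proof. exact: (levi2_F contactH splitH smooth_sg sg_neq0). Qed.

Let split_l B u v : altform B ->
  B [tuple u; v] = (B [tuple proj 0 u; v] : R) + (B [tuple proj 2 u; v] : R) :> R.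
Proof. by move=> aB; rewrite -(linD (alt2_linl v aB)) -proj_sum. Qed.

Let split_r B u v : altform B ->
  B [tuple u; v] = (B [tuple u; proj 0 v] : R) + (B [tuple u; proj 2 v] : R) :> R.
Proof. by move=> aB; rewrite -(linD (alt2_linr u aB)) -proj_sum. Qed.

(** Such a form factors through the projection [proj 0] onto [E] along [F]. As
    [E] and [F] are null, the adjoint of that projection with respect to the Levi
    form is the projection onto [F]. *)
Lemma ann2F_jtrace B : altform B ->
  (forall u v, vsval v \in F x -> B [tuple u; v] = 0) -> jtrace J B = 0.
Proof.
move=> aB h.
apply: (@jtrace_projection _ _ _ _ _ J Jform_alt Jform_nondeg B (proj 0) aB (proj_linear 0)) => u v.
  by rewrite (split_l u v aB) [X in _ + X](alt2C _ _ aB) (h _ _ (proj2F u)) oppr0 addr0.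
have -> : v - proj 0 v = proj 2 v by rewrite {1}(proj_sum v) addrAC subrr add0r.
rewrite (split_r (proj 0 u) v Jform_alt) (JE (proj0E u) (proj0E v)) add0r.
by rewrite (split_l u (proj 2 v) Jform_alt) (JF (proj2F u) (proj2F v)) addr0.
Qed.

Lemma ann2E_jtrace B : altform B ->
  (forall u v, vsval v \in E x -> B [tuple u; v] = 0) -> jtrace J B = 0.
Proof.
move=> aB h.
apply: (@jtrace_projection _ _ _ _ _ J Jform_alt Jform_nondeg B (proj 2) aB (proj_linear 2)) => u v.
  by rewrite (split_l u v aB) [X in X + _](alt2C _ _ aB) (h _ _ (proj0E u)) oppr0 add0r.
have -> : v - proj 2 v = proj 0 v by rewrite {1}(proj_sum v) addrK.
rewrite (split_r (proj 2 u) v Jform_alt) (JF (proj2F u) (proj2F v)) addr0.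
by rewrite (split_l u (proj 0 v) Jform_alt) (JE (proj0E u) (proj0E v)) add0r.
Qed.

End Perp.

(** * The connection of an adapted frame *)

Section LinearCombinators.
Variables (K : nzRingType) (A B C : lmodType K).

Lemma lin_add (f g : A -> B) : linear f -> linear g -> linear (fun v => f v + g v).
Proof. by move=> lf lg a u v; rewrite lf lg scalerDr addrACA. Qed.

Lemma lin_compose (f : B -> C) (g : A -> B) : linear f -> linear g -> linear (fun v => f (g v)).
Proof. by move=> lf lg a u v; rewrite lg lf. Qed.

End LinearCombinators.

Section LeviCivita.
Variables (R : realType) (M : smooth_manifold R 5) (H E F : vdistribution M).
Hypothesis contactH : contact_distribution H.
Hypothesis splitH : legendrean_splitting H E F.
Variable sg : forall x : M, 'Hom(subvs_of (Lfib H x), R^o).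
Hypothesis smooth_sg : Ldual_section sg.
Hypothesis sg_neq0 : forall x : M, sg x != 0.

Variables (U : set M) (X : nat -> forall y : M, tangent y) (Z : forall y : M, tangent y).
Variables (w : nat -> forall y : M, cotangent y) (tau : forall y : M, cotangent y).
Hypothesis afr : is_aframe E F sg U X Z w tau.
Let fr : is_frame H E F U X Z w tau := aframe_frame afr.
Let oU : open U. Proof. exact: frame_open fr. Qed.

(** The values of the exterior derivatives of the coframe, from which [Gc] takes
    its coefficients. *)
Definition Kc (i j k : nat) (y : M) : R^o := ext_deriv (w i) (X j y) (X k y).
Definition Gc (j i k : nat) (y : M) : R^o := christoffel (fun i j k => Kc i j k y) j i k.

Local Notation xh := (XH H X).
Local Notation wh := (wH H w).
Local Notation ext := (cst_ext X w).
Local Notation gm := (conn_matrix X w Gc).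
Local Notation DD := (form_conn X w Gc).
Local Notation nh := (nabla_field X w Gc).
Local Notation cn := (conn X w Gc).

Lemma KcC i j k y : Kc i j k y = - (Kc i k j y : R) :> R.
Proof. exact: ext_derivC. Qed.

Lemma Gc_system y : levi_civita_system (fun i j k => Kc i j k y) (fun j i k => Gc j i k y).
Proof. by apply: christoffel_system => i j k; exact: KcC. Qed.

Lemma Kc_smooth i j k : (i < 4)%N -> (j < 4)%N -> (k < 4)%N -> smooth_fun U (Kc i j k).
Proof.
move=> i4 j4 k4; exact: (ext_deriv_smooth oU (frame_smoothw fr i4)
  (frame_smoothX fr j4) (frame_smoothX fr k4)).
Qed.

Lemma dual_lt4 c : (c < 4)%N -> (dual_index c < 4)%N.
Proof. by case: c => [|[|[|[|]]]]. Qed.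

Lemma partner_lt4 c : (partner c < 4)%N.
Proof. by case: c => [|[|[|[|]]]] //= c; rewrite /partner /= nth_nil. Qed.

Lemma dual_indexK c : (c < 4)%N -> dual_index (dual_index c) = c.
Proof. by case: c => [|[|[|[|]]]]. Qed.

Lemma mixed_smooth j i k : (j < 4)%N -> (i < 4)%N -> (k < 4)%N ->
  smooth_fun U (fun y => mixed (fun i j k => Kc i j k y) j i k : R^o).
Proof.
move=> j4 i4 k4; have p4 := partner_lt4 i; have d4 := dual_lt4 i4; have dp4 := dual_lt4 p4.
apply: (smooth_funD oU (Kc_smooth i4 j4 k4)).
apply: (smooth_funM oU _ (smooth_fun_cst U _)).
apply: (smooth_funB oU _ (Kc_smooth dp4 dp4 d4)).
exact: (smooth_funB oU (Kc_smooth p4 d4 p4) (Kc_smooth i4 dp4 p4)).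
Qed.

Lemma Gc_smooth j i k : (j < 4)%N -> (i < 4)%N -> (k < 4)%N -> smooth_fun U (Gc j i k).
Proof.
move=> j4 i4 k4; rewrite /Gc /christoffel.
case: (same i k) => /=; last exact: smooth_fun_cst.
case: (same j i); last exact: mixed_smooth.
apply: (smooth_funN oU); apply: mixed_smooth => //; exact: dual_lt4.
Qed.

Local Notation "'JJ' x" := (@Jform R M H sg x) (at level 10, x at level 9).

Lemma J_XH x j k : U x -> (j < 4)%N -> (k < 4)%N -> JJ x [tuple xh j x; xh k x] = symp R j k.
Proof. by move=> Ux j4 k4; rewrite JformE !(vsval_XH fr)// (aframe_J afr). Qed.

Let J_altform x : altform (JJ x). Proof. exact: (Jform_alt contactH splitH smooth_sg sg_neq0). Qed.

Lemma J_expand x (u v : Hfib H x) : U x ->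
  JJ x [tuple u; v] = \sum_(j < 4) \sum_(k < 4) (wh j x u : R) * (wh k x v : R) * symp R j k :> R.
Proof.
move=> Ux.
have -> : JJ x [tuple u; v] = \sum_(j < 4) (wh j x u : R) * (JJ x [tuple xh j x; v] : R) :> R.
  by rewrite [in LHS](H_expand fr u Ux); apply: (lin_comb (alt2_linl v (J_altform x))).
apply: eq_bigr => j _.
have -> : JJ x [tuple xh j x; v] = \sum_(k < 4) (wh k x v : R) * (JJ x [tuple xh j x; xh k x] : R) :> R.
  by rewrite [in LHS](H_expand fr v Ux); apply: (lin_comb (alt2_linr _ (J_altform x))).
rewrite mulr_sumr; apply: eq_bigr => k _.
by rewrite J_XH// mulrA.
Qed.

(** The sign in the identification of frame and coframe by the Levi form. *)
Definition dual_sign (i : nat) : R := if (i < 2)%N then -1 else 1.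

Lemma symp_sum_l (f : nat -> R) k : (k < 4)%N ->
  \sum_(l < 4) f l * symp R l k = dual_sign k * f (dual_index k).
Proof.
rewrite !big_ord_recl big_ord0 /= /bump /= /symp /dual_sign.
by case: k => [|[|[|[|//]]]] _ /=; ring.
Qed.

Lemma symp_sum_r (f : nat -> R) k : (k < 4)%N ->
  \sum_(l < 4) f l * symp R k l = - dual_sign k * f (dual_index k).
Proof.
rewrite !big_ord_recl big_ord0 /= /bump /= /symp /dual_sign.
by case: k => [|[|[|[|//]]]] _ /=; ring.
Qed.

(** If [i] and [k] have the same type, both terms vanish because the summands
    are preserved and null; otherwise this is a metric equation of the system. *)
Lemma J_conn_matrix_XH x j i k : U x -> (j < 4)%N -> (i < 4)%N -> (k < 4)%N ->
  (JJ x [tuple gm (xh j x) (xh i x); xh k x] : R) + (JJ x [tuple xh i x; gm (xh j x) (xh k x)] : R) = 0.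
Proof.
move=> Ux j4 i4 k4.
have e1 : JJ x [tuple gm (xh j x) (xh i x); xh k x] = \sum_(l < 4) (- (Gc j l i x : R)) * symp R l k :> R.
  rewrite (conn_matrix_XH Gc fr Ux j4 i4); apply: (etrans (lin_comb (alt2_linl _ (J_altform x)) _ _ _ _)).
  by apply: eq_bigr => l _; rewrite (J_XH Ux (ltn_ord l) k4).
have e2 : JJ x [tuple xh i x; gm (xh j x) (xh k x)] = \sum_(l < 4) (- (Gc j l k x : R)) * symp R i l :> R.
  rewrite (conn_matrix_XH Gc fr Ux j4 k4); apply: (etrans (lin_comb (alt2_linr _ (J_altform x)) _ _ _ _)).
  by apply: eq_bigr => l _; rewrite (J_XH Ux i4 (ltn_ord l)).
rewrite e1 e2.
rewrite (symp_sum_l (fun l => - (Gc j l i x : R)))// (symp_sum_r (fun l => - (Gc j l k x : R)))//.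
have [gE gJ _] := Gc_system x.
have [s|ns] := boolP (same i k).
  rewrite !gE ?dual_lt4// ?oppr0 ?mulr0 ?addr0//.
    by move: s; case: (i) i4 => [|[|[|[|//]]]] _; case: (k) k4 => [|[|[|[|//]]]].
  by move: s; case: (i) i4 => [|[|[|[|//]]]] _; case: (k) k4 => [|[|[|[|//]]]].
have sk : same (dual_index k) i.
  by move: ns; case: (i) i4 => [|[|[|[|//]]]] _; case: (k) k4 => [|[|[|[|//]]]].
have := gJ j (dual_index k) i j4 (dual_lt4 k4) i4 sk; rewrite dual_indexK//.
have -> : dual_sign k = - dual_sign i.
  by rewrite /dual_sign; move: ns; rewrite /same; case: (i < 2)%N; case: (k < 2)%N; rewrite ?opprK.
by move=> e; rewrite -mulrDr -opprD e oppr0 mulr0.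
Qed.

Lemma J_conn_matrix x (v a b : Hfib H x) : U x ->
  (JJ x [tuple gm v a; b] : R) + (JJ x [tuple a; gm v b] : R) = 0.
Proof.
move=> Ux.
pose Q (v a b : Hfib H x) : R^o := (JJ x [tuple gm v a; b] : R) + (JJ x [tuple a; gm v b] : R).
have gl a' := @conn_matrix_linearl R M H X w Gc x a'; have gr v' := @conn_matrix_linearr R M H X w Gc x v'.
have lv a' b' : linear (fun v => Q v a' b').
  exact: lin_add (lin_compose (alt2_linl b' (J_altform x)) (gl a')) (lin_compose (alt2_linr a' (J_altform x)) (gl b')).
have la v' b' : linear (fun a => Q v' a b').
  exact: lin_add (lin_compose (alt2_linl b' (J_altform x)) (gr v')) (alt2_linl (gm v' b') (J_altform x)).
have lb v' a' : linear (fun b => Q v' a' b).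
  exact: lin_add (alt2_linr (gm v' a') (J_altform x)) (lin_compose (alt2_linr a' (J_altform x)) (gr v')).
suff : Q v a b = 0 by [].
rewrite (H_expand fr v Ux) (H_expand fr a Ux) (H_expand fr b Ux).
rewrite (lin_comb (lv _ _)) big1// => j _; rewrite (lin_comb (la _ _)) big1 ?scaler0// => i _.
rewrite (lin_comb (lb _ _)) big1 ?scaler0// => k _.
by rewrite /Q J_conn_matrix_XH// scaler0.
Qed.

Lemma J_ext x (a b : Hfib H x) y : U x -> U y -> JJ y [tuple ext a y; ext b y] = JJ x [tuple a; b].
Proof.
move=> Ux Uy; rewrite (J_expand a b Ux) /cst_ext; apply: (etrans (lin_comb (alt2_linl _ (J_altform y)) _ _ _ _)).
apply: eq_bigr => j _; rewrite (lin_comb (alt2_linr _ (J_altform y))).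
apply: (etrans (mulr_sumr _ _ _ _)); apply: eq_bigr => k _.
by rewrite (J_XH Uy (ltn_ord j) (ltn_ord k)) mulrA.
Qed.

Lemma Jform_section V : open V -> Hform_section V (fun x => JJ x).
Proof.
move=> oV; split=> [x _|W Y oW WV sY]; first exact: J_altform.
have h := levi2_smooth contactH splitH smooth_sg sg_neq0 oW (sY ord0) (sY ord_max).
by apply: (smooth_fun_eq oW _ h) => x _; rewrite [in RHS](tuple2E [tuple Y j x | j < 2]) !tnth_mktuple.
Qed.

Lemma sum_ord2 (f : 'I_2 -> R) : \sum_i f i = f ord0 + f ord_max.
Proof. by rewrite big_ord_recr big_ord1; congr (f _ + _); apply: val_inj. Qed.

Lemma sum_ord4 (f : 'I_4 -> R) :
  \sum_i f i = f (inord 0) + f (inord 1) + f (inord 2) + f (inord 3).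
Proof.
rewrite !big_ord_recl big_ord0 addr0 !addrA.
by congr (f _ + f _ + f _ + f _); apply: val_inj; rewrite /= inordK.
Qed.

(** The Leibniz rule for [wedge_square J], where [g i j] is [b i j] with the
    first argument differentiated; by skewness of the connection matrix the
    second argument contributes with the opposite sign. *)
Lemma wedge_square_derivation (g b : nat -> nat -> R) :
  2 * (g 0%N 1%N * b 2%N 3%N - g 0%N 2%N * b 1%N 3%N + g 0%N 3%N * b 1%N 2%N)
  + 2 * (- g 0%N 1%N * b 2%N 3%N - b 0%N 2%N * g 1%N 3%N + b 0%N 3%N * g 1%N 2%N)
  + 2 * (b 0%N 1%N * g 2%N 3%N - - g 0%N 2%N * b 1%N 3%N + b 0%N 3%N * - g 1%N 2%N)
  + 2 * (b 0%N 1%N * - g 2%N 3%N - b 0%N 2%N * - g 1%N 3%N + - g 0%N 3%N * b 1%N 2%N) = 0.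
Proof. ring. Qed.

Lemma subr_zeros (a b : R) : a = 0 -> b = 0 -> a - b = 0.
Proof. by move=> -> ->; rewrite subr0. Qed.

Lemma Hform0E k x (u : k.-tuple (Hfib H x)) : (0 : Hform H k x) u = 0.
Proof. by []. Qed.

(** In an adapted frame the Levi form has constant coefficients, and the
    connection matrix is skew for it. *)
Lemma form_conn_J x (v : Hfib H x) : U x -> DD (fun x => JJ x) v = 0.
Proof.
move=> Ux; apply/funext => u; rewrite form_connE Hform0E.
refine (subr_zeros _ _).
  rewrite -(dirder_cst (vsval v : tangent x) (JJ x u : R^o)); apply: (dirder_eq oU Ux) => y Uy.
  rewrite (tuple2E [tuple ext (tnth u i) y | i < 2]) !tnth_mktuple (J_ext _ _ Ux Uy).
  by congr (Jform _ _); apply: esym; apply: tuple2E.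
apply: (etrans (sum_ord2 _)).
have e0 a : tset u ord0 a = [tuple a; tnth u ord_max] by rewrite [in LHS](tuple2E u) tuple2_tset0.
have e3 a : tset u ord_max a = [tuple tnth u ord0; a] by rewrite [in LHS](tuple2E u) tuple2_tset1.
rewrite e0 e3; exact: J_conn_matrix.
Qed.

Lemma form_conn_J2 x (v : Hfib H x) : U x -> DD (fun y => wedge_square (JJ y)) v = 0.
Proof.
move=> Ux; apply/funext => u; rewrite form_connE Hform0E.
refine (subr_zeros _ _).
  rewrite -(dirder_cst (vsval v : tangent x) (wedge_square (JJ x) u : R^o)).
  by apply: (dirder_eq oU Ux) => y Uy; rewrite /wedge_square !tnth_mktuple !J_ext.
apply: (etrans (sum_ord4 _)).
pose a (i : nat) := tnth u (inord i : 'I_4).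
pose g i j : R := JJ x [tuple gm v (a i); a j]; pose b i j : R := JJ x [tuple a i; a j].
have h i j : JJ x [tuple a i; gm v (a j)] = - g i j :> R.
  by apply/eqP; rewrite -addr_eq0 addrC; apply/eqP; apply: J_conn_matrix.
have tn z m i : (m < 4)%N -> (i < 4)%N ->
    tnth (tset u (inord m) z) (inord i) = if i == m then z else a i.
  by move=> m4 i4; rewrite tnth_tset -val_eqE /= !inordK.
have e m : (m < 4)%N -> wedge_square (JJ x) (tset u (inord m) (gm v (a m))) =
    let c i j := if i == m then g i j else if j == m then - g i j else b i j in
    2 * (c 0%N 1%N * c 2%N 3%N - c 0%N 2%N * c 1%N 3%N + c 0%N 3%N * c 1%N 2%N) :> R.
  move=> m4; rewrite /wedge_square !(tn _ m 0%N m4 isT) !(tn _ m 1%N m4 isT) !(tn _ m 2%N m4 isT) !(tn _ m 3%N m4 isT).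
  by case: m m4 => [|[|[|[|//]]]] _ /=; rewrite ?h.
rewrite (e 0%N isT) (e 1%N isT) (e 2%N isT) (e 3%N isT) /=.
exact: wedge_square_derivation.
Qed.

End LeviCivita.

Section LinearOpp.
Variables (K : nzRingType) (A B : lmodType K).

Lemma lin_opp (f : A -> B) : linear f -> linear (fun v => - f v).
Proof. by move=> lf a u v; rewrite lf opprD scalerN. Qed.

End LinearOpp.

Lemma skew_algebra (R : nzRingType) (a b c c' : R) : c = - c' -> - a + b - c = - (- b + a - c').
Proof. by move=> ->; rewrite !opprD !opprK addrC [b - a]addrC addrC. Qed.

Section LeviCivita.
Variables (R : realType) (M : smooth_manifold R 5) (H E F : vdistribution M).
Hypothesis contactH : contact_distribution H.
Hypothesis splitH : legendrean_splitting H E F.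
Variable sg : forall x : M, 'Hom(subvs_of (Lfib H x), R^o).
Hypothesis smooth_sg : Ldual_section sg.
Hypothesis sg_neq0 : forall x : M, sg x != 0.

Section InFrame.
Variables (U : set M) (X : nat -> forall y : M, tangent y) (Z : forall y : M, tangent y).
Variables (w : nat -> forall y : M, cotangent y) (tau : forall y : M, cotangent y).
Hypothesis afr : is_aframe E F sg U X Z w tau.
Let fr : is_frame H E F U X Z w tau := aframe_frame afr.
Let oU : open U. Proof. exact: frame_open fr. Qed.

Local Notation xh := (XH H X).
Local Notation wh := (wH H w).
Local Notation ext := (cst_ext X w).
Local Notation Gx := (Gc X w).
Local Notation gm := (conn_matrix X w Gx).
Local Notation DD := (form_conn X w Gx).
Local Notation nh := (nabla_field X w Gx).
Local Notation cn := (conn X w Gx).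
Local Notation "'JJ' x" := (@Jform R M H sg x) (at level 10, x at level 9).

Let J_altform x : altform (JJ x). Proof. exact: (Jform_alt contactH splitH smooth_sg sg_neq0). Qed.

(** For [b = false] this describes [E], for [b = true] it describes [F]; in this
    form both summands can be treated together. *)
Definition block_vanish (b : bool) x (u : Hfib H x) :=
  forall k, (k < 4)%N -> (k < 2)%N = b -> wh k x u = 0.

Lemma memE_block x (u : Hfib H x) : U x -> vsval u \in E x <-> block_vanish false u.
Proof.
move=> Ux; split=> [/(frame_E fr Ux)[_ w2 w3]|h].
  by case=> [|[|[|[|//]]]] _ //= _; rewrite wHE.
apply/(frame_E fr Ux); split.
- by apply/eqP; rewrite -(frame_H fr Ux) subvsP.
- by rewrite -(wHE (H := H) w 2%N u); apply: h.
- by rewrite -(wHE (H := H) w 3%N u); apply: h.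
Qed.

Lemma memF_block x (u : Hfib H x) : U x -> vsval u \in F x <-> block_vanish true u.
Proof.
move=> Ux; split=> [/(frame_F fr Ux)[_ w0 w1]|h].
  by case=> [|[|[|[|//]]]] _ //= _; rewrite wHE.
apply/(frame_F fr Ux); split.
- by apply/eqP; rewrite -(frame_H fr Ux) subvsP.
- by rewrite -(wHE (H := H) w 0%N u); apply: h.
- by rewrite -(wHE (H := H) w 1%N u); apply: h.
Qed.

Lemma wh_comb x (f : nat -> R) i : U x -> (i < 4)%N ->
  wh i x (\sum_(l < 4) f l *: xh l x) = f i.
Proof.
move=> Ux i4; rewrite linear_sum (bigD1 (Ordinal i4)) //= big1 => [|l nl].
  by rewrite addr0 linearZ /= (wH_XH fr Ux)// eqxx /GRing.scale /= mulr1.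
rewrite linearZ /= (wH_XH fr Ux)// (_ : (l == i :> nat) = false) ?scaler0//.
by apply/negbTE.
Qed.

Lemma wh_ext x (u : Hfib H x) y i : U y -> (i < 4)%N -> wh i y (ext u y) = wh i x u.
Proof. by move=> Uy i4; rewrite (wh_comb (fun k => wh k x u)). Qed.

Lemma wh_conn_matrix x (v u : Hfib H x) i : U x -> (i < 4)%N -> wh i x (gm v u) =
  - \sum_(j < 4) \sum_(k < 4) (wh j x v : R) * (wh k x u : R) * (Gx j i k x : R) :> R.
Proof.
by move=> Ux i4; rewrite (wh_comb (fun l => - \sum_(j < 4) \sum_(k < 4) (wh j x v : R) * (wh k x u : R) * (Gx j l k x : R))).
Qed.

Lemma conn_matrix_block b x (v u : Hfib H x) : U x -> block_vanish b u -> block_vanish b (gm v u).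
Proof.
move=> Ux h i i4 ib; rewrite wh_conn_matrix// big1 ?oppr0// => j _; rewrite big1// => k _.
have [gE _ _] := Gc_system X w x.
have [/eqP kb|kb] := boolP ((k < 2)%N == b).
  by rewrite (h k (ltn_ord k) kb) mulr0 mul0r.
by rewrite [Gx _ _ _ _]gE ?mulr0// /same ib eq_sym.
Qed.

Lemma torsion_algebra (a du dv wu wv g h e : R) :
  (wv * du - a * g) - (wu * dv - a * h) - (du * wv - dv * wu + a * e) = a * (- g + h - e).
Proof. ring. Qed.

Lemma christoffel_algebra (a b c g h k : R) : a = - g -> b = - h -> c = k -> - a + b - c = g - h - k.
Proof. by move=> -> -> ->; rewrite opprK. Qed.

Lemma metric_algebra (a b p q d : R) : a = d - q -> b = - d - - p -> d = p + q -> a - b = d.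
Proof. by move=> -> -> ->; ring. Qed.

Section Local.
Variable V : set M.
Hypotheses (oV : open V) (VU : V `<=` U).

Lemma conn_block b a x (v u : Hfib H x) : Hdual_section V a -> V x ->
  (forall y, V y -> forall u : Hfib H y, block_vanish b u -> a y u = 0) ->
  block_vanish b u -> cn a v u = 0.
Proof.
move=> sa Vx h bu; apply: (etrans (connE _ fr oV VU v u sa Vx)); apply: subr_zeros.
  rewrite -(dirder_cst (vsval v : tangent x) (0 : R^o)); apply: (dirder_eq oV Vx) => y Vy.
  by apply: h => // k k4 kb; rewrite wh_ext//; [exact: bu|exact: VU].
by apply: h => //; apply: conn_matrix_block => //; exact: VU.
Qed.

Lemma nabla_field_metric Y Y' x (v : Hfib H x) : Hsection V Y -> Hsection V Y' -> V x ->
  dirder (vsval v : tangent x) (fun y => JJ y [tuple Y y; Y' y] : R^o)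
  = (JJ x [tuple nh Y v; Y' x] : R) + (JJ x [tuple Y x; nh Y' v] : R) :> R.
Proof.
move=> sY sY' Vx; pose YY (i : 'I_2) := if i == ord0 then Y else Y'.
have sYY i : Hsection V (YY i) by rewrite /YY; case: (i == ord0).
have sJ := Jform_section contactH splitH smooth_sg sg_neq0 oV.
have e := form_conn_key Gx fr oV VU v sJ sYY Vx.
have T y : [tuple YY j y | j < 2] = [tuple Y y; Y' y].
  by rewrite [LHS]tuple2E !tnth_mktuple.
have e0 := form_conn_J contactH splitH smooth_sg sg_neq0 afr v (VU Vx).
have e1 : dirder (vsval v : tangent x) (fun y => JJ y [tuple YY j y | j < 2] : R^o)
   = dirder (vsval v : tangent x) (fun y => JJ y [tuple Y y; Y' y] : R^o).
  by apply: (dirder_eq oV Vx) => y _; rewrite T.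
have z := congr1 (fun f : Hform H 2 x => f [tuple YY j x | j < 2] : R) e0.
apply: (etrans (esym e1)); apply: (etrans (subr0_eq (etrans (esym e) z))).
by apply: (etrans (sum_ord2 _)); rewrite T tuple2_tset0 tuple2_tset1.
Qed.

(** Since [a] is [Y] and [b] is [Y'] lowered by the Levi form, the Leibniz rule
    for J (Y, Y') takes this form; it makes sense for an operator on [Hdual]
    alone. *)
Lemma conn_metric a b Y Y' x (v : Hfib H x) :
  Hdual_section V a -> Hdual_section V b -> Hsection V Y -> Hsection V Y' -> V x ->
  (forall y, V y -> forall u : Hfib H y, a y u = JJ y [tuple Y y; u]) ->
  (forall y, V y -> forall u : Hfib H y, b y u = JJ y [tuple Y' y; u]) ->
  (cn a v (Y' x) : R) - (cn b v (Y x) : R)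
  = dirder (vsval v : tangent x) (fun y => JJ y [tuple Y y; Y' y] : R^o) :> R.
Proof.
move=> sa sb sY sY' Vx ea eb.
have c1 := conn_nabla_field Gx fr oV VU v sa sY' Vx; have c2 := conn_nabla_field Gx fr oV VU v sb sY Vx.
have d1 : dirder (vsval v : tangent x) (fun y => a y (Y' y) : R^o)
   = dirder (vsval v : tangent x) (fun y => JJ y [tuple Y y; Y' y] : R^o).
  by apply: (dirder_eq oV Vx) => y Vy; rewrite ea.
have d2 : dirder (vsval v : tangent x) (fun y => b y (Y y) : R^o)
   = - (dirder (vsval v : tangent x) (fun y => JJ y [tuple Y y; Y' y] : R^o) : R) :> R.
  have sJY : smooth_fun V (fun y => JJ y [tuple Y y; Y' y] : R^o).
    exact: (levi2_smooth contactH splitH smooth_sg sg_neq0 oV sY sY').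
  rewrite -(dirderN (vsval v : tangent x) oV Vx sJY); apply: (dirder_eq oV Vx) => y Vy.
  by rewrite eb// alt2C.
have m := nabla_field_metric v sY sY' Vx.
have e1 := etrans c1 (congr2 (fun p q : R => p - q) d1 (ea x Vx (nh Y' v))).
have e2 := etrans c2 (congr2 (fun p q : R => p - q) d2
  (etrans (eb x Vx (nh Y v)) (alt2C _ _ (J_altform x)))).
exact: (metric_algebra e1 e2 m).
Qed.

(** The torsion of [D] on the section [a], where [at_] is a 1-form on the
    manifold that restricts to [a]. Another such form changes the value by a
    multiple of the Levi form. *)
Definition tors (D : (forall x, Hdual H x) -> forall x, Hfib H x -> Hdual H x)
  (a : forall x, Hdual H x) (at_ : forall x : M, cotangent x) x (u v : Hfib H x) : R :=
  (D a x u v : R) - (D a x v u : R)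
  - ext_deriv at_ (vsval u : tangent x) (vsval v : tangent x).

Let frame_tors i x (u v : Hfib H x) : R :=
  - (wh i x (gm u v) : R) + (wh i x (gm v u) : R)
  - ext_deriv (w i) (vsval u : tangent x) (vsval v : tangent x).

Let frame_tors_linl i x v : (i < 4)%N -> U x -> linear (fun u : Hfib H x => frame_tors i u v : R^o).
Proof.
move=> i4 Ux.
have lw : linear (fun z : Hfib H x => wh i x z : R^o) by move=> c p q; exact: linearP.
have lv : linear (fun z : Hfib H x => vsval z : tangent x) by move=> c p q; exact: linearP.
have l1 := lin_opp (lin_compose lw (fun c p q => @conn_matrix_linearl R M H X w Gx x v c p q)).
have l2 := lin_compose lw (fun c p q => @conn_matrix_linearr R M H X w Gx x v c p q).
have l3 := lin_opp (lin_compose (ext_deriv_linearl oU (frame_smoothw fr i4) Ux (vsval v : tangent x)) lv).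
exact: (lin_add (lin_add l1 l2) l3).
Qed.

Let frame_torsC i x (u v : Hfib H x) : frame_tors i u v = - frame_tors i v u.
Proof. exact: (skew_algebra _ _ (ext_derivC (w i) _ _)). Qed.

Let frame_tors_linr i x u : (i < 4)%N -> U x -> linear (fun v : Hfib H x => frame_tors i u v : R^o).
Proof.
move=> i4 Ux; have -> : (fun v : Hfib H x => frame_tors i u v : R^o) = (fun v => - frame_tors i v u).
  by apply/funext => v; exact: frame_torsC.
exact: lin_opp (frame_tors_linl u i4 Ux).
Qed.

Let frame_tors_XH i j k x : U x -> (i < 4)%N -> (j < 4)%N -> (k < 4)%N ->
  frame_tors i (xh j x) (xh k x) = (Gx j i k x : R) - (Gx k i j x : R) - (Kc X w i j k x : R).
Proof.
move=> Ux i4 j4 k4.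
have e1 : wh i x (gm (xh j x) (xh k x)) = - (Gx j i k x : R) :> R.
  by rewrite (conn_matrix_XH Gx fr Ux j4 k4) (wh_comb (fun l => - (Gx j l k x : R)) Ux i4).
have e2 : wh i x (gm (xh k x) (xh j x)) = - (Gx k i j x : R) :> R.
  by rewrite (conn_matrix_XH Gx fr Ux k4 j4) (wh_comb (fun l => - (Gx k l j x : R)) Ux i4).
have e3 : ext_deriv (w i) (vsval (xh j x) : tangent x) (vsval (xh k x) : tangent x) = Kc X w i j k x.
  by rewrite (vsval_XH fr Ux j4) (vsval_XH fr Ux k4).
exact: (christoffel_algebra e1 e2 e3).
Qed.

(** By bilinearity it is enough to evaluate on frame fields, where this is the
    torsion equation of the system. *)
Lemma frame_torsion i x : U x -> (i < 4)%N -> exists p, forall u v : Hfib H x,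
  block_vanish (~~ (i < 2)%N) v -> frame_tors i u v = p * (JJ x [tuple u; v] : R).
Proof.
move=> Ux i4; have [_ _ gT] := Gc_system X w x; have [p hp] := gT i i4.
exists p => u v bv.
have -> : frame_tors i u v = \sum_(j < 4) \sum_(k < 4) (wh j x u : R) * (wh k x v : R) * frame_tors i (xh j x) (xh k x).
  rewrite [in LHS](H_expand fr u Ux); apply: (etrans (lin_comb (frame_tors_linl v i4 Ux) _ _ _ _)).
  apply: eq_bigr => j _; rewrite [in LHS](H_expand fr v Ux).
  rewrite (lin_comb (frame_tors_linr (xh j x) i4 Ux)); apply: (etrans (mulr_sumr _ _ _ _)).
  by apply: eq_bigr => k _; apply: mulrA.
rewrite (J_expand contactH splitH smooth_sg sg_neq0 afr u v Ux) mulr_sumr.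
apply: eq_bigr => j _; rewrite mulr_sumr; apply: eq_bigr => k _.
have [s|ns] := boolP (same k i).
  rewrite (frame_tors_XH Ux i4 (ltn_ord j) (ltn_ord k)).
  by rewrite (hp j k (ltn_ord j) (ltn_ord k) s) mulrCA.
have kb : (k < 2)%N = ~~ (i < 2)%N by move: ns; rewrite /same; case: (k < 2)%N; case: (i < 2)%N.
by rewrite (bv k (ltn_ord k) kb) mulr0 !mul0r mulr0.
Qed.

(** The lift is a combination of the forms [w i] and [tau]. The term with [tau]
    contributes a multiple of the Levi form, because [tau] annihilates [H]. *)
Lemma lift_ext_deriv a at_ x : Hdual_section V a -> lifts V a at_ -> V x ->
  exists c, forall u v : Hfib H x,
  ext_deriv at_ (vsval u : tangent x) (vsval v : tangent x) =
  \sum_(i < 4) ((dirder (vsval u : tangent x) (fun y => a y (xh i y) : R^o) : R) * (wh i x v : R)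
     - (dirder (vsval v : tangent x) (fun y => a y (xh i y) : R^o) : R) * (wh i x u : R)
     + (a x (xh i x) : R) * ext_deriv (w i) (vsval u : tangent x) (vsval v : tangent x))
  + c * (JJ x [tuple u; v] : R) :> R.
Proof.
move=> sa [sat lat] Vx.
have sw i : (i < 4)%N -> smooth_form V (w i) by move=> i4; apply: smooth_form_sub VU (frame_smoothw fr i4).
have st : smooth_form V tau by apply: smooth_form_sub VU (frame_smootht fr).
have sf i : (i < 4)%N -> smooth_fun V (fun y => a y (xh i y) : R^o).
  by move=> i4; apply: (sa V _ oV (@subset_refl _ V)); apply: (XH_section fr oV VU i4).
have sh : smooth_fun V (fun y => at_ y (Z y)).
  by apply: (pairing_smooth oV sat); apply: smooth_field_sub VU (frame_smoothZ fr).
have [c ec] : exists c, levi H tau x = (c : R) *: JJ x.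
  apply/(levi_lineP contactH splitH smooth_sg sg_neq0); exists V, tau; split=> //.
  split=> // y Vy; exact: (tau_L fr (VU Vy)).
exists ((at_ x (Z x) : R) * c) => u v.
pose f (l : 'I_5) y : R^o := if (l < 4)%N then a y (xh l y) else at_ y (Z y).
pose al (l : 'I_5) (y : M) : cotangent y := if (l < 4)%N then w l y else tau y.
have sfl l : smooth_fun V (f l) by rewrite /f; case l4: (l < 4)%N; [exact: sf|exact: sh].
have sall l : smooth_form V (al l) by rewrite /al; case l4: (l < 4)%N; [exact: sw|exact: st].
have e1 : ext_deriv at_ (vsval u : tangent x) (vsval v : tangent x)
   = ext_deriv (fun y => \sum_l (f l y : R) *: al l y) (vsval u : tangent x) (vsval v : tangent x).
  apply: (ext_deriv_eq _ _ oV Vx) => y Vy; have Uy := VU Vy.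
  apply/lfunP => z; rewrite [in LHS](frame_expand fr Uy z).
  rewrite linearD linear_sum linearZ sum_lfunE [RHS]big_ord_recr; congr (_ + _).
    apply: eq_bigr => k _; rewrite scale_lfunE linearZ /f /al /= ltn_ord -lat//.
    by rewrite restrictHE (vsval_XH fr Uy)// /GRing.scale /= mulrC.
  by rewrite scale_lfunE /f /al /= /GRing.scale /= mulrC.
have t0 (z : Hfib H x) : tau x (vsval z) = 0.
  by apply/eqP; rewrite -(frame_H fr (VU Vx)) subvsP.
rewrite e1; apply: (etrans (ext_deriv_comb _ _ oV Vx sfl sall)).
rewrite big_ord_recr /=; congr (_ + _).
  by apply: eq_bigr => k _; rewrite /f /al /= ltn_ord !(wHE (H := H)).
rewrite /f /al /= !t0 !mulr0 subrr add0r.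
have ec' : ext_deriv tau (vsval u : tangent x) (vsval v : tangent x) = c * (JJ x [tuple u; v] : R).
  exact: (congr1 (fun g : Hform H 2 x => g [tuple u; v] : R) ec).
by rewrite ec' mulrA.
Qed.

(** The derivatives of the coefficients of [a] cancel against those in the
    exterior derivative, which leaves a combination of the torsions of the
    coframe forms of one type. *)
Lemma conn_torsion b a at_ x : Hdual_section V a -> lifts V a at_ -> V x ->
  (forall y, V y -> forall u : Hfib H y, block_vanish b u -> a y u = 0) ->
  exists p, forall u v : Hfib H x, block_vanish (~~ b) v -> tors cn a at_ u v = p * (JJ x [tuple u; v] : R).
Proof.
move=> sa la Vx ha; have Ux := VU Vx.
have [c hc] := lift_ext_deriv sa la Vx.
have hp i : exists p, (i < 4)%N -> forall u v : Hfib H x,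
    block_vanish (~~ (i < 2)%N) v -> frame_tors i u v = p * (JJ x [tuple u; v] : R).
  case: (ltnP i 4) => [i4|_]; last by exists 0.
  by have [p h] := frame_torsion Ux i4; exists p.
pose p i := sval (cid (hp i)); have hp' i : (i < 4)%N -> _ := svalP (cid (hp i)).
exists (\sum_(i < 4) (a x (xh i x) : R) * p i - c) => u v bv.
have sf i : (i < 4)%N -> smooth_fun V (fun y => a y (xh i y) : R^o).
  by move=> i4; apply: (sa V _ oV (@subset_refl _ V)); apply: (XH_section fr oV VU i4).
have cE (u' v' : Hfib H x) : cn a u' v' = \sum_(i < 4) ((wh i x v' : R) *
     (dirder (vsval u' : tangent x) (fun y => a y (xh i y) : R^o) : R)
     - (a x (xh i x) : R) * (wh i x (gm u' v') : R)) :> R.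
  apply: (etrans (connE Gx fr oV VU u' v' sa Vx)); rewrite sumrB; congr (_ - _).
    have e : dirder (vsval u' : tangent x) (fun y => a y (ext v' y) : R^o)
      = dirder (vsval u' : tangent x) (fun y => \sum_(i < 4) (wh i x v' : R) * (a y (xh i y) : R) : R^o).
      by apply: (dirder_eq oV Vx) => y _; rewrite /cst_ext linear_sum; apply: eq_bigr => i _; rewrite linearZ.
    have sg' (i : 'I_4) : smooth_fun V (fun y => (wh i x v' : R) * (a y (xh i y) : R) : R^o).
      exact: (smooth_funM oV (smooth_fun_cst V _) (sf i (ltn_ord i))).
    apply: (etrans e); apply: (etrans (dirder_sum oV Vx _ _ (fun i _ => sg' i))).
    apply: eq_bigr => i _.
    apply: (etrans (dirderM Vx _ (smooth_fun_cst V (wh i x v')) (sf i (ltn_ord i)))).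
    by rewrite dirder_cst mulr0 addr0.
  rewrite [in LHS](H_expand fr (gm u' v') Ux) linear_sum; apply: eq_bigr => i _.
  by rewrite linearZ /= /GRing.scale /= mulrC.
rewrite /tors cE cE hc.
have -> : (\sum_(i < 4) (a x (xh i x) : R) * p i - c) * (JJ x [tuple u; v] : R)
   = \sum_(i < 4) (a x (xh i x) : R) * frame_tors i u v - c * (JJ x [tuple u; v] : R).
  rewrite mulrBl mulr_suml; congr (_ - _); apply: eq_bigr => i _.
  have [e|ne] := boolP ((i < 2)%N == b).
    have bv' : block_vanish (~~ (i < 2)%N) v by rewrite (eqP e).
    rewrite -mulrA; apply: (congr1 ( *%R _)); exact: esym (hp' i (ltn_ord i) u v bv').
  have -> : a x (xh i x) = 0.
    apply: ha => // k k4 kb; rewrite (wH_XH fr Ux k4 (ltn_ord i)).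
    by case: eqP => [e|//]; move: ne; rewrite e kb eqxx.
  by rewrite !mul0r.
rewrite -sumrB opprD addrA -sumrB; congr (_ - _).
apply: eq_bigr => i _; exact: torsion_algebra.
Qed.

End Local.
End InFrame.
End LeviCivita.

(** * Frame-independent description of the connection *)

Section Operators.
Variables (R : realType) (M : smooth_manifold R 5) (H E F : vdistribution M).

Definition Hop := (forall x, Hdual H x) -> forall x, Hfib H x -> Hdual H x.

(** The rules of a partial connection over one fixed open set, without the
    smoothness of the resulting sections. *)
Record pconn_on (V : set M) (D : Hop) : Prop := PConnOn {
  pc_local : forall a b, Hdual_section V a -> Hdual_section V b -> (forall y, V y -> a y = b y) ->
    forall x (v : Hfib H x), V x -> D a x v = D b x v;
  pc_lin : forall a b (c : R), Hdual_section V a -> Hdual_section V b ->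
    forall x (v : Hfib H x), V x -> D (fun y => c *: a y + b y) x v = c *: D a x v + D b x v;
  pc_leib : forall a (f : M -> R^o), Hdual_section V a -> smooth_fun V f ->
    forall x (v : Hfib H x), V x -> D (fun y => (f y : R) *: a y) x v
      = (f x : R) *: D a x v + (dirder (vsval v : tangent x) f : R) *: a x;
  pc_vlin : forall a, Hdual_section V a -> forall x, V x -> linear (D a x) }.

Lemma Hdual_section0 (V : set M) : Hdual_section V (fun x => 0 : Hdual H x).
Proof.
move=> W Y oW WV sY; apply: (smooth_fun_eq oW _ (smooth_fun_cst W (0 : R^o))) => x _.
by rewrite zero_lfunE.
Qed.

Lemma Hdual_section_sum (V : set M) (I : Type) (r : seq I) (f : I -> M -> R^o) (b : I -> forall x, Hdual H x) :
  (forall i, smooth_fun V (f i)) -> (forall i, Hdual_section V (b i)) ->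
  Hdual_section V (fun y => \sum_(i <- r) (f i y : R) *: b i y).
Proof.
move=> sf sb W Y oW WV sY.
have h : smooth_fun W (fun y => \sum_(i <- r) (f i y : R) * (b i y (Y y) : R) : R^o).
  apply: smooth_fun_sum => // i _; apply: smooth_funM => //; first exact: smooth_fun_sub WV (sf i).
  exact: sb.
apply: (smooth_fun_eq oW _ h) => x _; rewrite sum_lfunE; apply: eq_bigr => i _.
by rewrite scale_lfunE.
Qed.

Lemma pconn_sum V D (I : Type) (r : seq I) (f : I -> M -> R^o) (b : I -> forall x, Hdual H x)
    x (v : Hfib H x) : pconn_on V D -> V x ->
  (forall i, smooth_fun V (f i)) -> (forall i, Hdual_section V (b i)) ->
  D (fun y => \sum_(i <- r) (f i y : R) *: b i y) x v
  = \sum_(i <- r) ((f i x : R) *: D (b i) x v + (dirder (vsval v : tangent x) (f i) : R) *: b i x).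
Proof.
move=> pD Vx sf sb; elim: r => [|i r IH].
  have -> : (fun y => \sum_(i <- [::]) (f i y : R) *: b i y) = (fun y => 0 : Hdual H y).
    by apply: functional_extensionality_dep => y; rewrite big_nil.
  rewrite big_nil; have := pc_lin pD 1 (@Hdual_section0 V) (@Hdual_section0 V) v Vx.
  have -> : (fun y => 1 *: (0 : Hdual H y) + 0) = (fun y => 0 : Hdual H y).
    by apply: functional_extensionality_dep => y; rewrite scaler0 addr0.
  by rewrite scale1r => /esym/eqP; rewrite -subr_eq0 addrK => /eqP.
have -> : (fun y => \sum_(j <- i :: r) (f j y : R) *: b j y) =
    (fun y => 1 *: ((f i y : R) *: b i y) + \sum_(j <- r) (f j y : R) *: b j y).
  by apply: functional_extensionality_dep => y; rewrite big_cons scale1r.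
rewrite (pc_lin pD 1 (Hdual_section_scale (sb i) (sf i)) (Hdual_section_sum r sf sb) v Vx).
by rewrite scale1r IH big_cons (pc_leib pD (sb i) (sf i) v Vx).
Qed.

Section InFrame.
Variables (U : set M) (X : nat -> forall y : M, tangent y) (Z : forall y : M, tangent y).
Variables (w : nat -> forall y : M, cotangent y) (tau : forall y : M, cotangent y).
Hypothesis fr : is_frame H E F U X Z w tau.

Local Notation xh := (XH H X).
Local Notation wh := (wH H w).

Variables (V : set M).
Hypotheses (oV : open V) (VU : V `<=` U).

Lemma section_expand (a : forall x, Hdual H x) y : V y -> a y = \sum_(i < 4) ((a y (xh i y)) : R) *: wh i y.
Proof.
move=> Vy; apply/lfunP => u; rewrite [in LHS](H_expand fr u (VU Vy)) linear_sum sum_lfunE.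
by apply: eq_bigr => i _; rewrite linearZ scale_lfunE /GRing.scale /= mulrC.
Qed.

Lemma pconn_expand D (a : forall x, Hdual H x) x (v : Hfib H x) : pconn_on V D -> Hdual_section V a -> V x ->
  D a x v = \sum_(i < 4) ((a x (xh i x) : R) *: D (wh i) x v
     + (dirder (vsval v : tangent x) (fun y => a y (xh i y) : R^o) : R) *: wh i x).
Proof.
move=> pD sa Vx.
have sf (i : 'I_4) : smooth_fun V (fun y => a y (xh i y) : R^o).
  by apply: (sa V _ oV (@subset_refl _ V)); apply: (XH_section fr oV VU (ltn_ord i)).
have sw (i : 'I_4) : Hdual_section V (wh i) := wH_section fr oV VU (ltn_ord i).
rewrite -(pconn_sum (index_enum 'I_4) v pD Vx sf sw).
apply: (pc_local pD) => //; first exact: (Hdual_section_sum _ sf sw).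
by move=> y Vy; apply: section_expand.
Qed.

(** By the Leibniz rule and linearity in the direction, everything follows from
    the derivatives of the coframe along the frame. *)
Lemma pconn_determined D D' (a : forall x, Hdual H x) x (v : Hfib H x) : pconn_on V D -> pconn_on V D' ->
  Hdual_section V a -> V x ->
  (forall i j k, (i < 4)%N -> (j < 4)%N -> (k < 4)%N ->
     D (wh i) x (xh j x) (xh k x) = D' (wh i) x (xh j x) (xh k x)) -> D a x v = D' a x v.
Proof.
move=> pD pD' sa Vx e; have Ux := VU Vx.
rewrite (pconn_expand v pD sa Vx) (pconn_expand v pD' sa Vx); apply: eq_bigr => i _.
congr (_ *: _ + _); have sw := wH_section fr oV VU (ltn_ord i).
rewrite (H_expand fr v Ux) (lin_comb (pc_vlin pD sw Vx)) (lin_comb (pc_vlin pD' sw Vx)).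
apply: eq_bigr => j _; congr (_ *: _); apply/lfunP => u.
rewrite [in LHS](H_expand fr u Ux) [in RHS](H_expand fr u Ux) !linear_sum; apply: eq_bigr => k _.
by rewrite !linearZ /= (e i j k (ltn_ord i) (ltn_ord j) (ltn_ord k)).
Qed.

End InFrame.
End Operators.

Section Characterisation.
Variables (R : realType) (M : smooth_manifold R 5) (H E F : vdistribution M).
Hypothesis contactH : contact_distribution H.
Hypothesis splitH : legendrean_splitting H E F.
Variable sg : forall x : M, 'Hom(subvs_of (Lfib H x), R^o).
Hypothesis smooth_sg : Ldual_section sg.
Hypothesis sg_neq0 : forall x : M, sg x != 0.

Local Notation "'JJ' x" := (@Jform R M H sg x) (at level 10, x at level 9).

(** With the two summands indexed by a boolean, [ann (summand b)] is the dual of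
    [summand (~~ b)]. *)
Definition summand (b : bool) : vdistribution M := if b then F else E.

(** These properties do not refer to a frame, and in every adapted frame they
    imply the linear system. They are what the connections of different frames
    have in common. *)
Record levi_civita_on (V : set M) (D : Hop H) : Prop := LeviCivitaOn {
  lcon_split : forall b (a : forall x, Hdual H x), Hdual_section V a ->
    (forall y, V y -> ann (summand b) (a y)) -> forall x (v : Hfib H x), V x -> ann (summand b) (D a x v);
  lcon_torsion : forall b (a : forall x, Hdual H x) (at_ : forall x : M, cotangent x),
    Hdual_section V a -> lifts V a at_ -> (forall y, V y -> ann (summand b) (a y)) ->
    forall x, V x -> exists p, forall u v : Hfib H x, vsval v \in summand (~~ b) x ->
      tors D a at_ u v = p * (JJ x [tuple u; v] : R);
  lcon_metric : forall (a b : forall x, Hdual H x) (Y Y' : forall x, Hfib H x),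
    Hdual_section V a -> Hdual_section V b -> Hsection V Y -> Hsection V Y' ->
    (forall y, V y -> forall u : Hfib H y, a y u = JJ y [tuple Y y; u]) ->
    (forall y, V y -> forall u : Hfib H y, b y u = JJ y [tuple Y' y; u]) ->
    forall x (v : Hfib H x), V x ->
    (D a x v (Y' x) : R) - (D b x v (Y x) : R)
    = dirder (vsval v : tangent x) (fun y => JJ y [tuple Y y; Y' y] : R^o) :> R }.

Section InFrame.
Variables (U : set M) (X : nat -> forall y : M, tangent y) (Z : forall y : M, tangent y).
Variables (w : nat -> forall y : M, cotangent y) (tau : forall y : M, cotangent y).
Hypothesis afr : is_aframe E F sg U X Z w tau.
Let fr : is_frame H E F U X Z w tau := aframe_frame afr.
Let oU : open U. Proof. exact: frame_open fr. Qed.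

Local Notation xh := (XH H X).
Local Notation wh := (wH H w).
Local Notation Gx := (Gc X w).
Definition frame_conn : Hop H := fun a x v => conn X w Gx a v.

Lemma summand_block b x (u : Hfib H x) : U x -> vsval u \in summand b x <-> block_vanish w b u.
Proof.
by case: b => Ux; [exact: (memF_block afr)|exact: (memE_block afr)].
Qed.

Lemma XH_summand b k x : U x -> (k < 4)%N -> (k < 2)%N = ~~ b -> vsval (xh k x) \in summand b x.
Proof.
move=> Ux k4 kb; apply/summand_block => // i i4 ib; rewrite (wH_XH fr Ux)//.
by case: eqP => // e; move: kb; rewrite e ib; case: (b).
Qed.

Lemma wH_ann i x : U x -> (i < 4)%N -> ann (summand (i < 2)%N) (wh i x).
Proof. by move=> Ux i4 u /summand_block h; apply: h. Qed.

Section Local.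
Variable V : set M.
Hypotheses (oV : open V) (VU : V `<=` U).

Lemma frame_conn_pconn : pconn_on V frame_conn.
Proof.
split.
- move=> a b sa sb e x v Vx; exact: (conn_local Gx fr oV VU v sa sb Vx e).
- move=> a b c sa sb x v Vx; exact: (conn_lin Gx fr oV VU v c sa sb Vx).
- move=> a f sa sf x v Vx; exact: (conn_leibniz Gx fr oV VU v sa sf Vx).
- move=> a sa x Vx; exact: (conn_linear Gx fr oV VU sa Vx).
Qed.

Lemma frame_conn_levi_civita : levi_civita_on V frame_conn.
Proof.
split.
- move=> b a sa ha x v Vx u ub.
  apply: (conn_block afr oV VU (b := b) v sa Vx) => [y Vy u' bu|].
    by apply: ha => //; apply/summand_block => //; exact: VU.
  by apply/summand_block => //; exact: VU.
- move=> b a at_ sa la ha x Vx.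
  have ha' y : V y -> forall u : Hfib H y, block_vanish w b u -> a y u = 0.
    by move=> Vy u bu; apply: ha => //; apply/summand_block => //; exact: VU.
  have [p hp] := conn_torsion contactH splitH smooth_sg sg_neq0 afr oV VU sa la Vx ha'.
  exists p => u v vb; apply: hp; apply/summand_block => //; exact: VU.
- move=> a b Y Y' sa sb sY sY' ea eb x v Vx.
  exact: (conn_metric contactH splitH smooth_sg sg_neq0 afr oV VU v sa sb sY sY' Vx ea eb).
Qed.

Definition frame_metric (D : Hop H) x := forall j i k, (j < 4)%N -> (i < 4)%N -> (k < 4)%N ->
  same i k -> (D (wh i) x (xh j x) (xh k x) : R)
    + (D (wh (dual_index k)) x (xh j x) (xh (dual_index i) x) : R) = 0.

Lemma dual_sign_dual i : (i < 4)%N -> dual_sign R (dual_index i) = - dual_sign R i.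
Proof. by case: i => [|[|[|[|//]]]] _; rewrite /dual_sign /= ?opprK. Qed.

Lemma dual_sign_sq i : dual_sign R i * dual_sign R i = 1.
Proof. by rewrite /dual_sign; case: ifP => _; rewrite ?mulrNN mulr1. Qed.

(** Up to sign the Levi form identifies a frame field with the coframe form of
    the dual index. *)
Lemma dual_coframe i y (u : Hfib H y) : U y -> (i < 4)%N ->
  wh i y u = JJ y [tuple dual_sign R i *: xh (dual_index i) y; u].
Proof.
move=> Uy i4; have J_altform := Jform_alt contactH splitH smooth_sg sg_neq0 y.
rewrite [in RHS](H_expand fr u Uy); apply/esym.
apply: (etrans (lin_comb (alt2_linr _ J_altform) _ _ _ _)).
transitivity (\sum_(k < 4) (dual_sign R i * (wh k y u : R)) * symp R (dual_index i) k).
  apply: eq_bigr => k _; rewrite (linZ (alt2_linl _ J_altform)).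
  rewrite (J_XH afr Uy (dual_lt4 i4) (ltn_ord k)) /GRing.scale /=; ring.
rewrite (symp_sum_r (fun k => dual_sign R i * (wh k y u : R)) (dual_lt4 i4)) (dual_indexK i4).
by rewrite (dual_sign_dual i4) opprK mulrA dual_sign_sq mul1r.
Qed.

Lemma metric_system_algebra (s s' g h d : R) : s * s = 1 -> s' = s -> (- s') *: (g : R^o) + s *: (- h : R^o) = d :> R -> d = 0 -> g + h = 0.
Proof.
rewrite /GRing.scale /= mulrN; move=> s1 -> e d0; have : s * ((- s) * g - s * h) = 0 by rewrite e d0 mulr0.
have -> : s * (- s * g - s * h) = - (s * s) * (g + h) by ring.
by rewrite s1 mulN1r => /eqP; rewrite oppr_eq0 => /eqP.
Qed.

(** Take for [a] and [b] two coframe forms: the corresponding fields are frame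
    fields up to sign, so that the right-hand side is the derivative of a
    constant. *)
Lemma levi_civita_frame_metric D x : pconn_on V D -> levi_civita_on V D -> V x -> frame_metric D x.
Proof.
move=> pD [_ _ mD] Vx j i k j4 i4 k4 sik.
have Ux := VU Vx; have dk4 := dual_lt4 k4; have di4 := dual_lt4 i4.
have sw l (l4 : (l < 4)%N) := wH_section fr oV VU l4.
have sx l (l4 : (l < 4)%N) (c : R) : Hsection V (fun y => c *: xh l y).
  have h := Hsection_comb oV (fun _ : 'I_1 => smooth_fun_cst V (c : R^o)) (fun _ => XH_section fr oV VU l4).
  by apply: (Hsection_eq oV _ h) => y _; rewrite big_ord1.
have ea y : V y -> forall u : Hfib H y, wh i y u = JJ y [tuple dual_sign R i *: xh (dual_index i) y; u].
  by move=> Vy u; exact: dual_coframe (VU Vy) i4.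
have eb y : V y -> forall u : Hfib H y,
    wh (dual_index k) y u = JJ y [tuple dual_sign R (dual_index k) *: xh k y; u].
  by move=> Vy u; rewrite (dual_coframe u (VU Vy) dk4) (dual_indexK k4).
have := mD _ _ _ _ (sw i i4) (sw _ dk4) (sx _ di4 _) (sx _ k4 _) ea eb x (xh j x) Vx.
rewrite !linearZ /= (dual_sign_dual k4) => e.
apply: (metric_system_algebra (dual_sign_sq i) _ e).
  by move: sik; rewrite /same /dual_sign => /eqP ->.
rewrite -(dirder_cst (vsval (xh j x) : tangent x)
  (dual_sign R i * (- dual_sign R k) * symp R (dual_index i) k : R^o)).
apply: (dirder_eq oV Vx) => y Vy; have J_altform := Jform_alt contactH splitH smooth_sg sg_neq0 y.
rewrite (linZ (alt2_linl _ J_altform)) (linZ (alt2_linr _ J_altform)) (J_XH afr (VU Vy) di4 k4).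
by rewrite /GRing.scale /= mulrA.
Qed.

(** The splitting and torsion conditions are applied to the coframe forms, with
    the 1-forms [w c] as lifts. *)
Lemma system_of_conditions D x :
  (forall b (a : forall x, Hdual H x), Hdual_section V a ->
    (forall y, V y -> ann (summand b) (a y)) -> forall v : Hfib H x, ann (summand b) (D a x v)) ->
  (forall b (a : forall x, Hdual H x) (at_ : forall x : M, cotangent x),
    Hdual_section V a -> lifts V a at_ -> (forall y, V y -> ann (summand b) (a y)) ->
    exists p, forall u v : Hfib H x, vsval v \in summand (~~ b) x ->
      tors D a at_ u v = p * (JJ x [tuple u; v] : R)) ->
  frame_metric D x -> V x ->
  levi_civita_system (fun i j k => Kc X w i j k x) (fun j i k => D (wh i) x (xh j x) (xh k x) : R).
Proof.
move=> sD tD mD Vx; have Ux := VU Vx.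
have sw l (l4 : (l < 4)%N) := wH_section fr oV VU l4.
have aw l y (l4 : (l < 4)%N) (Vy : V y) := wH_ann (VU Vy) l4.
split=> [j i k j4 i4 k4 ns|j i k j4 i4 k4 s|c c4].
- apply: (sD (i < 2)%N (wh i) (sw i i4) (fun y => aw i y i4)).
  by apply: (XH_summand Ux k4); move: ns; rewrite /same; case: (i < 2)%N; case: (k < 2)%N.
- exact: mD.
- have lw : lifts V (wh c) (w c) by split=> //; apply: smooth_form_sub VU (frame_smoothw fr c4).
  have [p hp] := tD _ _ _ (sw c c4) lw (fun y => aw c y c4).
  exists p => a k a4 k4 skc.
  have kc : (k < 2)%N = ~~ ~~ (c < 2)%N by move/eqP: (skc) => ->; rewrite negbK.
  have := hp (xh a x) (xh k x) (XH_summand Ux k4 kc).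
  by rewrite (J_XH afr Ux a4 k4) /tors (vsval_XH fr Ux a4) (vsval_XH fr Ux k4).
Qed.

(** Both families of coefficients solve the same uniquely solvable system. *)
Lemma system_agree D D' a x (v : Hfib H x) : pconn_on V D -> pconn_on V D' ->
  levi_civita_system (fun i j k => Kc X w i j k x) (fun j i k => D (wh i) x (xh j x) (xh k x) : R) ->
  levi_civita_system (fun i j k => Kc X w i j k x) (fun j i k => D' (wh i) x (xh j x) (xh k x) : R) ->
  Hdual_section V a -> V x -> D a x v = D' a x v.
Proof.
move=> pD pD' sD sD' sa Vx; apply: (pconn_determined fr oV VU v pD pD' sa Vx) => i j k i4 j4 k4.
have e := christoffel_unique sD j4 i4 k4; have e' := christoffel_unique sD' j4 i4 k4.
exact: (etrans e (esym e')).
Qed.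

Lemma levi_civita_on_system D x : pconn_on V D -> levi_civita_on V D -> V x ->
  levi_civita_system (fun i j k => Kc X w i j k x) (fun j i k => D (wh i) x (xh j x) (xh k x) : R).
Proof.
move=> pD lD Vx; have mD := levi_civita_frame_metric pD lD Vx.
case: lD => sD tD _; apply: system_of_conditions => //.
- by move=> b a sa ha v; apply: sD.
- by move=> b a at_ sa la ha; apply: tD.
Qed.

Lemma levi_civita_on_agree D D' a x (v : Hfib H x) : pconn_on V D -> pconn_on V D' ->
  levi_civita_on V D -> levi_civita_on V D' -> Hdual_section V a -> V x -> D a x v = D' a x v.
Proof.
move=> pD pD' lD lD' sa Vx; apply: (system_agree v pD pD' _ _ sa Vx).
  exact: (levi_civita_on_system pD lD Vx).
exact: (levi_civita_on_system pD' lD' Vx).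
Qed.

End Local.
End InFrame.
End Characterisation.

(** * Gluing the connections of adapted frames *)

Section LocalSections.
Variables (R : realType) (n : nat) (M : smooth_manifold R n) (H : vdistribution M).

Lemma Hdual_section_pointwise (U : set M) (a : forall x, Hdual H x) :
  (forall x, U x -> exists V, [/\ open V, V x & Hdual_section V a]) -> Hdual_section U a.
Proof.
move=> h W Y oW WU sY; apply: smooth_fun_pointwise => x Wx.
have [V [oV Vx sa]] := h x (WU x Wx).
have oVW : open (V `&` W) by apply: openI.
exists (V `&` W) => //.
exact: (sa (V `&` W) Y oVW (@subIsetl _ _ _) (Hsection_sub (@subIsetr _ _ _) sY)).
Qed.

Lemma Hform_section_pointwise k (U : set M) (s : forall x, Hform H k x) :
  (forall x, U x -> exists V, [/\ open V, V x & Hform_section V s]) -> Hform_section U s.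
Proof.
move=> h; split=> [x Ux|W Y oW WU sY].
  by have [V [_ Vx [al _]]] := h x Ux; exact: al.
apply: smooth_fun_pointwise => x Wx.
have [V [oV Vx [_ sa]]] := h x (WU x Wx).
have oVW : open (V `&` W) by apply: openI.
exists (V `&` W) => //.
exact: (sa (V `&` W) Y oVW (@subIsetl _ _ _) (fun j => Hsection_sub (@subIsetr _ _ _) (sY j))).
Qed.

End LocalSections.

Section Gluing.
Variables (R : realType) (M : smooth_manifold R 5) (H E F : vdistribution M).
Hypothesis contactH : contact_distribution H.
Hypothesis splitH : legendrean_splitting H E F.
Variable sg : forall x : M, 'Hom(subvs_of (Lfib H x), R^o).
Hypothesis smooth_sg : Ldual_section sg.
Hypothesis sg_neq0 : forall x : M, sg x != 0.

Local Notation "'JJ' x" := (@Jform R M H sg x) (at level 10, x at level 9).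

(** Bundled so that one adapted frame can be chosen at every point. *)
Record aframe := AFrame {
  af_dom : set M;
  af_X : nat -> forall y : M, tangent y;
  af_Z : forall y : M, tangent y;
  af_w : nat -> forall y : M, cotangent y;
  af_tau : forall y : M, cotangent y;
  af_ok : is_aframe E F sg af_dom af_X af_Z af_w af_tau }.

Lemma aframe_at x : exists f, af_dom f x.
Proof.
have [U [X [Z [w [tau [Ux fr]]]]]] := aframe_exists contactH splitH smooth_sg sg_neq0 x.
by exists (AFrame fr).
Qed.

Let chosen x : aframe := sval (cid (aframe_at x)).
Let chosen_dom x : af_dom (chosen x) x. Proof. exact: svalP (cid (aframe_at x)). Qed.
Let af_frame f : is_frame H E F (af_dom f) (af_X f) (af_Z f) (af_w f) (af_tau f) := af_ok f.
Let af_open f : open (af_dom f). Proof. exact: frame_open (af_frame f). Qed.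

Let nabla_in (f : aframe) : Hop H := frame_conn (af_X f) (af_w f).
Let nabla_form_in f k (s : forall x, Hform H k x) x (v : Hfib H x) : Hform H k x :=
  form_conn (af_X f) (af_w f) (Gc (af_X f) (af_w f)) s v.

(** At each point this uses the adapted frame chosen there. Near a given point a
    single frame can be used instead, by [glued_connE], which is how smoothness
    is obtained. *)
Definition glued_conn : Hop H := fun a x v => nabla_in (chosen x) a v.
Definition glued_form_conn k (s : forall x, Hform H k x) x (v : Hfib H x) : Hform H k x :=
  nabla_form_in (chosen x) s v.
Arguments glued_form_conn k s x v : clear implicits.

Section Local.
Variables (f : aframe) (V : set M).
Hypotheses (oV : open V) (Vf : V `<=` af_dom f).

Lemma nabla_in_pconn : pconn_on V (nabla_in f).
Proof. exact: (frame_conn_pconn (af_ok f) oV Vf). Qed.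

Lemma nabla_in_levi_civita : levi_civita_on E F sg V (nabla_in f).
Proof. exact: (frame_conn_levi_civita contactH splitH smooth_sg sg_neq0 (af_ok f) oV Vf). Qed.

End Local.

Lemma nabla_in_agree f g V (a : forall x, Hdual H x) x (v : Hfib H x) : open V ->
  V `<=` af_dom f -> V `<=` af_dom g -> Hdual_section V a -> V x -> nabla_in f a v = nabla_in g a v.
Proof.
move=> oV Vf Vg sa Vx.
exact: (levi_civita_on_agree contactH splitH smooth_sg sg_neq0 (af_ok f) oV Vf v
  (nabla_in_pconn oV Vf) (nabla_in_pconn oV Vg) (nabla_in_levi_civita oV Vf) (nabla_in_levi_civita oV Vg) sa Vx).
Qed.

Lemma glued_connE f V (a : forall x, Hdual H x) x (v : Hfib H x) : open V ->
  V `<=` af_dom f -> Hdual_section V a -> V x -> glued_conn a v = nabla_in f a v.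
Proof.
move=> oV Vf sa Vx; have oW : open (V `&` af_dom (chosen x)) by apply: openI.
apply: (nabla_in_agree v oW (@subIsetr _ _ _) (subset_trans (@subIsetl _ _ _) Vf)) => //.
by apply: Hdual_section_sub sa; apply: subIsetl.
Qed.

Lemma glued_form_connE f V k (s : forall x, Hform H k x) x (v : Hfib H x) : open V ->
  V `<=` af_dom f -> Hform_section V s -> V x -> glued_form_conn k s x v = nabla_form_in f s v.
Proof.
move=> oV Vf ss Vx; have oW : open (V `&` af_dom (chosen x)) by apply: openI.
have Wf := subset_trans (@subIsetl _ V (af_dom (chosen x))) Vf.
have Wr : V `&` af_dom (chosen x) `<=` af_dom (chosen x) by exact: subIsetr.
have Wx : (V `&` af_dom (chosen x)) x by split.
have ss' := Hform_section_sub (@subIsetl _ V (af_dom (chosen x))) ss.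
have ce a (sa : Hdual_section (V `&` af_dom (chosen x)) a) : conn (af_X (chosen x)) (af_w (chosen x)) (Gc (af_X (chosen x)) (af_w (chosen x))) a v
   = conn (af_X f) (af_w f) (Gc (af_X f) (af_w f)) a v := nabla_in_agree v oW Wr Wf sa Wx.
exact: (form_conn_frame_change (af_frame (chosen x)) (af_frame f) oW Wr Wf Wx ce ss').
Qed.

Section At.
Variables (U : set M).
Hypothesis oU : open U.
Let W x := U `&` af_dom (chosen x).
Let oW x : open (W x). Proof. by apply: openI. Qed.
Let WU x : W x `<=` U. Proof. exact: subIsetl. Qed.
Let Wf x : W x `<=` af_dom (chosen x). Proof. exact: subIsetr. Qed.
Let Wx x : U x -> W x x. Proof. by []. Qed.

Let restr (a : forall x, Hdual H x) x : Hdual_section U a -> Hdual_section (W x) a.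
Proof. exact: (Hdual_section_sub (@WU x)). Qed.

Lemma glued_pconn : pconn_on U glued_conn.
Proof.
split=> [a b sa sb e x v Ux|a b c sa sb x v Ux|a h sa sh x v Ux|a sa x Ux].
- exact: (pc_local (nabla_in_pconn (oW x) (@Wf x)) (restr sa) (restr sb) (fun y Wy => e y (WU Wy)) v (Wx Ux)).
- exact: (pc_lin (nabla_in_pconn (oW x) (@Wf x)) c (restr sa) (restr sb) v (Wx Ux)).
- exact: (pc_leib (nabla_in_pconn (oW x) (@Wf x)) (restr sa) (smooth_fun_sub (@WU x) sh) v (Wx Ux)).
- exact: (pc_vlin (nabla_in_pconn (oW x) (@Wf x)) (restr sa) (Wx Ux)).
Qed.

Lemma glued_split b (a : forall x, Hdual H x) : Hdual_section U a ->
  (forall y, U y -> ann (summand E F b) (a y)) ->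
  forall x (v : Hfib H x), U x -> ann (summand E F b) (glued_conn a v).
Proof.
move=> sa ha x v Ux.
exact: (lcon_split (nabla_in_levi_civita (oW x) (@Wf x)) (restr sa) (fun y Wy => ha y (WU Wy)) v (Wx Ux)).
Qed.

Lemma glued_torsion b (a : forall x, Hdual H x) (at_ : forall x : M, cotangent x) :
  Hdual_section U a -> lifts U a at_ -> (forall y, U y -> ann (summand E F b) (a y)) ->
  forall x, U x -> exists p, forall u v : Hfib H x, vsval v \in summand E F (~~ b) x ->
    tors glued_conn a at_ u v = p * (JJ x [tuple u; v] : R).
Proof.
move=> sa [la1 la2] ha x Ux.
have lW : lifts (W x) a at_ by split=> [|y /WU]; [exact: (smooth_form_sub (@WU x) la1)|exact: la2].
have [p hp] := lcon_torsion (nabla_in_levi_civita (oW x) (@Wf x)) (restr sa) lW (fun y Wy => ha y (WU Wy)) (Wx Ux).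
have ge (z : Hfib H x) : glued_conn a z = nabla_in (chosen x) a z by [].
by exists p => u v vb; rewrite /tors !ge; exact: hp.
Qed.

Lemma glued_conn_section (a : forall x, Hdual H x) A : Hdual_section U a -> Hsection U A ->
  Hdual_section U (fun x => glued_conn a (A x)).
Proof.
move=> sa sA; apply: Hdual_section_pointwise => x Ux; exists (W x); split=> //.
have sa' := Hdual_section_sub (@WU x) sa; have sA' := Hsection_sub (@WU x) sA.
have h := conn_section (af_frame (chosen x)) (fun j i k => @Gc_smooth _ _ _ _ _ _ _ _ _ _ _ (af_ok (chosen x)) j i k) (oW x) (@Wf x) sa' sA'.
move=> W' Y oW' WW' sY; apply: (smooth_fun_eq oW' _ (h W' Y oW' WW' sY)) => y Wy.
by rewrite (glued_connE (A y) (oW x) (@Wf x) sa' (WW' y Wy)).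
Qed.

Section FormConnection.
Variable k : nat.
Implicit Types s t : forall x, Hform H k x.

Let restrs x s : Hform_section U s -> Hform_section (W x) s.
Proof. exact: (Hform_section_sub (@WU x)). Qed.

Lemma glued_form_conn_section s A : Hform_section U s -> Hsection U A ->
  Hform_section U (fun x => glued_form_conn k s x (A x)).
Proof.
move=> ss sA; apply: Hform_section_pointwise => x Ux; exists (W x); split=> //.
have ss' := restrs x ss; have sA' := Hsection_sub (@WU x) sA.
have h := form_conn_section (af_frame (chosen x)) (fun j i k => @Gc_smooth _ _ _ _ _ _ _ _ _ _ _ (af_ok (chosen x)) j i k) (oW x) (@Wf x) ss' sA'.
apply: (Hform_section_eq (oW x) _ h) => y Wy.
exact: (esym (glued_form_connE (A y) (oW x) (@Wf x) ss' Wy)).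
Qed.

Lemma glued_form_conn_linear s x : Hform_section U s -> U x -> linear (glued_form_conn k s x).
Proof.
by move=> ss Ux; exact: (form_conn_linear (Gc (af_X (chosen x)) (af_w (chosen x))) (af_frame (chosen x)) (oW x) (@Wf x) (restrs x ss) (Wx Ux)).
Qed.

Lemma glued_form_conn_local s t x (v : Hfib H x) : U x -> (forall y, U y -> s y = t y) ->
  glued_form_conn k s x v = glued_form_conn k t x v.
Proof.
move=> Ux e.
exact: (form_conn_local (af_X (chosen x)) (af_w (chosen x)) (Gc (af_X (chosen x)) (af_w (chosen x))) oU v Ux e).
Qed.

Lemma glued_form_conn_lin (c : R) s t x (v : Hfib H x) : Hform_section U s -> Hform_section U t -> U x ->
  glued_form_conn k (fun y => c *: s y + t y) x v = c *: glued_form_conn k s x v + glued_form_conn k t x v.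
Proof.
move=> ss st Ux.
exact: (form_conn_lin (Gc (af_X (chosen x)) (af_w (chosen x))) (af_frame (chosen x)) (oW x) (@Wf x) v c (restrs x ss) (restrs x st) (Wx Ux)).
Qed.

Lemma glued_form_conn_leibniz s (h : M -> R^o) x (v : Hfib H x) : Hform_section U s -> smooth_fun U h -> U x ->
  glued_form_conn k (fun y => (h y : R) *: s y) x v
  = (h x : R) *: glued_form_conn k s x v + (dirder (vsval v : tangent x) h : R) *: s x.
Proof.
move=> ss sh Ux.
exact: (form_conn_leibniz (Gc (af_X (chosen x)) (af_w (chosen x))) (af_frame (chosen x)) (oW x) (@Wf x) v (restrs x ss) (smooth_fun_sub (@WU x) sh) (Wx Ux)).
Qed.

Lemma glued_form_conn_wedge (b : 'I_k -> forall x, Hdual H x) x (v : Hfib H x) :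
  (forall i, Hdual_section U (b i)) -> U x ->
  glued_form_conn k (fun y => wedge (fun i => b i y)) x v
  = \sum_(i < k) wedge (fun j => if j == i then glued_conn (b j) v else b j x).
Proof.
move=> sb Ux.
exact: (form_conn_wedge (Gc (af_X (chosen x)) (af_w (chosen x))) (af_frame (chosen x)) (oW x) (@Wf x) v (fun i => restr (sb i)) (Wx Ux)).
Qed.

End FormConnection.

(** Near [x] the section is [c] times the Levi form, where [c] is its value on
    the frame fields [X 0] and [X 2] and hence smooth; the Levi form is parallel. *)
Lemma glued_levi_line (s : forall x, Hform H 2 x) : Hform_section U s ->
  (forall x, U x -> levi_line x (s x)) -> forall x (v : Hfib H x), U x -> levi_line x (glued_form_conn 2 s x v).
Proof.
move=> ss sl x v Ux; have afr := af_ok (chosen x).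
pose c y : R^o := s y [tuple XH H (af_X (chosen x)) 0 y; XH H (af_X (chosen x)) 2 y].
have sc : smooth_fun (W x) c.
  have [_ h] := Hform_section_sub (@WU x) ss.
  pose Y (i : 'I_2) y := if i == ord0 then XH H (af_X (chosen x)) 0 y else XH H (af_X (chosen x)) 2 y.
  have sY i : Hsection (W x) (Y i).
    by rewrite /Y; case: (i == ord0); [exact: (XH_section afr (oW x) (@Wf x) (isT : (0 < 4)%N))
      |exact: (XH_section afr (oW x) (@Wf x) (isT : (2 < 4)%N))].
  apply: (smooth_fun_eq (oW x) _ (h (W x) Y (oW x) (@subset_refl _ _) sY)) => y _.
  by rewrite [in LHS](tuple2E [tuple Y j y | j < 2]) !tnth_mktuple.
have ec y : W x y -> s y = (c y : R) *: JJ y.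
  move=> Wy; have [d ed] := (levi_lineP contactH splitH smooth_sg sg_neq0 (s y)).1 (sl y (WU Wy)).
  rewrite {1}ed; congr (_ *: _); rewrite /c ed.
  have -> : (d *: JJ y) [tuple XH H (af_X (chosen x)) 0 y; XH H (af_X (chosen x)) 2 y]
     = d * (JJ y [tuple XH H (af_X (chosen x)) 0 y; XH H (af_X (chosen x)) 2 y] : R) by [].
  by rewrite (J_XH afr (Wf Wy) (isT : (0 < 4)%N) (isT : (2 < 4)%N)) /symp subr0 mulr1.
have sJ := Jform_section contactH splitH smooth_sg sg_neq0 (oW x).
have e1 := form_conn_local (af_X (chosen x)) (af_w (chosen x)) (Gc (af_X (chosen x)) (af_w (chosen x))) (oW x) v (Wx Ux) ec.
have e2 := form_conn_leibniz (Gc (af_X (chosen x)) (af_w (chosen x))) (af_frame (chosen x)) (oW x) (@Wf x) v sJ sc (Wx Ux).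
have e3 := form_conn_J contactH splitH smooth_sg sg_neq0 afr v (chosen_dom x).
have e : glued_form_conn 2 s x v = (dirder (vsval v : tangent x) c : R) *: JJ x.
  by apply: (etrans e1); apply: (etrans e2); rewrite e3 scaler0 add0r.
by rewrite e; exact: (levi_lineZ contactH splitH smooth_sg sg_neq0).
Qed.

End At.

Lemma glued_partial_connection : partial_connection (V := Lambda1_H H) glued_conn.
Proof.
move=> U oU a sa; have pc := glued_pconn oU; split=> /=.
- split=> [x Ux|A sA]; first exact: (pc_vlin pc sa Ux).
  exact: (glued_conn_section oU sa sA).
- move=> t st e x Ux v; exact: (pc_local pc sa st e v Ux).
- move=> c t st x Ux v; exact: (pc_lin pc c sa st v Ux).
- move=> f sf x Ux v; exact: (pc_leib pc sa sf v Ux).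
Qed.

Lemma glued_induced k : Defs.induced glued_conn (glued_form_conn k).
Proof.
split; last first.
  by move=> U oU b sb x Ux v; exact: (glued_form_conn_wedge oU v sb Ux).
move=> U oU s ss; split=> /=.
- split=> [x Ux|A sA]; first exact: (glued_form_conn_linear oU ss Ux).
  exact: (glued_form_conn_section oU ss sA).
- move=> t st e x Ux v; exact: (glued_form_conn_local oU v Ux e).
- move=> c t st x Ux v; exact: (glued_form_conn_lin oU c v ss st Ux).
- move=> f sf x Ux v; exact: (glued_form_conn_leibniz oU v ss sf Ux).
Qed.

Lemma glued_compatible : compatible E F glued_conn.
Proof.
split.
- move=> U oU a sa ha x Ux v; exact: (glued_split oU (b := true) sa ha v Ux).
- move=> U oU a sa ha x Ux v; exact: (glued_split oU (b := false) sa ha v Ux).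
- exists (glued_form_conn 2); split; first exact: glued_induced.
  move=> U oU s ss sl x Ux v; exact: (glued_levi_line oU ss sl v Ux).
Qed.

Lemma glued_sigma_sq : annihilates_sigma_sq sg glued_conn.
Proof.
exists (glued_form_conn 4); split; first exact: glued_induced.
by move=> x v; exact: (form_conn_J2 contactH splitH smooth_sg sg_neq0 (af_ok (chosen x)) v (chosen_dom x)).
Qed.

End Gluing.

(** * Minimal torsion *)

Section MinimalTorsion.
Variables (R : realType) (M : smooth_manifold R 5) (H E F : vdistribution M).
Hypothesis contactH : contact_distribution H.
Hypothesis splitH : legendrean_splitting H E F.
Variable sg : forall x : M, 'Hom(subvs_of (Lfib H x), R^o).
Hypothesis smooth_sg : Ldual_section sg.
Hypothesis sg_neq0 : forall x : M, sg x != 0.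

Local Notation "'JJ' x" := (@Jform R M H sg x) (at level 10, x at level 9).

(** The 2-form to which [nabla_perp] applies the projection [perp]. *)
Definition skew_part x (N : Hfib H x -> Hdual H x) : Hform H 2 x := fun v =>
  (N (tnth v ord0) (tnth v ord_max) : R) - (N (tnth v ord_max) (tnth v ord0) : R).

Lemma skew_part_algebra (a p q r s : R) :
  (a *: (p : R^o) + q : R) - (a *: (r : R^o) + s : R) = a *: ((p - r : R) : R^o) + (q - s) :> R^o.
Proof. by rewrite scalerBr opprD addrACA. Qed.

Lemma skew_part_alt x (N : Hfib H x -> Hdual H x) : linear N -> altform (skew_part N).
Proof.
move=> lN; have E2 u v : skew_part N [tuple u; v] = (N u v : R) - (N v u : R) by [].
apply: altform2 => [v a p q|u a p q|u].
- rewrite !E2 lN linearP add_lfunE scale_lfunE; exact: skew_part_algebra.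
- rewrite !E2 lN linearP add_lfunE scale_lfunE; exact: skew_part_algebra.
- by rewrite E2 subrr.
Qed.

Lemma levi_alt (U : set M) (al : forall x, cotangent x) x : open U -> smooth_form U al -> U x ->
  altform (levi H al x).
Proof.
move=> oU sal Ux.
have E2 u v : levi H al x [tuple u; v] = ext_deriv al (vsval u : tangent x) (vsval v : tangent x) by [].
apply: altform2 => [v a p q|u a p q|u].
- by rewrite !E2 linearP (ext_deriv_linearl oU sal Ux).
- by rewrite !E2 linearP (ext_deriv_linearr oU sal Ux).
- have := ext_derivC al (vsval u : tangent x) (vsval u : tangent x).
  by rewrite E2 => e; lra.
Qed.

Lemma summand_jtrace b x (B : Hform H 2 x) : altform B ->
  (forall u v, vsval v \in summand E F b x -> B [tuple u; v] = 0) -> jtrace (JJ x) B = 0.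
Proof.
move=> aB h; have [f fx] := aframe_at contactH splitH smooth_sg sg_neq0 x.
case: b h => h.
- exact: (ann2F_jtrace contactH splitH smooth_sg sg_neq0 (af_ok f) fx aB h).
- exact: (ann2E_jtrace contactH splitH smooth_sg sg_neq0 (af_ok f) fx aB h).
Qed.

Definition torsion_on (V : set M) (D : Hop H) : Prop :=
  forall b (a : forall x, Hdual H x) (at_ : forall x : M, cotangent x),
    Hdual_section V a -> lifts V a at_ -> (forall y, V y -> ann (summand E F b) (a y)) ->
    forall x, V x -> exists p, forall u v : Hfib H x, vsval v \in summand E F (~~ b) x ->
      tors D a at_ u v = p * (JJ x [tuple u; v] : R).

Section At.
Variables (U : set M) (D : Hop H) (a : forall x, Hdual H x) (at_ : forall x : M, cotangent x) (x : M).
Hypotheses (oU : open U) (sal : smooth_form U at_) (Ux : U x) (lD : linear (@D a x)).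

Let N := skew_part (@D a x).
Let L := levi H at_ x.
Let aN : altform N := skew_part_alt lD.
Let aL : altform L := levi_alt oU sal Ux.

Let torsE p u v : (N - L - p *: JJ x) [tuple u; v]
  = tors D a at_ u v - p * (JJ x [tuple u; v] : R) :> R.
Proof. by []. Qed.

(** The form [N - L - p *: J] vanishes on the summand and is therefore
    trace-free, so it is the difference of the projections. *)
Lemma tors_perp b p : (forall u v : Hfib H x, vsval v \in summand E F b x ->
    tors D a at_ u v = p * (JJ x [tuple u; v] : R)) ->
  ann2 (summand E F b) (nabla_perp D a x - rumin_lift H at_ x).
Proof.
move=> hp.
have aB : altform (N - L - p *: JJ x).
  apply: altformB; first exact: altformB.
  by apply: altformZ; exact: (Jform_alt contactH splitH smooth_sg sg_neq0).
have vB u v : vsval v \in summand E F b x -> (N - L - p *: JJ x) [tuple u; v] = 0.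
  by move=> vb; rewrite torsE hp// subrr.
have e : perp N - perp L = N - L - p *: JJ x.
  exact: (perp_diff_tracefree contactH splitH smooth_sg sg_neq0 aN aL (summand_jtrace aB vB)).
have -> : nabla_perp D a x - rumin_lift H at_ x = N - L - p *: JJ x by exact: e.
by split.
Qed.

Lemma perp_tors b : ann2 (summand E F b) (nabla_perp D a x - rumin_lift H at_ x) ->
  exists p, forall u v : Hfib H x, vsval v \in summand E F b x ->
    tors D a at_ u v = p * (JJ x [tuple u; v] : R).
Proof.
have [p e] := perp_diff contactH splitH smooth_sg sg_neq0 aN aL.
have -> : nabla_perp D a x - rumin_lift H at_ x = N - L - p *: JJ x by exact: e.
move=> [_ h]; exists p => u v vb; have := h u v vb; rewrite torsE => /eqP.
by rewrite subr_eq0 => /eqP.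
Qed.

End At.

(** The projection [perp] subtracts a multiple of the Levi form, so passing
    between a form and its projection is harmless up to such a multiple. *)
Lemma minimal_torsionP (D : Hop H) :
  (forall U a x, open U -> Hdual_section U a -> U x -> linear (D a x)) ->
  minimal_torsion E F D <-> forall U, open U -> torsion_on U D.
Proof.
move=> lD; split=> [h U oU b a at_ sa la ha x Ux|h U a at_ oU sa la].
  have [hF hE] := h U a at_ oU sa la; have [sat _] := la.
  have lDx := lD U a x oU sa Ux.
  by case: b ha => ha; [exact: (perp_tors oU sat Ux lDx (b := false) (hE ha x Ux))
    |exact: (perp_tors oU sat Ux lDx (b := true) (hF ha x Ux))].
have [sat _] := la; split=> ha x Ux; have lDx := lD U a x oU sa Ux.
  have [p hp] := h U oU false a at_ sa la ha x Ux.
  exact: (tors_perp oU sat Ux lDx (b := true) hp).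
have [p hp] := h U oU true a at_ sa la ha x Ux.
exact: (tors_perp oU sat Ux lDx (b := false) hp).
Qed.

End MinimalTorsion.

(** * The induced connections determine the metric equations *)

Section SmallDeterminants.
Variable R : realType.
Implicit Types f g : nat -> nat -> R.

Lemma det_first_row n f : \det (\matrix_(i < n.+1, j < n.+1) f i j) =
  \sum_(j < n.+1) (-1) ^+ j * f 0%N j * \det (\matrix_(i < n, k < n) f i.+1 (bump j k)).
Proof.
rewrite (expand_det_row _ ord0); apply: eq_bigr => j _.
rewrite mxE /cofactor add0n mulrA [f _ _ * _]mulrC; congr (_ * \det _).
by apply/matrixP => i k; rewrite !mxE.
Qed.

Lemma det2_entries f : \det (\matrix_(i < 2, j < 2) f i j) =
  f 0%N 0%N * f 1%N 1%N - f 0%N 1%N * f 1%N 0%N.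
Proof.
rewrite (det_first_row 1 f); under eq_bigr => j _ do rewrite det_mx11 mxE.
rewrite !big_ord_recl big_ord0 /= /bump /=; ring.
Qed.

Lemma det3_entries f : \det (\matrix_(i < 3, j < 3) f i j) =
  f 0%N 0%N * (f 1%N 1%N * f 2%N 2%N - f 1%N 2%N * f 2%N 1%N)
  - f 0%N 1%N * (f 1%N 0%N * f 2%N 2%N - f 1%N 2%N * f 2%N 0%N)
  + f 0%N 2%N * (f 1%N 0%N * f 2%N 1%N - f 1%N 1%N * f 2%N 0%N).
Proof.
rewrite (det_first_row 2 f).
under eq_bigr => j _ do rewrite (det2_entries (fun i k => f i.+1 (bump j k))).
rewrite !big_ord_recl big_ord0 /= /bump /=; ring.
Qed.

(** For [f i a] the value of the coframe form [i] on the vector [a], [J] is the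
    Levi form; so this is the identity J /\ J = - 2 w_0 /\ w_1 /\ w_2 /\ w_3. *)
Lemma pfaffian4 f : let J a b := f 0%N a * f 2%N b - f 2%N a * f 0%N b
    + (f 1%N a * f 3%N b - f 3%N a * f 1%N b) in
  2 * (J 0%N 1%N * J 2%N 3%N - J 0%N 2%N * J 1%N 3%N + J 0%N 3%N * J 1%N 2%N)
  = - 2 * \det (\matrix_(i < 4, j < 4) f i j).
Proof.
rewrite /= (det_first_row 3 f).
under eq_bigr => j _ do rewrite (det3_entries (fun i k => f i.+1 (bump j k))).
rewrite !big_ord_recl big_ord0 /= /bump /=; ring.
Qed.

(** The derivative of the determinant at the identity is the trace. *)
Lemma det_derivative_id n (g : 'I_n -> 'I_n -> R) :
  \sum_i \det (\matrix_(a, b) if a == i then g i b else (b == a)%:R) = \sum_i g i i.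
Proof.
apply: eq_bigr => i _.
have := det_replace_row (1%:M : 'M[R]_n) (\matrix_(a, b) g a b) i.
have -> : \det (\matrix_(a, b) (if a == i then (\matrix_(a', b') g a' b') i b else (1%:M : 'M[R]_n) a b))
  = \det (\matrix_(a, b) if a == i then g i b else (b == a)%:R).
  congr (\det _); apply/matrixP => a b; rewrite !mxE; case: (a == i) => //.
  by rewrite eq_sym.
move=> ->; rewrite (bigD1 i) //= big1 => [|j ji].
  have := congr1 (fun A : 'M[R]_n => A i i) (adj1 R n); rewrite !mxE eqxx => ->.
  by rewrite mulr1 addr0.
have := congr1 (fun A : 'M[R]_n => A j i) (adj1 R n); rewrite !mxE (negbTE ji) => ->.
by rewrite mulr0.
Qed.

End SmallDeterminants.

Section Wedge.
Variables (R : realType) (M : smooth_manifold R 5) (H : vdistribution M).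

Lemma wedge2E x (b : 'I_2 -> Hdual H x) (u v : Hfib H x) : wedge b [tuple u; v]
  = (b ord0 u : R) * (b ord_max v : R) - (b ord0 v : R) * (b ord_max u : R) :> R.
Proof.
pose f (i j : nat) : R := b (inord i) (nth 0 [:: u; v] j).
have -> : wedge b [tuple u; v] = \det (\matrix_(i < 2, j < 2) f i j).
  by rewrite /wedge; congr (\det _); apply/matrixP => i j; rewrite !mxE /f inord_val (tnth_nth 0).
have i0 : inord 0 = ord0 :> 'I_2 by apply: val_inj; rewrite /= inordK.
have i1 : inord 1 = ord_max :> 'I_2 by apply: val_inj; rewrite /= inordK.
by rewrite det2_entries /f i0 i1.
Qed.

Lemma Hform_sumE k x (I : Type) (r : seq I) (f : I -> Hform H k x) t :
  (\sum_(i <- r) f i) t = \sum_(i <- r) (f i t : R) :> R.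
Proof. by rewrite fct_sumE. Qed.

Lemma partial_connection_pconn (V : set M) (D : Hop H) : open V ->
  partial_connection (V := Lambda1_H H) D -> pconn_on V D.
Proof.
move=> oV pD; split.
- by move=> a b sa sb e x v Vx; have [_ h _ _] := pD V oV a sa; exact: (h b sb e x Vx v).
- by move=> a b c sa sb x v Vx; have [_ _ h _] := pD V oV a sa; exact: (h c b sb x Vx v).
- by move=> a f sa sf x v Vx; have [_ _ _ h] := pD V oV a sa; exact: (h f sf x Vx v).
- by move=> a sa x Vx; have [[h _] _ _ _] := pD V oV a sa; exact: h.
Qed.

End Wedge.

Section Scale.
Variables (R : realType) (n : nat) (M : smooth_manifold R n) (H : vdistribution M).

Lemma Hform_section_scale k (U : set M) (s : forall x, Hform H k x) (c : R) : open U ->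
  Hform_section U s -> Hform_section U (fun x => c *: s x).
Proof.
move=> oU [al sm]; split=> [x Ux|V X oV VU sX]; first exact: (altformZ c (al x Ux)).
exact: (smooth_funM oV (smooth_fun_cst V (c : R^o)) (sm V X oV VU sX)).
Qed.

End Scale.

Section NecessityAlgebra.
Variable R : realType.

(** The first hypothesis says that the derivative of the Levi form, written with
    the coefficients [G], is [c] times the Levi form. The trace of [G] is then
    [2 * c], and the second hypothesis makes it zero. *)
Lemma metric_from_scale_and_trace (c : R) (G : nat -> nat -> R) :
  let d (i a : nat) : R := (a == i)%:R in
  (forall a b, (a < 4)%N -> (b < 4)%N -> c * symp R a b =
    G 0%N a * d 2%N b - G 0%N b * d 2%N a + (d 0%N a * G 2%N b - d 0%N b * G 2%N a)
    + (G 1%N a * d 3%N b - G 1%N b * d 3%N a + (d 1%N a * G 3%N b - d 1%N b * G 3%N a))) ->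
  G 0%N 0%N + G 1%N 1%N + G 2%N 2%N + G 3%N 3%N = 0 ->
  forall i k, (i < 4)%N -> (k < 4)%N -> same i k -> G i k + G (dual_index k) (dual_index i) = 0.
Proof.
move=> d h tr i k i4 k4 sik.
have := h 0%N 2%N isT isT; have := h 1%N 3%N isT isT; have := h 0%N 3%N isT isT; have := h 1%N 2%N isT isT.
rewrite /symp /d /= => e1 e2 e3 e4.
by case: i i4 sik => [|[|[|[|//]]]] _; case: k k4 => [|[|[|[|//]]]] _ //= _; lra.
Qed.

End NecessityAlgebra.

Section Necessity.
Variables (R : realType) (M : smooth_manifold R 5) (H E F : vdistribution M).
Hypothesis contactH : contact_distribution H.
Hypothesis splitH : legendrean_splitting H E F.
Variable sg : forall x : M, 'Hom(subvs_of (Lfib H x), R^o).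
Hypothesis smooth_sg : Ldual_section sg.
Hypothesis sg_neq0 : forall x : M, sg x != 0.
Variables (U : set M) (X : nat -> forall y : M, tangent y) (Z : forall y : M, tangent y).
Variables (w : nat -> forall y : M, cotangent y) (tau : forall y : M, cotangent y).
Hypothesis afr : is_aframe E F sg U X Z w tau.
Let fr : is_frame H E F U X Z w tau := aframe_frame afr.
Let oU : open U. Proof. exact: frame_open fr. Qed.

Local Notation xh := (XH H X).
Local Notation wh := (wH H w).
Local Notation "'JJ' x" := (@Jform R M H sg x) (at level 10, x at level 9).

Lemma symp_form (f g : nat -> R) :
  \sum_(j < 4) \sum_(k < 4) f j * g k * symp R j k
  = f 0%N * g 2%N - f 2%N * g 0%N + (f 1%N * g 3%N - f 3%N * g 1%N).
Proof. rewrite !big_ord_recl !big_ord0 /= /bump /= /symp /=; ring. Qed.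

Lemma J_coframe y (u v : Hfib H y) : U y -> JJ y [tuple u; v] =
  (wh 0 y u : R) * (wh 2 y v : R) - (wh 2 y u : R) * (wh 0 y v : R)
  + ((wh 1 y u : R) * (wh 3 y v : R) - (wh 3 y u : R) * (wh 1 y v : R)) :> R.
Proof.
move=> Uy; rewrite (J_expand contactH splitH smooth_sg sg_neq0 afr u v Uy).
exact: (symp_form (fun j => wh j y u) (fun j => wh j y v)).
Qed.

(* the forms [w p] and [w (p + 2)], whose wedge product is a summand of the Levi form *)
Let pr (p : nat) (i : 'I_2) : forall y, Hdual H y := wh (i.*2 + p).
Let S2 p y : Hform H 2 y := wedge (fun i => pr p i y).
Let S4 y : Hform H 4 y := wedge (fun i : 'I_4 => wh i y).
Arguments S2 : clear implicits.
Arguments S4 : clear implicits.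

Let pr_section p i : (p < 2)%N -> Hdual_section U (pr p i).
Proof.
move=> p2; apply: (wH_section fr oU (@subset_refl _ U)).
by case: i => [[|[|//]] q]; case: p p2 => [|[|]].
Qed.

Let J_S2 y : U y -> JJ y = 1 *: S2 0 y + S2 1 y.
Proof.
move=> Uy; apply/funext => t; rewrite scale1r [in LHS](tuple2E t) (J_coframe _ _ Uy).
have -> : (S2 0 y + S2 1 y) t = (S2 0 y t : R) + (S2 1 y t : R) by [].
rewrite (tuple2E t) /S2 !wedge2E; congr (_ - _ + (_ - _)); exact: mulrC.
Qed.

Let J_S4 y : U y -> wedge_square (JJ y) = - 2 *: S4 y.
Proof.
move=> Uy; apply/funext => t; rewrite /wedge_square !(J_coframe _ _ Uy).
apply: etrans (pfaffian4 (fun i a => wh i y (tnth t (inord a)))) _.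
have -> : (- 2 *: S4 y) t = - 2 * (S4 y t : R) by [].
congr (_ * \det _); apply/matrixP => i a; rewrite !mxE inord_val; reflexivity.
Qed.

Variable D : Hop H.
Hypothesis D2ex : exists D2, Defs.induced D D2 /\
  preserves (V := Lambda_H H 2) (@levi_line _ _ _ H) D2.
Hypothesis D4ex : annihilates_sigma_sq sg D.
Variables (x : M) (v : Hfib H x).
Hypothesis Ux : U x.

Let g i (u : Hfib H x) : R := @D (wh i) x v u.

(** The connection on forms of degree 4 kills [wedge_square J], a constant
    multiple of the wedge product of the coframe; the derivative of the latter is
    its multiple by the trace of the connection. *)
Lemma trace_connection : \sum_(i < 4) g i (xh i x) = 0.
Proof.
have [D4 [[pD4 ind4] D4J]] := D4ex.
have sw (i : 'I_4) : Hdual_section U (wh i) := wH_section fr oU (@subset_refl _ U) (ltn_ord i).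
have sS : Hform_section U S4 := wedge_section sw.
have sS' := Hform_section_scale (-2) oU sS.
have sJ : Hform_section U (fun y => wedge_square (JJ y)).
  by apply: (Hform_section_eq oU _ sS') => y Uy; rewrite J_S4.
have [_ loc _ _] := pD4 U oU _ sJ; have [_ _ _ leib] := pD4 U oU _ sS.
have e1 := loc _ sS' J_S4 x Ux v.
have e2 := leib (fun=> -2) (smooth_fun_cst U (-2 : R^o)) x Ux v.
have e3 := ind4 U oU _ sw x Ux v.
have e4 : D4 S4 x v = 0.
  have : - 2 *: D4 S4 x v = 0.
    apply: etrans (D4J x v); apply/esym; apply: (etrans e1); apply: (etrans e2).
    by rewrite dirder_cst scale0r addr0.
  by move/eqP; rewrite scaler_eq0 oppr_eq0 pnatr_eq0 => /eqP.
have := congr1 (fun B : Hform H 4 x => B [tuple xh i x | i < 4]) (etrans (esym e3) e4).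
rewrite Hform_sumE => e; rewrite -(det_derivative_id (fun i k : 'I_4 => g i (xh k x))).
apply: etrans e; apply: eq_bigr => i _; congr (\det _); apply/matrixP => a b; rewrite !mxE tnth_mktuple.
case: eqP => [->|_] //.
exact: (esym (wH_XH fr Ux (ltn_ord a) (ltn_ord b))).
Qed.

(** The induced connection is applied to w_0 /\ w_2 + w_1 /\ w_3, which is the
    Levi form. *)
Lemma levi_line_connection : exists c, forall u u' : Hfib H x,
  c * (JJ x [tuple u; u'] : R) =
  g 0 u * (wh 2 x u' : R) - g 0 u' * (wh 2 x u : R) + ((wh 0 x u : R) * g 2 u' - (wh 0 x u' : R) * g 2 u)
  + (g 1 u * (wh 3 x u' : R) - g 1 u' * (wh 3 x u : R) + ((wh 1 x u : R) * g 3 u' - (wh 1 x u' : R) * g 3 u)).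
Proof.
have [D2 [[pD2 ind2] D2J]] := D2ex.
have sS p : (p < 2)%N -> Hform_section U (S2 p).
  by move=> p2; exact: (wedge_section (fun i => pr_section i p2)).
have sJ := Jform_section contactH splitH smooth_sg sg_neq0 oU.
have sJ' : Hform_section U (fun y => 1 *: S2 0 y + S2 1 y) by exact: (Hform_section_eq oU J_S2 sJ).
have [_ loc _ _] := pD2 U oU _ sJ; have [_ _ lin _] := pD2 U oU _ (sS 0%N isT).
have e1 := loc _ sJ' J_S2 x Ux v.
have e2 := lin 1 _ (sS 1%N isT) x Ux v.
have e3 p (p2 : (p < 2)%N) := ind2 U oU _ (fun i => pr_section i p2) x Ux v.
have lJ := D2J U oU _ sJ (fun y _ => Jform_line contactH splitH smooth_sg sg_neq0 y) x Ux v.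
have [c ec] := (levi_lineP contactH splitH smooth_sg sg_neq0 _).1 lJ.
exists c => u u'.
have ep p : (p < 2)%N -> D2 (S2 p) x v [tuple u; u'] =
   g p u * (wh (p.+2) x u' : R) - g p u' * (wh p.+2 x u : R)
   + ((wh p x u : R) * g p.+2 u' - (wh p x u' : R) * g p.+2 u).
  move=> p2; have := congr1 (fun B : Hform H 2 x => B [tuple u; u'] : R) (e3 p p2).
  move=> e; apply: (etrans e); rewrite Hform_sumE; apply: (etrans (sum_ord2 _)).
  by rewrite !wedge2E.
have := congr1 (fun B : Hform H 2 x => B [tuple u; u'] : R) (etrans (esym ec) (etrans e1 e2)).
move=> e; apply: (etrans e); rewrite scale1r; congr (_ + _); exact: ep.
Qed.

Lemma metric_of_induced i k : (i < 4)%N -> (k < 4)%N -> same i k ->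
  g i (xh k x) + g (dual_index k) (xh (dual_index i) x) = 0.
Proof.
have [c hc] := levi_line_connection; have := trace_connection.
rewrite sum_ord4 !inordK// => tr.
apply: (metric_from_scale_and_trace (c := c) (G := fun i k => g i (xh k x)) _ tr) => a b a4 b4.
by have := hc (xh a x) (xh b x); rewrite (J_XH afr Ux a4 b4) !(wH_XH fr Ux).
Qed.

End Necessity.

(** * Existence and uniqueness *)

Section Final.
Variables (R : realType) (M : smooth_manifold R 5) (H E F : vdistribution M).
Hypothesis contactH : contact_distribution H.
Hypothesis splitH : legendrean_splitting H E F.
Variable sg : forall x : M, 'Hom(subvs_of (Lfib H x), R^o).
Hypothesis smooth_sg : Ldual_section sg.
Hypothesis sg_neq0 : forall x : M, sg x != 0.

Definition weyl_connection (D : Hop H) :=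
  [/\ partial_connection (V := Lambda1_H H) D, compatible E F D,
      annihilates_sigma_sq sg D & minimal_torsion E F D].

Lemma partial_connection_linear (D : Hop H) : partial_connection (V := Lambda1_H H) D ->
  forall U a x, open U -> Hdual_section U a -> U x -> linear (D a x).
Proof. by move=> pD U a x oU sa Ux; have [[h _] _ _ _] := pD U oU a sa; exact: h. Qed.

Lemma glued_weyl : weyl_connection (glued_conn contactH splitH smooth_sg sg_neq0).
Proof.
have pD := glued_partial_connection contactH splitH smooth_sg sg_neq0; split=> //.
- exact: glued_compatible.
- exact: glued_sigma_sq.
- apply/(minimal_torsionP contactH splitH smooth_sg sg_neq0 (partial_connection_linear pD)).
  by move=> U oU b a at_ sa la ha x Ux; exact: (glued_torsion contactH splitH smooth_sg sg_neq0 oU sa la ha Ux).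
Qed.

(** Each of the required properties contributes one kind of equation. *)
Lemma weyl_connection_system (D : Hop H) (f : aframe E F sg) x : weyl_connection D -> af_dom f x ->
  levi_civita_system (fun i j k => Kc (af_X f) (af_w f) i j k x)
    (fun j i k => D (wH H (af_w f) i) x (XH H (af_X f) j x) (XH H (af_X f) k x) : R).
Proof.
move=> [pD [pE pF D2] D4 mt] fx; have oU := frame_open (af_ok f).
have tD := (minimal_torsionP contactH splitH smooth_sg sg_neq0 (partial_connection_linear pD)).1 mt _ oU.
apply: (system_of_conditions (af_ok f) oU (@subset_refl _ _) _ _ _ fx).
- by case=> a sa ha v; [exact: (pE _ oU a sa ha x fx v)|exact: (pF _ oU a sa ha x fx v)].
- by move=> b a at_ sa la ha; exact: (tD b a at_ sa la ha x fx).
- move=> j i k j4 i4 k4 s.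
  exact: (metric_of_induced contactH splitH smooth_sg sg_neq0 (af_ok f) D2 D4 (XH H (af_X f) j x) fx i4 k4 s).
Qed.

Lemma weyl_connection_unique (D D' : Hop H) : weyl_connection D -> weyl_connection D' ->
  forall U (a : forall x, Hdual H x), open U -> Hdual_section U a -> forall x, U x -> forall v, D a x v = D' a x v.
Proof.
move=> wD wD' U a oU sa x Ux v; have [f fx] := aframe_at contactH splitH smooth_sg sg_neq0 x.
have oW : open (U `&` af_dom f) by apply: openI => //; exact: (frame_open (af_ok f)).
have [pD _ _ _] := wD; have [pD' _ _ _] := wD'.
have sa' := Hdual_section_sub (@subIsetl _ U (af_dom f)) sa.
exact: (system_agree (af_ok f) oW (@subIsetr _ _ _) v (partial_connection_pconn oW pD)
  (partial_connection_pconn oW pD') (weyl_connection_system wD fx) (weyl_connection_system wD' fx) sa' (conj Ux fx)).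
Qed.

End Final.

Theorem proposition8p2 (R : realType) (M : smooth_manifold R 5)
    (H E F : vdistribution M)
    (contactH : contact_distribution H)
    (splitH : legendrean_splitting H E F)
    (sg : forall x : M, 'Hom(subvs_of (Lfib H x), R^o))
    (smooth_sg : Ldual_section sg)
    (sg_neq0 : forall x : M, sg x != 0) :
  let good nabla :=
    [/\ partial_connection (V := Lambda1_H H) nabla,
        compatible E F nabla,
        annihilates_sigma_sq sg nabla
      & minimal_torsion E F nabla] in
  exists nabla, good nabla /\
    forall nabla', good nabla' ->
      forall U (w : forall x, Hdual H x), open U -> Hdual_section U w ->
        forall x, U x -> forall v, nabla' w x v = nabla w x v.
Proof.
move=> good; have wc := glued_weyl contactH splitH smooth_sg sg_neq0.
exists (glued_conn contactH splitH smooth_sg sg_neq0); split; first exact: wc.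
move=> D wD U a oU sa x Ux v.
exact: (weyl_connection_unique contactH splitH smooth_sg sg_neq0 wD wc oU sa Ux v).
Qed.
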